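(* Let $\mathbb{H}=\{(z_1,z_2)\in\mathbb{C}^2:|z_1|<|z_2|<1\}$ and let $k\in\mathbb{N}_0$. Then $$\mathfrak{H}^2_k(\mathbb{H})=\Big\{\sum_{(j,\ell)\in\mathbb{Z}^2}\hat f_{j,\ell}\,e^{i(j\theta_1+\ell\theta_2)}\in L^2(\mathbb{T}):\ \hat f_{j,\ell}=0\ \text{ if }\ \min\{j,\ell+j+k\}<0\Big\}.$$ In particular, the filtration $\{\mathfrak{H}^2_k(\mathbb{H})\}_{k\in\mathbb{N}_0}$ does not stabilize. Moreover, $$s_k(z,w)=\frac{1}{4\pi^2}\,\frac{(z_2\overline{w}_2)^{-(k-1)}}{(z_2\overline{w}_2-z_1\overline{w}_1)(1-z_2\overline{w}_2)},\qquad z\in\mathbb{H},\ w\in\mathbb{T},$$ is the Szegő kernel for $\mathfrak{H}^2_k(\mathbb{H})$.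
   Context: $\mathbb{N}_0=\{0,1,2,\dots\}$. $\mathbb{T}=b\mathbb{D}\times b\mathbb{D}$, where $\mathbb{D}\subset\mathbb{C}$ is the open unit disk, is endowed with the measure $\sigma_{\mathbb{T}}$, the product of the arc-length measures on the two circles, and $L^2(\mathbb{T})=L^2(\mathbb{T},\sigma_{\mathbb{T}})$; $(\theta_1,\theta_2)$ are polar coordinates on $\mathbb{T}$. For $k\in\mathbb{N}_0$, $\mathcal{A}_k(\mathbb{H})$ is the set of $F\in\mathcal{O}(\mathbb{H})\cap\mathcal{C}(\mathbb{H}\cup\mathbb{T})$ such that $z_2^kF(z_1,z_2)$ is bounded at $(0,0)$ (i.e. bounded on the intersection of $\mathbb{H}$ with some neighborhood of $(0,0)$). $\mathfrak{H}^2_k(\mathbb{H})$ is the closure of $\mathcal{A}_k(\mathbb{H})|_{\mathbb{T}}$ in $L^2(\mathbb{T})$. ''Does not stabilize'' means there is no $k_0$ with $\mathfrak{H}^2_k(\mathbb{H})=\mathfrak{H}^2_{k_0}(\mathbb{H})$ for all $k\ge k_0$. The Szegő kernel for $\mathfrak{H}^2_k(\mathbb{H})$ is the unique function $s_k:\mathbb{H}\times\mathbb{T}\to\mathbb{C}$ such that, for each $z\in\mathbb{H}$, $\overline{s_k(z,\cdot)}\in\mathfrak{H}^2_k(\mathbb{H})$ and $\operatorname{Ev}_z(f)=\int_{\mathbb{T}}f(w)s_k(z,w)\,d\sigma_{\mathbb{T}}(w)$ for all $f\in\mathfrak{H}^2_k(\mathbb{H})$, where $\operatorname{Ev}_z$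 is the bounded linear functional on $\mathfrak{H}^2_k(\mathbb{H})$ determined by $\operatorname{Ev}_z(F|_{\mathbb{T}})=F(z)$ for $F\in\mathcal{A}_k(\mathbb{H})$. *)

(* Defs.v *)
From HB Require Import structures.
From mathcomp Require Import all_boot all_order all_algebra finmap complex.
From mathcomp Require Import all_classical all_reals all_analysis.

Set Implicit Arguments.
Unset Strict Implicit.
Unset Printing Implicit Defensive.
Import Order.TTheory GRing.Theory Num.Theory.
Import numFieldNormedType.Exports.

Local Open Scope classical_set_scope.
Local Open Scope ring_scope.

(* The topology of R[i] induced by its modulus, and R[i] as a one-dimensional
   normed module over itself. With these, [differentiable F z] for
   F : R[i] * R[i] -> R[i] asks for a differential that is R[i]-linear, so it is
   complex differentiability. *)
HB.instance Definition _ (R : realType) := GRing.ComAlgebra.copy R[i] R[i]^o.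
HB.instance Definition _ (R : realType) := Vector.copy R[i] R[i]^o.
HB.instance Definition _ (R : realType) := NormedModule.copy R[i] R[i]^o.

Section HartogsTriangle.
Variable R : realType.
Local Notation C := R[i].
Local Notation C2 := (R[i] * R[i])%type.
Local Notation angles := (measurableTypeR R * measurableTypeR R)%type.
Local Notation modulus := (@Normc.normc R).

Definition hartogs : set C2 :=
  [set z | `|z.1| < `|z.2| /\ `|z.2| < 1].

Definition torus : set C2 := [set z | `|z.1| = 1 /\ `|z.2| = 1].

(* Polar coordinates (theta_1, theta_2) on the torus. *)
Definition expi (t : R) : C := Complex (cos t) (sin t).
Definition polar (t : angles) : C2 := (expi t.1, expi t.2).

Lemma measurable_angle :
  measurable (`[0, pi *+ 2[%classic : set (measurableTypeR R)).
Proof. exact: measurable_itv. Qed.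

Lemma angle_finite : (@lebesgue_measure R `[0%R, (pi *+ 2)%R[%classic < +oo)%E.
Proof. by rewrite lebesgue_measure_itv/=; case: ifP => _; rewrite ?ltry. Qed.

(* The arc-length measure of the unit circle, read in the coordinate theta:
   the circle is parametrized at unit speed by expi on [0, 2 pi[. *)
Definition arc_length : {finite_measure set (measurableTypeR R) -> \bar R} :=
  mfrestr measurable_angle angle_finite.

(* sigma_T in polar coordinates. A function on the torus is represented by a
   function f on C2, of which only f \o polar, that is, the restriction of f to
   the torus, is ever used. *)
Definition sigmaT : {measure set angles -> \bar R} :=
  (arc_length \x arc_length)%E.

Definition integralT (f : C2 -> C) : C :=
  Complex (\int[sigmaT]_t complex.Re (f (polar t)))
          (\int[sigmaT]_t complex.Im (f (polar t))).

Definition normT (f : C2 -> C) : \bar R :=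
  Lnorm sigmaT 2%:E (fun t => (modulus (f (polar t)))%:E).

(* Elements of L^2(T) are represented by functions, not by classes modulo almost
   everywhere equality: L2T and H2_ k are sets of representatives, stable under
   changing a function to a measurable one equal to it almost everywhere. *)
Definition L2T : set (C2 -> C) :=
  [set f | [/\ measurable_fun setT (fun t : angles => complex.Re (f (polar t))),
               measurable_fun setT (fun t : angles => complex.Im (f (polar t)))
             & (normT f < +oo)%E]].

Definition A_ (k : nat) : set (C2 -> C) :=
  [set F | [/\ (forall z, hartogs z -> differentiable F z),
               {within hartogs `|` torus, continuous F}
             & bounded_near (fun z : C2 => z.2 ^+ k * F z)
                            (within hartogs (nbhs (0 : C2)))]].

Definition H2_ (k : nat) : set (C2 -> C) :=
  [set f | L2T f /\
     forall e : R, 0 < e ->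
       exists2 F, A_ k F & (normT (fun w => f w - F w)%R < e%:E)%E].

(* The value at polar (theta_1, theta_2) is
   exp (i (j theta_1 + l theta_2)), for p = (j, l). *)
Definition monomialT (p : int * int) (w : C2) : C := w.1 ^ p.1 * w.2 ^ p.2.

Definition fourier (f : C2 -> C) (p : int * int) : C :=
  (4 * pi ^+ 2)%:C%C^-1 * integralT (fun w => f w * (monomialT p w)^*).

(* f is the sum in L^2(T), over the index set Z^2 without any prescribed order
   of summation, of the series with coefficients c. *)
Definition sumsT (c : int * int -> C) (f : C2 -> C) : Prop :=
  forall e : R, 0 < e ->
    exists A : {fset int * int}, forall B : {fset int * int},
      (A `<=` B)%fset ->
      (normT (fun w => f w - \sum_(p <- B) c p * monomialT p w)%R < e%:E)%E.

(* Ev is (a representative on functions of) the bounded linear functional Ev_z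
   on H2_ k. *)
Definition is_evaluation (k : nat) (z : C2) (Ev : (C2 -> C) -> C) : Prop :=
  [/\ (forall (a : C) f g, H2_ k f -> H2_ k g ->
         Ev (fun w => a * f w + g w) = a * Ev f + Ev g),
      (exists M : R, forall f, H2_ k f ->
         ((modulus (Ev f))%:E <= M%:E * normT f)%E)
    & (forall F, A_ k F -> Ev F = F z)].

Definition reproduces (k : nat) (s : C2 -> C2 -> C) : Prop :=
  forall z, hartogs z ->
    H2_ k (fun w => (s z w)^*) /\
    exists2 Ev, is_evaluation k z Ev &
      forall f, H2_ k f -> Ev f = integralT (fun w => f w * s z w).

(* Uniqueness is that of an element of L^2(T): s z is determined almost
   everywhere on the torus. *)
Definition is_szego_kernel (k : nat) (s : C2 -> C2 -> C) : Prop :=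
  reproduces k s /\
  forall s', reproduces k s' -> forall z, hartogs z ->
    {ae sigmaT, forall t, s' z (polar t) = s z (polar t)}.

Definition szego_ (k : nat) (z w : C2) : C :=
  (4 * pi ^+ 2)%:C%C^-1 *
  ((z.2 * w.2^*) ^ (- (k%:Z - 1)) /
   ((z.2 * w.2^* - z.1 * w.1^*) * (1 - z.2 * w.2^*))).

End HartogsTriangle.

(* Main.v *)
(* On circles, Goursat's lemma is applied in the coordinates [z = exp (s + i t)]:
   for holomorphic [psi] the integral of [psi (r e^(it))] over [0, 2 pi] does not
   depend on [r].  This gives Cauchy's formula for functions that are holomorphic
   on a punctured disc and bounded at its centre, hence uniform polynomial
   approximation with an explicit error.  The map [(u, v) -> (u v, v)] sends the
   product of the disc and the punctured disc onto the Hartogs triangle, and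
   [v^k F(u v, v)] is bounded near [v = 0] when [F] is in [A_ k]; expanding it
   first in [u], then in [v], shows that [F (s^2 z1, s z2)] with [s < 1] is,
   uniformly on the torus and at any given point, a limit of combinations of the
   monomials [z1^j z2^l] with [j >= 0] and [l + j + k >= 0].  Letting [s] tend to
   1, [H2_ k] is the closure of these combinations.  The description by Fourier
   coefficients follows because the monomials are orthogonal, so that the partial
   sums of the Fourier series are best approximations.  The conjugate of the
   Szego kernel is the sum of [conj (z^p) w^p / (4 pi^2)] over the allowed
   exponents [p]; it reproduces the monomials, hence, by density, every element
   of [A_ k]. *)
Require Import Defs.
From mathcomp Require Import all_boot all_order all_algebra finmap complex.
From mathcomp Require Import all_classical all_reals all_analysis.
From mathcomp Require Import measurable_realfun ring lra.
Import Order.TTheory GRing.Theory Num.Theory.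
Import numFieldNormedType.Exports.
Local Open Scope classical_set_scope.
Local Open Scope ring_scope.

Set Implicit Arguments.
Unset Strict Implicit.
Unset Printing Implicit Defensive.

(** * Goursat's lemma on rectangles *)

(** Cauchy's theorem is needed only for circles about the origin. In logarithmic coordinates these
    are the vertical sides of a rectangle of height 2 pi, whose horizontal sides cancel by
    periodicity, so Goursat's lemma for rectangles in two real variables suffices. The centre itself
    is never reached: as [dz = i z dt], integrands with respect to [dt] carry a factor [z], and
    boundedness near the centre makes the integrals over small circles tend to 0. No removable
    singularity theorem is used. The polynomial approximation of [F] is controlled at the same time
    on the torus and at a chosen point [z] of the triangle. The second control is essential: nothing
    says beforehand that [F z] depends continuously on [F] in L^2(T), so closeness on the torus
    alone would say nothing about [F z]. With both, the reproducing formula passes from monomials to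
    [A_ k], and boundedness of the evaluation then follows from Cauchy-Schwarz. Near [z.2 = 0] only
    the error multiplied by [z.2 ^+ k] is uniformly small, which is harmless on the torus and at a
    fixed [z]. *)

Section RectangleInduction.
Variable R : realType.

Lemma nested_intervals (a b : nat -> R) :
  (forall n, a n <= a n.+1) -> (forall n, b n.+1 <= b n) ->
  (forall n, a n <= b n) -> exists x, forall n, a n <= x <= b n.
Proof.
move=> a_incr b_decr le_ab.
have le_a m n : (m <= n)%N -> a m <= a n.
  by move/nondecreasing_seqP : a_incr; exact.
have le_b m n : (m <= n)%N -> b n <= b m.
  by move/nonincreasing_seqP : b_decr; exact.
have ub_b n : ubound (range a) (b n).
  move=> _ [m _ <-]; have [mn|/ltnW nm] := leqP m n.
    exact: le_trans (le_a _ _ mn) (le_ab n).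
  exact: le_trans (le_ab m) (le_b _ _ nm).
exists (sup (range a)) => n; apply/andP; split.
  by apply: ub_le_sup; [exists (b 0); exact: ub_b | exists n].
by apply: ge_sup; [exists (a 0); exists 0%N | exact: ub_b].
Qed.

(** If [S] failed on the whole rectangle it would fail on one of the four quarters, and so on for
    ever; the failing rectangles shrink to a point, where the local hypothesis contradicts the
    failure. *)
Lemma rectangle_induction (S : R -> R -> R -> R -> Prop) (a b c d : R) :
  a <= b -> c <= d ->
  (forall a' b' c' d', a <= a' -> a' <= b' -> b' <= b ->
     c <= c' -> c' <= d' -> d' <= d ->
     let m := (a' + b') / 2 in let n := (c' + d') / 2 in
     S a' m c' n -> S m b' c' n -> S a' m n d' -> S m b' n d' ->
     S a' b' c' d') ->
  (forall x y, a <= x <= b -> c <= y <= d -> exists2 e, 0 < e &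
     forall a' b' c' d', a <= a' -> b' <= b -> c <= c' -> d' <= d ->
       a' <= x <= b' -> c' <= y <= d' ->
       b' - a' < e -> d' - c' < e -> S a' b' c' d') ->
  S a b c d.
Proof.
move=> leab lecd split_S local_S; apply: contrapT => nS.
pose rect := (R * R * (R * R))%type.
pose bad (q : rect) := [/\ [/\ a <= q.1.1, q.1.1 <= q.1.2 & q.1.2 <= b],
  [/\ c <= q.2.1, q.2.1 <= q.2.2 & q.2.2 <= d] & ~ S q.1.1 q.1.2 q.2.1 q.2.2].
pose half (q q' : rect) := [/\ q.1.1 <= q'.1.1, q'.1.2 <= q.1.2,
  q.2.1 <= q'.2.1, q'.2.2 <= q.2.2 &
  q'.1.2 - q'.1.1 = (q.1.2 - q.1.1) / 2 /\
  q'.2.2 - q'.2.1 = (q.2.2 - q.2.1) / 2].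
(* The assumption [bad q] stands under the existential so that [choice] returns a total function,
   which can be iterated. *)
have step q : exists q', bad q -> bad q' /\ half q q'.
  have [bq|nbq] := pselect (bad q); last by exists q.
  case: q bq => [[a' b'] [c' d']] [/= [h1 h2 h3] [h4 h5 h6] nSq].
  set m := (a' + b') / 2; set n := (c' + d') / 2.
  have hm : a' <= m <= b' by rewrite /m; lra.
  have hn : c' <= n <= d' by rewrite /n; lra.
  have [S1|nS1] := pselect (S a' m c' n); last first.
    by exists ((a', m), (c', n)) => _; rewrite /bad /half /= /m /n; do ?split; lra || done.
  have [S2|nS2] := pselect (S m b' c' n); last first.
    by exists ((m, b'), (c', n)) => _; rewrite /bad /half /= /m /n; do ?split; lra || done.
  have [S3|nS3] := pselect (S a' m n d'); last first.
    by exists ((a', m), (n, d')) => _; rewrite /bad /half /= /m /n; do ?split; lra || done.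
  have [S4|nS4] := pselect (S m b' n d'); last first.
    by exists ((m, b'), (n, d')) => _; rewrite /bad /half /= /m /n; do ?split; lra || done.
  by case: nSq; apply: split_S.
have [f fP] := choice step.
pose q n := iter n f ((a, b), (c, d)).
have bad_q n : bad (q n).
  elim: n => [|n IH]; first by rewrite /bad /=.
  by have [] := fP _ IH.
have half_q n : half (q n) (q n.+1) by have [] := fP _ (bad_q n).
have size_q n : (q n).1.2 - (q n).1.1 = (b - a) / 2 ^+ n /\
                (q n).2.2 - (q n).2.1 = (d - c) / 2 ^+ n.
  elim: n => [|n [IH1 IH2]]; first by rewrite expr0 !divr1.
  have [_ _ _ _ [-> ->]] := half_q n.
  by rewrite IH1 IH2 -!mulrA -invfM -exprSr.
have [x xP] : exists x, forall n, (q n).1.1 <= x <= (q n).1.2.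
  apply: nested_intervals => n; try by have [] := half_q n.
  by have [[]] := bad_q n.
have [y yP] : exists y, forall n, (q n).2.1 <= y <= (q n).2.2.
  apply: nested_intervals => n; try by have [] := half_q n.
  by have [_ []] := bad_q n.
have [e e0 eP] := local_S x y (xP 0%N) (yP 0%N).
have [N NP] : exists N : nat, ((b - a) + (d - c)) / 2 ^+ N < e.
  have [N NP] : exists N : nat, ((b - a) + (d - c)) / e < N%:R.
    exists (Num.truncn (((b - a) + (d - c)) / e)).+1.
    exact: truncnS_gt.
  exists N; rewrite ltr_pdivrMr ?exprn_gt0// mulrC -ltr_pdivrMr//.
  by rewrite (lt_trans NP)// -natrX ltr_nat ltn_expl.
have [sx sy] := size_q N.
have pow0 : 0 < (2 ^+ N)^-1 :> R by rewrite invr_gt0 exprn_gt0.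
have [[h1 h2 h3] [h4 h5 h6] nSq] := bad_q N.
have ba : 0 <= (b - a) / 2 ^+ N by rewrite mulr_ge0// ?subr_ge0// ltW.
have dc : 0 <= (d - c) / 2 ^+ N by rewrite mulr_ge0// ?subr_ge0// ltW.
move: NP; rewrite mulrDl => NP.
by apply: nSq; apply: eP => //; [rewrite sx; lra | rewrite sy; lra].
Qed.

End RectangleInduction.

(** * Closed differential forms on rectangles *)

Section Green.
Variable R : realType.
Local Notation mu := (@lebesgue_measure R).

Lemma integrable_itv (a b : R) (f : R -> R) :
  (forall x, a <= x <= b -> {for x, continuous f}) ->
  mu.-integrable `[a, b] (EFin \o f).
Proof.
move=> cf; apply: continuous_compact_integrable; first exact: segment_compact.
by apply: continuous_in_subspaceT => x /set_mem /=; rewrite in_itv /=; exact: cf.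
Qed.

Lemma Rintegral_itv_bound (a b K : R) (f : R -> R) : a <= b ->
  (forall x, a <= x <= b -> {for x, continuous f}) ->
  (forall x, a <= x <= b -> `|f x| <= K) ->
  `|\int[mu]_(x in `[a, b]) f x| <= K * (b - a).
Proof.
move=> leab cf fK; have intf := integrable_itv cf.
apply: le_trans (le_normr_Rintegral _ intf) _ => //.
have -> : K * (b - a) = \int[mu]_(x in `[a, b]) K.
  rewrite Rintegral_cst//= lebesgue_measure_itv /=.
  case: ifP; rewrite lte_fin => // /negbT; rewrite -leNgt => ba.
  by have -> : a = b; [apply/eqP; rewrite eq_le leab ba | rewrite subrr].
apply: le_Rintegral => //.
- exact: integrable_norm intf.
- by apply: integrable_itv => x _; exact: cst_continuous.
Qed.

Lemma Rintegral_itv_cst (a b r : R) : a <= b ->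
  \int[mu]_(x in `[a, b]) r = r * (b - a).
Proof.
move=> leab.
rewrite Rintegral_cst//= lebesgue_measure_itv /=.
case: ifP; rewrite lte_fin => // /negbT; rewrite -leNgt => ba.
by have -> : a = b; [apply/eqP; rewrite eq_le leab ba | rewrite subrr].
Qed.

Lemma Rintegral_itv_split (a m b : R) (f : R -> R) : a <= m -> m <= b ->
  (forall x, a <= x <= b -> {for x, continuous f}) ->
  \int[mu]_(x in `[a, b]) f x =
  \int[mu]_(x in `[a, m]) f x + \int[mu]_(x in `[m, b]) f x.
Proof.
move=> am mb cf; have intf := integrable_itv cf.
have -> : \int[mu]_(x in `[m, b]) f x = \int[mu]_(x in `]m, b]) f x.
  rewrite [RHS]Rintegral_itv_obnd_cbnd//.
  apply: (@integrableS _ _ _ mu `[a, b]) => //.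
  by apply: subset_itvr; rewrite bnd_simp.
by rewrite -(@Rintegral_itvB _ f (BLeft a) (BRight b) m) ?bnd_simp//; lra.
Qed.

Lemma near_dist_lt (x0 d : R) : 0 < d -> \forall x \near x0, `|x - x0| < d.
Proof. by move=> d0; exists d => // x; rewrite /ball_/= distrC. Qed.

(** Pointwise closedness of the form [P dx + Q dy]: [P] and [Q] are differentiable at the point, and
    the same [B] serves as the [y]-derivative of [P] and the [x]-derivative of [Q]. No continuity of
    the partial derivatives is asked for. *)
Definition closed_form_at (P Q : R -> R -> R) (x0 y0 : R) :=
  exists A B C : R, forall e, 0 < e -> exists2 d, 0 < d &
    forall x y, `|x - x0| < d -> `|y - y0| < d ->
      `|P x y - P x0 y0 - A * (x - x0) - B * (y - y0)|
         <= e * (`|x - x0| + `|y - y0|) /\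
      `|Q x y - Q x0 y0 - B * (x - x0) - C * (y - y0)|
         <= e * (`|x - x0| + `|y - y0|).

Lemma affine_approx_continuous (f : R -> R -> R) (x0 y0 A B : R) :
  (forall e, 0 < e -> exists2 d, 0 < d &
    forall x y, `|x - x0| < d -> `|y - y0| < d ->
      `|f x y - f x0 y0 - A * (x - x0) - B * (y - y0)|
         <= e * (`|x - x0| + `|y - y0|)) ->
  {for x0, continuous (f ^~ y0)} /\ {for y0, continuous (f x0)}.
Proof.
move=> /(_ 1 ltr01) [d d0 dP].
have K0 : 0 < `|A| + `|B| + 1 by rewrite ltr_wpDl// addr_ge0.
split; apply/cvgrPdist_lt => e e0.
- near=> x; rewrite distrC.
  have := dP x y0; rewrite !subrr normr0 addr0 mulr0 subr0 mul1r => h.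
  have hx : `|x - x0| < d by near: x; exact: near_dist_lt.
  have hx2 : `|x - x0| < e / (`|A| + `|B| + 1).
    by near: x; apply: near_dist_lt; rewrite divr_gt0.
  have [h1] := h hx d0; move: hx2; rewrite ltr_pdivlMr// => hx2.
  have : `|f x y0 - f x0 y0| <= `|x - x0| + `|A| * `|x - x0|.
    rewrite -normrM -[X in `|X|](subrK (A * (x - x0))).
    by apply: le_trans (ler_normD _ _) _; rewrite lerD2r.
  have := normr_ge0 B; have := normr_ge0 (x - x0) => *; nra.
- near=> y; rewrite distrC.
  have := dP x0 y; rewrite !subrr normr0 add0r mulr0 subr0 mul1r => h.
  have hx : `|y - y0| < d by near: y; exact: near_dist_lt.
  have hx2 : `|y - y0| < e / (`|A| + `|B| + 1).
    by near: y; apply: near_dist_lt; rewrite divr_gt0.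
  have [h1] := h d0 hx; move: hx2; rewrite ltr_pdivlMr// => hx2.
  have : `|f x0 y - f x0 y0| <= `|y - y0| + `|B| * `|y - y0|.
    rewrite -normrM -[X in `|X|](subrK (B * (y - y0))).
    by apply: le_trans (ler_normD _ _) _; rewrite lerD2r.
  have := normr_ge0 A; have := normr_ge0 (y - y0) => *; nra.
Unshelve. all: by end_near. Qed.

Lemma closed_form_continuous P Q x y : closed_form_at P Q x y ->
  [/\ {for x, continuous (P ^~ y)}, {for y, continuous (P x)},
      {for x, continuous (Q ^~ y)} & {for y, continuous (Q x)}].
Proof.
move=> [A [B [C h]]].
have [|? ?] := @affine_approx_continuous P x y A B.
  by move=> e /h [d d0 dP]; exists d => // u v hu hv; have [] := dP u v hu hv.
have [|? ?] := @affine_approx_continuous Q x y B C.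
  by move=> e /h [d d0 dP]; exists d => // u v hu hv; have [] := dP u v hu hv.
by split.
Qed.

(** The counterclockwise boundary integral of [P dx + Q dy], with opposite sides paired under one
    integral so that their common terms cancel pointwise. *)
Definition circulation (P Q : R -> R -> R) a b c d :=
  \int[mu]_(x in `[a, b]) (P x c - P x d) +
  \int[mu]_(y in `[c, d]) (Q b y - Q a y).

(** Each inner side is run through twice, in opposite directions. *)
Lemma circulation_quarters P Q a b c d m n :
  a <= m <= b -> c <= n <= d ->
  (forall x y, a <= x <= b -> c <= y <= d -> closed_form_at P Q x y) ->
  circulation P Q a b c d =
  circulation P Q a m c n + circulation P Q m b c n +
  circulation P Q a m n d + circulation P Q m b n d.
Proof.
move=> /andP[am mb] /andP[cn nd] cl.
have cP x y : a <= x <= b -> c <= y <= d -> {for x, continuous (P ^~ y)}.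
  by move=> hx hy; have [] := closed_form_continuous (cl x y hx hy).
have cQ x y : a <= x <= b -> c <= y <= d -> {for y, continuous (Q x)}.
  by move=> hx hy; have [] := closed_form_continuous (cl x y hx hy).
have PD a' b' c' d' : a <= a' -> b' <= b -> c <= c' <= d -> c <= d' <= d ->
    \int[mu]_(x in `[a', b']) (P x c' - P x d') =
    \int[mu]_(x in `[a', b']) P x c' - \int[mu]_(x in `[a', b']) P x d'.
  by move=> *; rewrite RintegralB//; apply: integrable_itv => x hx; apply: cP => //; lra.
have QD a' b' c' d' : c <= c' -> d' <= d -> a <= a' <= b -> a <= b' <= b ->
    \int[mu]_(y in `[c', d']) (Q b' y - Q a' y) =
    \int[mu]_(y in `[c', d']) Q b' y - \int[mu]_(y in `[c', d']) Q a' y.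
  by move=> *; rewrite RintegralB//; apply: integrable_itv => x hx; apply: cQ => //; lra.
rewrite /circulation !PD; try lra.
rewrite !QD; try lra.
have PS y : c <= y <= d -> \int[mu]_(x in `[a, b]) P x y =
    \int[mu]_(x in `[a, m]) P x y + \int[mu]_(x in `[m, b]) P x y.
  by move=> hy; apply: Rintegral_itv_split => // x hx; exact: cP.
have QS x : a <= x <= b -> \int[mu]_(y in `[c, d]) Q x y =
    \int[mu]_(y in `[c, n]) Q x y + \int[mu]_(y in `[n, d]) Q x y.
  by move=> hx; apply: Rintegral_itv_split => // y hy; exact: cQ.
rewrite !PS ?QS; try lra.
Qed.

(** The affine part of the form has zero circulation: the terms in [A] and [C] cancel between
    opposite sides, and the two contributions of the common [B] are opposite. Only the remainders
    are left, of size [e] times the side lengths, integrated along the sides. *)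
Lemma circulation_small P Q A B C x0 y0 a b c d e :
  0 <= e -> a <= x0 <= b -> c <= y0 <= d ->
  (forall x y, a <= x <= b -> c <= y <= d -> closed_form_at P Q x y) ->
  (forall x y, a <= x <= b -> c <= y <= d ->
      `|P x y - P x0 y0 - A * (x - x0) - B * (y - y0)|
         <= e * (`|x - x0| + `|y - y0|) /\
      `|Q x y - Q x0 y0 - B * (x - x0) - C * (y - y0)|
         <= e * (`|x - x0| + `|y - y0|)) ->
  `|circulation P Q a b c d| <= 4 * e * ((b - a) ^+ 2 + (d - c) ^+ 2).
Proof.
move=> e0 hx0 hy0 cl ap.
have hab : a <= b by lra.
have hcd : c <= d by lra.
have cP x y : a <= x <= b -> c <= y <= d -> {for x, continuous (P ^~ y)}.
  by move=> hx hy; have [] := closed_form_continuous (cl x y hx hy).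
have cQ x y : a <= x <= b -> c <= y <= d -> {for y, continuous (Q x)}.
  by move=> hx hy; have [] := closed_form_continuous (cl x y hx hy).
have dist x y : a <= x <= b -> c <= y <= d ->
    e * (`|x - x0| + `|y - y0|) <= e * ((b - a) + (d - c)).
  move=> hx hy; apply: ler_wpM2l => //; apply: lerD; rewrite ler_norml; lra.
have cPD x : a <= x <= b -> {for x, continuous (fun x => P x c - P x d)}.
  by move=> hx; apply: cvgB; apply: cP => //; lra.
have cQD y : c <= y <= d -> {for y, continuous (fun y => Q b y - Q a y)}.
  by move=> hx; apply: cvgB; apply: cQ => //; lra.
have cstc (r x : R) : {for x, continuous (fun _ : R => r)} by exact: cst_continuous.
have -> : circulation P Q a b c d =
    \int[mu]_(x in `[a, b]) (P x c - P x d + B * (d - c)) +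
    \int[mu]_(y in `[c, d]) (Q b y - Q a y - B * (b - a)).
  rewrite RintegralD//; [|exact: integrable_itv|exact: integrable_itv].
  rewrite [X in _ = _ + X]RintegralB//; [|exact: integrable_itv|exact: integrable_itv].
  by rewrite !Rintegral_itv_cst// /circulation; ring.
apply: le_trans (ler_normD _ _) _.
have bP : `|\int[mu]_(x in `[a, b]) (P x c - P x d + B * (d - c))| <=
    2 * e * ((b - a) + (d - c)) * (b - a).
  apply: Rintegral_itv_bound => // x hx.
    by apply: cvgD; [exact: (cPD x hx)|exact: cstc].
  have [||h1 _] := ap x c => //; first lra.
  have [||h2 _] := ap x d => //; first lra.
  have k1 := dist x c hx; have k2 := dist x d hx.
  have -> : P x c - P x d + B * (d - c) =
     (P x c - P x0 y0 - A * (x - x0) - B * (c - y0)) -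
     (P x d - P x0 y0 - A * (x - x0) - B * (d - y0)) by ring.
  apply: le_trans (ler_normB _ _) _.
  have := le_trans h1 (k1 ltac:(lra)); have := le_trans h2 (k2 ltac:(lra)); lra.
have bQ : `|\int[mu]_(y in `[c, d]) (Q b y - Q a y - B * (b - a))| <=
    2 * e * ((b - a) + (d - c)) * (d - c).
  apply: Rintegral_itv_bound => // y hy.
    by apply: cvgB; [exact: (cQD y hy)|exact: cstc].
  have [||_ h1] := ap b y => //; first lra.
  have [||_ h2] := ap a y => //; first lra.
  have k1 := dist b y; have k2 := dist a y.
  have -> : Q b y - Q a y - B * (b - a) =
     (Q b y - Q x0 y0 - B * (b - x0) - C * (y - y0)) -
     (Q a y - Q x0 y0 - B * (a - x0) - C * (y - y0)) by ring.
  apply: le_trans (ler_normB _ _) _.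
  have := le_trans h1 (k1 ltac:(lra) hy); have := le_trans h2 (k2 ltac:(lra) hy); lra.
apply: le_trans (lerD bP bQ) _.
(* For side lengths [p] and [q] the two bounds add up to [2 * e * (p + q) ^+ 2]; this square brings
   the sum below [4 * e * (p ^+ 2 + q ^+ 2)]. *)
have : 0 <= e * ((b - a) - (d - c)) ^+ 2 by rewrite mulr_ge0// sqr_ge0.
move=> h; lra.
Qed.

Lemma goursat P Q a b c d : a <= b -> c <= d ->
  (forall x y, a <= x <= b -> c <= y <= d -> closed_form_at P Q x y) ->
  circulation P Q a b c d = 0.
Proof.
move=> leab lecd cl.
suff bound (e : R) : 0 < e ->
    `|circulation P Q a b c d| <= e * ((b - a) ^+ 2 + (d - c) ^+ 2).
  apply/eqP; rewrite -normr_le0; apply/ler_addgt0Pl => e e0; rewrite addr0.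
  have K0 : 0 < (b - a) ^+ 2 + (d - c) ^+ 2 + 1.
    by rewrite ltr_wpDl// addr_ge0// sqr_ge0.
  apply: le_trans (bound (e / ((b - a) ^+ 2 + (d - c) ^+ 2 + 1)) _) _.
    exact: divr_gt0.
  by rewrite mulrAC ler_pdivrMr// ler_pM2l// lerDl.
move=> e0.
(* [(b - a)^2 + (d - c)^2] is additive when a rectangle is cut into four equal
   parts, so the bound passes from the quarters to the whole. *)
pose S a b c d := `|circulation P Q a b c d| <= e * ((b - a) ^+ 2 + (d - c) ^+ 2).
apply: (@rectangle_induction R S) => //.
- move=> a' b' c' d' h1 h2 h3 h4 h5 h6 m n.
  rewrite /S /m /n => S1 S2 S3 S4.
  rewrite (@circulation_quarters P Q a' b' c' d' ((a' + b') / 2) ((c' + d') / 2));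
    [|lra|lra|by move=> x y hx hy; apply: cl; lra].
  apply: (le_trans (ler_normD _ _)).
  apply: (le_trans (lerD (ler_normD _ _) (lexx _))).
  apply: (le_trans (lerD (lerD (ler_normD _ _) (lexx _)) (lexx _))).
  lra.
- move=> x y hx hy; have [A [B [C h]]] := cl x y hx hy.
  (* The quarter absorbs the factor 4 of [circulation_small]. *)
  have [|dlt dlt0 dP] := h (e / 4); first by rewrite divr_gt0.
  exists dlt => // a' b' c' d' h1 h2 h3 h4 hx' hy' sx sy; rewrite /S.
  have e4 : 0 <= e / 4 by lra.
  have cl' u v : a' <= u <= b' -> c' <= v <= d' -> closed_form_at P Q u v.
    by move=> hu hv; apply: cl; lra.
  have := circulation_small e4 hx' hy' cl' (A := A) (B := B) (C := C).
  rewrite mulrCA mulfV ?mulr1 ?pnatr_eq0//; apply.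
  by move=> u v hu hv; apply: dP; rewrite ltr_norml; lra.
Qed.

(** Periodicity removes the horizontal sides from the vanishing circulation; the two vertical sides
    remain. *)
Lemma goursat_periodic P Q a b c d : a <= b -> c <= d ->
  (forall x, P x c = P x d) ->
  (forall x y, a <= x <= b -> c <= y <= d -> closed_form_at P Q x y) ->
  \int[mu]_(y in `[c, d]) Q a y = \int[mu]_(y in `[c, d]) Q b y.
Proof.
move=> leab lecd per cl; have := goursat leab lecd cl; rewrite /circulation.
rewrite (@eq_Rintegral _ _ _ _ _ (fun=> 0)) => [|x _]; last by rewrite per subrr.
rewrite Rintegral_itv_cst// mul0r add0r RintegralB//.
- by move/eqP; rewrite subr_eq0 => /eqP.
- apply: integrable_itv => y hy.
  by have [] := closed_form_continuous (cl b y ltac:(lra) hy).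
- apply: integrable_itv => y hy.
  by have [] := closed_form_continuous (cl a y ltac:(lra) hy).
Qed.

End Green.

(** * The modulus and the topology of the complex numbers *)

Section ComplexModulus.
Variable R : realType.
Local Notation C := R[i].
Local Notation modulus := (@Normc.normc R).
Implicit Types (z w : C) (e r : R).

Lemma normE z : `|z| = (modulus z)%:C%C. Proof. by []. Qed.

Lemma modulus_ge0 z : 0 <= modulus z.
Proof. by case: z => x y; exact: sqrtr_ge0. Qed.

Lemma modulus0 : modulus 0 = 0. Proof. exact: Normc.normc0. Qed.

Lemma modulus1 : modulus 1 = 1. Proof. exact: Normc.normc1. Qed.

Lemma modulusM z w : modulus (z * w) = modulus z * modulus w.
Proof. exact: Normc.normcM. Qed.

Lemma modulusV z : modulus z^-1 = (modulus z)^-1.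
Proof. exact: Normc.normcV. Qed.

Lemma modulusX z n : modulus (z ^+ n) = modulus z ^+ n.
Proof. by elim: n => [|n IH]; rewrite ?expr0 ?modulus1// !exprS modulusM IH. Qed.

Lemma modulusD z w : modulus (z + w) <= modulus z + modulus w.
Proof. by have := ler_normD z w; rewrite !normE -rmorphD lecR. Qed.

Lemma modulusN z : modulus (- z) = modulus z.
Proof. by apply: complexI; rewrite -!normE normrN. Qed.

Lemma modulusB z w : modulus (z - w) <= modulus z + modulus w.
Proof. by rewrite -(modulusN w) modulusD. Qed.

Lemma modulusC z w : modulus (z - w) = modulus (w - z).
Proof. by rewrite -modulusN opprB. Qed.

Lemma modulus_conj z : modulus (z^*)%C = modulus z.
Proof. by apply: complexI; rewrite -!normE normcJ. Qed.

Lemma modulus_eq0 z : (modulus z == 0) = (z == 0).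
Proof.
apply/eqP/eqP => [|->]; last exact: modulus0.
exact: Normc.eq0_normc.
Qed.

Lemma modulus_gt0 z : (0 < modulus z) = (z != 0).
Proof. by rewrite lt_neqAle modulus_ge0 andbT eq_sym modulus_eq0. Qed.

Lemma modulus_real r : modulus r%:C%C = `|r|.
Proof. by rewrite /= expr0n /= addr0 sqrtr_sqr. Qed.

Lemma sqr_modulus z : modulus z ^+ 2 = complex.Re z ^+ 2 + complex.Im z ^+ 2.
Proof. by case: z => x y /=; rewrite sqr_sqrtr// addr_ge0// sqr_ge0. Qed.

Lemma modulus_Re z : `|complex.Re z| <= modulus z.
Proof.
rewrite -(@ler_pXn2r _ 2) ?nnegrE ?modulus_ge0 ?normr_ge0//.
by rewrite sqr_modulus real_normK ?num_real// lerDl sqr_ge0.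
Qed.

Lemma modulus_Im z : `|complex.Im z| <= modulus z.
Proof.
rewrite -(@ler_pXn2r _ 2) ?nnegrE ?modulus_ge0 ?normr_ge0//.
by rewrite sqr_modulus real_normK ?num_real// lerDr sqr_ge0.
Qed.

Lemma modulus_le z : modulus z <= `|complex.Re z| + `|complex.Im z|.
Proof.
rewrite -(@ler_pXn2r _ 2) ?nnegrE ?modulus_ge0 ?addr_ge0//.
rewrite sqr_modulus sqrrD !real_normK ?num_real//.
by rewrite -addrA lerD2l lerDr mulrn_wge0// mulr_ge0.
Qed.

Lemma Re_add z w : complex.Re (z + w) = complex.Re z + complex.Re w.
Proof. by case: z; case: w. Qed.

Lemma Im_add z w : complex.Im (z + w) = complex.Im z + complex.Im w.
Proof. by case: z; case: w. Qed.

Lemma Re_opp z : complex.Re (- z) = - complex.Re z.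
Proof. by case: z. Qed.

Lemma Im_opp z : complex.Im (- z) = - complex.Im z.
Proof. by case: z. Qed.

Lemma Re_mul z w : complex.Re (z * w) =
  complex.Re z * complex.Re w - complex.Im z * complex.Im w.
Proof. by case: z; case: w. Qed.

Lemma Im_mul z w : complex.Im (z * w) =
  complex.Re z * complex.Im w + complex.Im z * complex.Re w.
Proof. by case: z => a b; case: w => c d /=; rewrite [b * c]mulrC. Qed.

Lemma modulus_expi (t : R) : modulus (expi t) = 1.
Proof. by rewrite /expi /= cos2Dsin2 sqrtr1. Qed.

Lemma expiD (s t : R) : expi (s + t) = expi s * expi t :> C.
Proof. by apply/eqP; rewrite eq_complex /= cosD sinD addrC eqxx /= addrC [cos s * _]mulrC [sin s * _]mulrC addrC mulrC [sin t * _]mulrC eqxx. Qed.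

Lemma expi0 : expi 0 = 1 :> C.
Proof. by rewrite /expi cos0 sin0. Qed.

Lemma expi_2pi : expi (pi *+ 2) = 1 :> C.
Proof. by rewrite /expi cos2pi sin2pi. Qed.

Lemma cvg_modulusP (T : Type) (F : set_system T) (FF : Filter F) (f : T -> C) l :
  f @ F --> l <-> forall e : R, 0 < e -> \forall x \near F, modulus (f x - l) < e.
Proof.
split=> [/cvgrPdist_lt h e e0|h].
  have := h e%:C%C; rewrite ltcR => /(_ e0); apply: filterS => x.
  by rewrite normE ltcR modulusC.
apply/cvgrPdist_lt => -[e e'].
(* The order of [R[i]] compares only numbers with equal imaginary parts, so a positive tolerance is
   real. *)
rewrite ltcE /= => /andP[/eqP -> e0]; apply: filterS (h e e0) => x.
by rewrite distrC normE ltcR.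
Qed.

Lemma nbhs_complexP z (P : set C) :
  nbhs z P <-> exists2 d : R, 0 < d & forall w, modulus (w - z) < d -> P w.
Proof.
split=> [/nbhs_normP[[e e']]|[d d0 dP]].
  rewrite /= ltcE /= => /andP[/eqP -> e0] eP; exists e => // w h.
  by apply: eP; rewrite /= distrC normE ltcR.
apply/nbhs_normP; exists d%:C%C; first by rewrite /= ltcR.
by move=> w /=; rewrite distrC normE ltcR; exact: dP.
Qed.

Lemma nbhs_realP (x : R) (P : set R) :
  nbhs x P <-> exists2 d : R, 0 < d & forall y, `|y - x| < d -> P y.
Proof.
split=> [/nbhs_normP[e e0 eP]|[d d0 dP]].
  by exists e => // w h; apply: eP; rewrite /= distrC.
by apply/nbhs_normP; exists d => // w /=; rewrite distrC; exact: dP.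
Qed.

Lemma continuous_Re (T : topologicalType) (f : T -> C) x :
  {for x, continuous f} -> {for x, continuous (fun y => complex.Re (f y))}.
Proof.
move=> /cvg_modulusP h; apply/cvgrPdist_lt => e e0.
apply: filterS (h e e0) => y; apply: le_lt_trans.
by rewrite distrC /= -Re_opp -Re_add modulus_Re.
Qed.

Lemma continuous_Im (T : topologicalType) (f : T -> C) x :
  {for x, continuous f} -> {for x, continuous (fun y => complex.Im (f y))}.
Proof.
move=> /cvg_modulusP h; apply/cvgrPdist_lt => e e0.
apply: filterS (h e e0) => y; apply: le_lt_trans.
by rewrite distrC /= -Im_opp -Im_add modulus_Im.
Qed.

Lemma continuous_Complex (T : topologicalType) (f g : T -> R) x :
  {for x, continuous f} -> {for x, continuous g} ->
  {for x, continuous (fun y => Complex (f y) (g y))}.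
Proof.
move=> /cvgrPdist_lt cf /cvgrPdist_lt cg; apply/cvg_modulusP => e e0.
have e2 : 0 < e / 2 by rewrite divr_gt0.
near=> y; apply: le_lt_trans (modulus_le _) _ => /=.
rewrite (splitr e) ltrD//; rewrite distrC.
  by near: y; exact: cf.
by near: y; exact: cg.
Unshelve. all: by end_near. Qed.

Lemma continuous_expi (t : R) : {for t, continuous (@expi R)}.
Proof. by apply: continuous_Complex; [exact: continuous_cos | exact: continuous_sin]. Qed.

(** The differential is [R[i]]-linear on a one-dimensional space, hence multiplication by its value
    at 1. *)
Lemma complex_derivative (f : C -> C) z : differentiable f z ->
  exists D : C, forall e : R, 0 < e -> exists2 d : R, 0 < d &
    forall w, modulus (w - z) < d ->
      modulus (f w - f z - D * (w - z)) <= e * modulus (w - z).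
Proof.
move=> df; exists ('d f z 1) => e e0.
have /eqaddoP /(_ e%:C%C) := diff_locally df; rewrite ltcR => /(_ e0) /nbhs_complexP[d d0 dP].
exists d => // w wz; have := dP (w - z); rewrite subr0 => /(_ wz).
rewrite !fctE /= subrK normE (normE (w - z)) -rmorphM lecR.
suff -> : 'd f z 1 * (w - z) = 'd f z (w - z) by rewrite opprD addrA.
by rewrite -[w - z in RHS]mulr1 -[_ * 1]/(_ *: 1) linearZ /= mulrC.
Qed.

End ComplexModulus.

(** * Consequences of compactness *)

Section UniformSegment.
Variable R : realType.
Local Notation C := R[i].
Local Notation modulus := (@Normc.normc R).

(** A tube argument: around each [y] there is a product neighbourhood on which [Phi] is within
    [e / 2] of [Phi x0 y], and the near-covering form of compactness makes the neighbourhood of [x0]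
    independent of [y]. *)
Lemma uniform_on_segment (T : topologicalType) (Phi : T -> R -> C) (x0 : T) (a b : R) :
  (forall y, a <= y <= b -> {for (x0, y), continuous (fun p => Phi p.1 p.2)}) ->
  forall e : R, 0 < e ->
    \forall x \near x0, forall y, a <= y <= b -> modulus (Phi x y - Phi x0 y) < e.
Proof.
move=> cPhi e e0.
have /compact_near_coveringP := @segment_compact R a b.
move=> /(_ T (nbhs x0) (fun x y => modulus (Phi x y - Phi x0 y) < e) _) h.
apply: filterS (h _) => [x hx y hy|y].
  by apply: hx; rewrite /= in_itv.
rewrite /= in_itv /= => hy.
have e2 : 0 < e / 2 by rewrite divr_gt0.
have /cvg_modulusP/(_ _ e2) [[U V] /= [Ux0 Vy] UV] := cPhi y hy.
exists (V, U) => //= -[y' x] /= [Vy' Ux].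
have h1 := UV (x, y') (conj Ux Vy').
have h2 := UV (x0, y') (conj (nbhs_singleton Ux0) Vy').
rewrite /= in h1 h2.
rewrite (_ : Phi x y' - Phi x0 y' = (Phi x y' - Phi x0 y) - (Phi x0 y' - Phi x0 y));
  last by rewrite opprB addrA subrK.
by apply: le_lt_trans (modulusB _ _) _; rewrite (splitr e) ltrD.
Qed.

(** Near-covering compactness with the bound [M] as the parameter, tending to [+oo]: near each [y]
    every [M] above [modulus (f y) + 1] is a bound. *)
Lemma continuous_compact_bounded (T : topologicalType) (f : T -> C) (K : set T) :
  compact K -> (forall y, K y -> {for y, continuous f}) ->
  exists2 M : R, 0 <= M & forall y, K y -> modulus (f y) <= M.
Proof.
move=> /compact_near_coveringP cK cf.
have [|M [Mr hM]] := cK R (+oo%R) (fun M y => modulus (f y) <= M) _.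
  move=> y Ky; have /cvg_modulusP/(_ _ ltr01) V := cf y Ky.
  exists ([set y' | modulus (f y' - f y) < 1], [set M | modulus (f y) + 1 < M]).
    split => //; exists (modulus (f y) + 1); split => //; exact: num_real.
  move=> [y' M] /= [h1 h2]; apply: le_trans (ltW h2).
  have := modulusD (f y' - f y) (f y); rewrite subrK => /le_trans; apply.
  by rewrite addrC lerD2l ltW.
exists (Num.max 0 (M + 1)); first by rewrite le_max lexx.
move=> y Ky; rewrite le_max; apply/orP; right.
by apply: hM => //; rewrite ltrDl.
Qed.

End UniformSegment.

(** * Complex-valued integrals *)

Section ComplexIntegral.
Variable R : realType.
Local Notation C := R[i].
Local Notation modulus := (@Normc.normc R).
Context d (T : measurableType d) (mu : {measure set T -> \bar R}) (D : set T).
Hypothesis mD : measurable D.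
Implicit Types f g : T -> C.

(** For [sigmaT] and the whole space this is convertible to [integralT], so the linearity lemmas
    serve both for circles and for the torus. *)
Definition cint f : C :=
  Complex (\int[mu]_(x in D) complex.Re (f x)) (\int[mu]_(x in D) complex.Im (f x)).

Definition cintegrable f :=
  mu.-integrable D (EFin \o (fun x => complex.Re (f x))) /\
  mu.-integrable D (EFin \o (fun x => complex.Im (f x))).

Lemma eq_cint f g : {in D, f =1 g} -> cint f = cint g.
Proof. by move=> fg; congr Complex; apply: eq_Rintegral => x xD; rewrite fg. Qed.

Lemma eq_cintegrable f g : {in D, f =1 g} -> cintegrable f -> cintegrable g.
Proof.
move=> fg [h1 h2]; split; [apply: eq_integrable h1 | apply: eq_integrable h2] => //.
  by move=> x xD /=; rewrite fg.
by move=> x xD /=; rewrite fg.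
Qed.

Lemma cintegrableD f g : cintegrable f -> cintegrable g ->
  cintegrable (fun x => f x + g x).
Proof.
move=> [f1 f2] [g1 g2]; split.
  apply: eq_integrable (integrableD mD f1 g1) => // x xD /=.
  by rewrite Re_add EFinD.
apply: eq_integrable (integrableD mD f2 g2) => // x xD /=.
by rewrite Im_add EFinD.
Qed.

Lemma cintegrableZ (c : C) f : cintegrable f -> cintegrable (fun x => c * f x).
Proof.
move=> [f1 f2]; split.
  have := integrableB mD (integrableZl mD (complex.Re c) f1) (integrableZl mD (complex.Im c) f2).
  by apply: eq_integrable => // x xD /=; rewrite Re_mul EFinB !EFinM.
have := integrableD mD (integrableZl mD (complex.Re c) f2) (integrableZl mD (complex.Im c) f1).
by apply: eq_integrable => // x xD /=; rewrite Im_mul EFinD !EFinM.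
Qed.

Lemma cintD f g : cintegrable f -> cintegrable g ->
  cint (fun x => f x + g x) = cint f + cint g.
Proof.
move=> [f1 f2] [g1 g2]; rewrite /cint; apply/eqP; rewrite eq_complex /=.
rewrite -!RintegralD//; apply/andP; split; apply/eqP; apply: eq_Rintegral => x _.
  by rewrite Re_add.
by rewrite Im_add.
Qed.

Lemma integrableZl_fun (a : R) (h : T -> R) : mu.-integrable D (EFin \o h) ->
  mu.-integrable D (EFin \o (fun x => a * h x)).
Proof.
by move=> /(integrableZl mD a); apply: eq_integrable => // x _ /=; rewrite EFinM.
Qed.

Lemma cintZ (c : C) f : cintegrable f -> cint (fun x => c * f x) = c * cint f.
Proof.
move=> [f1 f2]; rewrite /cint; apply/eqP; rewrite eq_complex Re_mul Im_mul /=.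
rewrite -!RintegralZl// -RintegralD -?RintegralB//; try exact: integrableZl_fun.
apply/andP; split; apply/eqP; apply: eq_Rintegral => x _.
  by rewrite Re_mul.
by rewrite Im_mul.
Qed.

Lemma cintegrable0 : cintegrable (fun=> 0).
Proof.
by split; apply: eq_integrable (integrable0 mu D) => //.
Qed.

Lemma cint0 : cint (fun=> 0) = 0.
Proof. by rewrite /cint /Rintegral !integral0. Qed.

Lemma cintB f g : cintegrable f -> cintegrable g ->
  cint (fun x => f x - g x) = cint f - cint g.
Proof.
move=> hf hg; rewrite -mulN1r -cintZ// -cintD//; last exact: cintegrableZ.
by apply: eq_cint => x _; rewrite mulN1r.
Qed.

Lemma cintegrable_sum (I : Type) (s : seq I) (F : I -> T -> C) :
  (forall i, cintegrable (F i)) -> cintegrable (fun x => \sum_(i <- s) F i x).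
Proof.
move=> hF; elim: s => [|i s IH].
  by apply: eq_cintegrable cintegrable0 => x _; rewrite big_nil.
by apply: eq_cintegrable (cintegrableD (hF i) IH) => x _; rewrite big_cons.
Qed.

Lemma cint_sum (I : Type) (s : seq I) (F : I -> T -> C) :
  (forall i, cintegrable (F i)) ->
  cint (fun x => \sum_(i <- s) F i x) = \sum_(i <- s) cint (F i).
Proof.
move=> hF; elim: s => [|i s IH].
  by rewrite big_nil (@eq_cint _ (fun=> 0)) ?cint0// => x _; rewrite big_nil.
rewrite big_cons -IH -cintD//; last exact: cintegrable_sum.
by apply: eq_cint => x _; rewrite big_cons.
Qed.

(** The factor 2 comes from bounding real and imaginary parts separately; a bound up to a constant
    is enough for every limit argument below. *)
Lemma modulus_cint_le f (K : R) : (mu D < +oo)%E -> 0 <= K ->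
  cintegrable f -> (forall x, D x -> modulus (f x) <= K) ->
  modulus (cint f) <= 2 * (K * fine (mu D)).
Proof.
move=> Doo K0 [f1 f2] fK; apply: le_trans (modulus_le _) _ => /=.
have iK : mu.-integrable D (EFin \o (fun=> K)).
  apply/integrableP; split; first exact: measurable_cst.
  rewrite (eq_integral (fun=> K%:E)) => [|x _ /=]; last by rewrite ger0_norm.
  by rewrite integral_cst// lte_mul_pinfty// ltry.
have bd h : mu.-integrable D (EFin \o h) -> (forall x, D x -> `|h x| <= K) ->
    `|\int[mu]_(x in D) h x| <= K * fine (mu D).
  move=> ih hK; apply: le_trans (le_normr_Rintegral _ ih) _ => //.
  rewrite -(@Rintegral_cst _ _ _ mu D mD K).
  by apply: le_Rintegral => //; exact: integrable_norm ih.
rewrite mulr2n mulrDl mul1r; apply: lerD; apply: bd => // x Dx.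
  exact: le_trans (modulus_Re _) (fK _ Dx).
exact: le_trans (modulus_Im _) (fK _ Dx).
Qed.

End ComplexIntegral.

(** * Integrals over one period of the angle *)

Section CircleIntegral.
Variable R : realType.
Local Notation C := R[i].
Local Notation modulus := (@Normc.normc R).
Local Notation tau := (pi *+ 2 : R).
Implicit Types f g : R -> C.

Definition circ f := cint (@lebesgue_measure R) `[0, tau] f.

Lemma tau_gt0 : 0 < tau.
Proof. by rewrite pmulrn_lgt0// pi_gt0. Qed.

Definition segment_continuous f := forall t, 0 <= t <= tau -> {for t, continuous f}.

Lemma segment_cintegrable f : segment_continuous f ->
  cintegrable (@lebesgue_measure R) `[0, tau] f.
Proof.
move=> cf; split; apply: integrable_itv => x hx.
  exact: continuous_Re (cf x hx).
exact: continuous_Im (cf x hx).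
Qed.

Lemma circB f g : segment_continuous f -> segment_continuous g ->
  circ (fun t => f t - g t) = circ f - circ g.
Proof. by move=> cf cg; apply: cintB => //; exact: segment_cintegrable. Qed.

Lemma circZ (c : C) f : segment_continuous f -> circ (fun t => c * f t) = c * circ f.
Proof. by move=> cf; apply: cintZ => //; exact: segment_cintegrable. Qed.

Lemma circ_sum (I : Type) (s : seq I) (F : I -> R -> C) :
  (forall i, segment_continuous (F i)) ->
  circ (fun x => \sum_(i <- s) F i x) = \sum_(i <- s) circ (F i).
Proof. by move=> cF; apply: cint_sum => // i; exact: segment_cintegrable. Qed.

Lemma eq_circ f g : (forall t, f t = g t) -> circ f = circ g.
Proof. by move=> fg; apply: eq_cint => t _. Qed.

Lemma circ_cst (c : C) : circ (fun=> c) = tau%:C%C * c.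
Proof.
rewrite /circ /cint !Rintegral_itv_cst ?ltW ?tau_gt0// subr0.
by case: c => x y; apply/eqP; rewrite eq_complex /= !mul0r subr0 addr0 ![tau * _]mulrC !eqxx.
Qed.

Lemma circ_le f (K : R) : 0 <= K -> segment_continuous f ->
  (forall t, 0 <= t <= tau -> modulus (f t) <= K) ->
  modulus (circ f) <= 2 * (K * tau).
Proof.
move=> K0 cf fK.
have := @modulus_cint_le R _ _ (@lebesgue_measure R) `[0, tau] _ f K.
rewrite /= lebesgue_measure_itv /= lte_fin tau_gt0 oppr0 addr0 /= => h; apply: h => //; first by rewrite ltry.
- exact: segment_cintegrable.
Qed.

Lemma continuous_circ (T : topologicalType) (Phi : T -> R -> C) (x0 : T) :
  (forall t, 0 <= t <= tau -> {for (x0, t), continuous (fun p => Phi p.1 p.2)}) ->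
  (\forall x \near x0, segment_continuous (Phi x)) ->
  {for x0, continuous (fun x => circ (Phi x))}.
Proof.
move=> cPhi sPhi; apply/cvg_modulusP => e e0.
(* Chosen so that the bound [2 * (e' * tau)] of [circ_le] equals [e / 2]. *)
pose e' := e / (4 * tau).
have t0 := tau_gt0.
have e'0 : 0 < e' by rewrite divr_gt0// mulr_gt0.
have := uniform_on_segment cPhi e'0.
have s0 := nbhs_singleton sPhi.
apply: filterS2 sPhi => x sx hx.
rewrite -circB//.
apply: (@le_lt_trans _ _ (2 * (e' * tau))).
  apply: circ_le => [||t ht]; first exact: ltW.
    move=> t ht; apply: cvgB; [exact: sx|exact: s0].
  by apply/ltW/hx.
rewrite /e'; set a := tau in t0 *; have a0 : a != 0 by rewrite gt_eqF.
have -> : 2 * (e / (4 * a) * a) = e / 2 by clearbody a; field.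
by rewrite ltr_pdivrMr// ltr_pMr ?ltr1n.
Qed.

End CircleIntegral.

(** * Integrals over circles do not depend on the radius *)

Section PolarGoursat.
Variable R : realType.
Local Notation C := R[i].
Local Notation modulus := (@Normc.normc R).
Local Notation tau := (pi *+ 2 : R).

Lemma real_derivative (f : R -> R) x (l : R) : is_derive x (1 : R) f l ->
  forall e, 0 < e -> exists2 d, 0 < d &
    forall y, `|y - x| < d -> `|f y - f x - l * (y - x)| <= e * `|y - x|.
Proof.
move=> [df fl] e e0.
have /derivable1_diffP/diff_locally/eqaddoP/(_ e e0) := df.
move=> /nbhs_realP[d d0 dP]; exists d => // y yx.
have := dP (y - x); rewrite subr0 => /(_ yx).
rewrite !fctE /= subrK opprD addrA.
suff -> : 'd f x (y - x) = l * (y - x) by [].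
by rewrite -[y - x in LHS]mulr1 -[_ * 1]/(_ *: 1) linearZ /= -deriveE ?fl//;
   [rewrite mulrC | exact/derivable1_diffP].
Qed.

(** The first-order expansion at 0 of the exponential of [h + i k], assembled from those of [expR],
    [cos] and [sin]. *)
Lemma polar_increment (e : R) : 0 < e -> exists2 d : R, 0 < d &
  forall h k, `|h| < d -> `|k| < d ->
    modulus ((expR h)%:C%C * expi k - 1 - Complex h k) <= e * (`|h| + `|k|).
Proof.
(* Five terms arise, each at most [3 * (e / 12)] times [|h|] or [|k|]; the minimum with 1 keeps
   [expR h] at most 3. *)
move=> e0; pose e' := Num.min 1 (e / 12).
have e'0 : 0 < e' by rewrite lt_min ltr01 divr_gt0.
have e'1 : e' <= 1 by rewrite ge_min lexx.
have e'6 : e' <= e / 12 by rewrite ge_min lexx orbT.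
have [d1 d10 d1P] := real_derivative (is_derive_expR 0) e'0.
have [d2 d20 d2P] := real_derivative (is_derive_cos 0) e'0.
have [d3 d30 d3P] := real_derivative (is_derive_sin 0) e'0.
exists (Num.min (Num.min d1 d2) (Num.min d3 (Num.min 1 (e / 12)))).
  by rewrite !lt_min d10 d20 d30 ltr01 divr_gt0.
move=> h k; rewrite !lt_min => /andP[/andP[h1 h2] /and3P[h3 h4 h5]].
move=> /andP[/andP[k1 k2] /and3P[k3 k4 k5]].
have := d1P h; rewrite subr0 expR0 mul1r => /(_ h1) eh.
have := d2P k; rewrite subr0 cos0 sin0 oppr0 mul0r subr0 => /(_ k2) ck.
have := d3P k; rewrite subr0 sin0 cos0 mul1r subr0 => /(_ k3) sk.
have E : (expR h)%:C%C * expi k - 1 - Complex h k =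
    Complex (expR h - 1 - h + expR h * (cos k - 1))
            (k * (expR h - 1 - h) + k * h + expR h * (sin k - k)).
  by apply/eqP; rewrite eq_complex /= !mul0r; apply/andP; split; apply/eqP; ring.
have h0 := normr_ge0 h; have k0 := normr_ge0 k.
have eh2 : expR h <= 1 + 2 * `|h|.
  have := le_trans (ler_norm _) eh; have := ler_norm h; nra.
have eh0 := expR_ge0 h.
rewrite E; apply: le_trans (modulus_le _) _ => /=.
apply: le_trans (lerD (ler_normD _ _) (ler_normD _ _)) _.
apply: le_trans (lerD (lexx _) (lerD (ler_normD _ _) (lexx _))) _.
rewrite !normrM (ger0_norm eh0).
set X := `|expR h - 1 - h| in eh *.
set Y := `|cos k - 1| in ck *; set Z := `|sin k - k| in sk *.
have X0 : 0 <= X by exact: normr_ge0.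
have Y0 : 0 <= Y by exact: normr_ge0.
have Z0 : 0 <= Z by exact: normr_ge0.
have eh3 : expR h <= 3 by lra.
have hX : X <= e / 12 * `|h| by apply: le_trans eh _; rewrite ler_wpM2r.
have hY : Y <= e / 12 * `|k| by apply: le_trans ck _; rewrite ler_wpM2r.
have hZ : Z <= e / 12 * `|k| by apply: le_trans sk _; rewrite ler_wpM2r.
have kY : expR h * Y <= 3 * (e / 12 * `|k|) by exact: ler_pM.
have kZ : expR h * Z <= 3 * (e / 12 * `|k|) by exact: ler_pM.
have kX : `|k| * X <= 1 * (e / 12 * `|h|) by apply: ler_pM => //; exact: ltW.
have kh : `|k| * `|h| <= e / 12 * `|h| by apply: ler_wpM2r => //; exact: ltW.
have eh4 : 0 <= e * `|h| by rewrite mulr_ge0// ltW.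
have ek4 : 0 <= e * `|k| by rewrite mulr_ge0// ltW.
lra.
Qed.

Definition log_polar (s t : R) : C := (expR s)%:C%C * expi t.

Lemma modulus_log_polar s t : modulus (log_polar s t) = expR s.
Proof. by rewrite modulusM modulus_real modulus_expi mulr1 ger0_norm// expR_ge0. Qed.

Lemma log_polarD s t h k :
  log_polar (s + h) (t + k) = log_polar s t * ((expR h)%:C%C * expi k).
Proof. by rewrite /log_polar expRD expiD rmorphM mulrACA. Qed.

Lemma log_polar_tau s : log_polar s tau = log_polar s 0.
Proof. by rewrite /log_polar expi0 expi_2pi. Qed.

(* The Cauchy-Riemann equations say that [psi dz / (i z)] is closed; in the
   coordinates [z = exp (s + i t)] its real part is [Im psi ds + Re psi dt]. *)
Lemma closed_form_log_polar (psi : C -> C) s0 t0 :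
  differentiable psi (log_polar s0 t0) ->
  closed_form_at (fun s t => complex.Im (psi (log_polar s t)))
                 (fun s t => complex.Re (psi (log_polar s t))) s0 t0.
Proof.
move=> /complex_derivative [D DP].
set z0 := log_polar s0 t0 in DP *; pose E := D * z0.
(* By the chain rule [E] is the derivative of [psi] composed with the exponential. Imaginary and
   real parts of [E * (h + i k)] give the coefficients of [P] and [Q], and the shared [Re E] is the
   Cauchy-Riemann equation. *)
exists (complex.Im E), (complex.Re E), (- complex.Im E) => e e0.
have mz0 : 0 < modulus z0 by rewrite modulus_log_polar expR_gt0.
have mD := modulus_ge0 D.
(* Half of [e] pays for the differentiability of [psi], through [e1] and the bound [2 * modulus z0]
   on the speed; the other half pays for the expansion of the exponential, through [e2]. The [+ 1]
   in [e2] covers [D = 0]. *)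
pose e1 := e / (4 * modulus z0).
have e10 : 0 < e1 by rewrite divr_gt0// mulr_gt0.
have [d1 d10 d1P] := DP _ e10.
pose e2 := Num.min 1 (e / (2 * (modulus z0 * (modulus D + 1)))).
have e20 : 0 < e2 by rewrite lt_min ltr01 divr_gt0// !mulr_gt0// ltr_wpDl.
have [d2 d20 d2P] := polar_increment e20.
exists (Num.min d2 (d1 / (4 * modulus z0))).
  by rewrite lt_min d20 divr_gt0// mulr_gt0.
move=> s t; rewrite !lt_min => /andP[hs1 hs2] /andP[ht1 ht2].
set h := s - s0 in hs1 hs2 *; set k := t - t0 in ht1 ht2 *.
have zE : log_polar s t = z0 * ((expR h)%:C%C * expi k).
  by rewrite /z0 -log_polarD /h /k !(addrC _ (_ - _)) !subrK.
have inc := d2P h k hs1 ht1.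
set q := _ * expi k in zE inc.
have h0 := normr_ge0 h; have k0 := normr_ge0 k.
have hk : modulus (Complex h k) <= `|h| + `|k| by exact: modulus_le.
have dz : modulus (log_polar s t - z0) <= modulus z0 * (2 * (`|h| + `|k|)).
  rewrite zE -[X in _ - X]mulr1 -mulrBr modulusM ler_wpM2l ?modulus_ge0//.
  have := modulusD (q - 1 - Complex h k) (Complex h k); rewrite subrK => /le_trans; apply.
  rewrite [leRHS]mulrDl mul1r; apply: lerD => //; apply: le_trans inc _.
  by rewrite ler_piMl ?addr_ge0// /e2 ge_min lexx.
have dz1 : modulus (log_polar s t - z0) < d1.
  apply: le_lt_trans dz _; move: hs2 ht2.
  rewrite !ltr_pdivlMr ?mulr_gt0//; lra.
have := d1P _ dz1 => der.
have main : modulus (psi (log_polar s t) - psi z0 - E * Complex h k) <= e * (`|h| + `|k|).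
  have -> : psi (log_polar s t) - psi z0 - E * Complex h k =
    (psi (log_polar s t) - psi z0 - D * (log_polar s t - z0)) +
    E * (q - 1 - Complex h k) by rewrite zE /E; ring.
  apply: le_trans (modulusD _ _) _; rewrite modulusM.
  have b1 : e1 * modulus (log_polar s t - z0) <= e / 2 * (`|h| + `|k|).
    apply: le_trans (ler_wpM2l (ltW e10) dz) _; rewrite /e1 le_eqVlt; apply/orP; left.
    apply/eqP; have : modulus z0 != 0 by rewrite gt_eqF.
    by move: (modulus z0) => a a0; field.
  have b2 : modulus E * modulus (q - 1 - Complex h k) <= e / 2 * (`|h| + `|k|).
    apply: le_trans (ler_wpM2l (modulus_ge0 _) inc) _.
    rewrite mulrA ler_wpM2r ?addr_ge0// /E modulusM.
    have : e2 <= e / (2 * (modulus z0 * (modulus D + 1))) by rewrite /e2 ge_min lexx orbT.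
    rewrite ler_pdivlMr ?mulr_gt0// ?ltr_wpDl// => le2.
    have : 0 <= e2 * modulus z0 by rewrite mulr_ge0// ltW.
    move: le2; lra.
  by have := le_trans der b1; lra.
clearbody E; split.
  apply: le_trans main; apply: le_trans (modulus_Im _).
  by rewrite !Im_add !Im_opp Im_mul /= opprD addrA addrAC.
apply: le_trans main; apply: le_trans (modulus_Re _).
by rewrite !Re_add !Re_opp Re_mul /= mulNr opprK opprB addrA addrAC.
Qed.

Lemma circ_log_polar_Re (psi : C -> C) s1 s2 : s1 <= s2 ->
  (forall z, expR s1 <= modulus z <= expR s2 -> differentiable psi z) ->
  complex.Re (circ (fun t => psi (log_polar s1 t))) =
  complex.Re (circ (fun t => psi (log_polar s2 t))).
Proof.
move=> s12 dpsi.
have tau0 := ltW (tau_gt0 R).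
have cl x y : s1 <= x <= s2 -> 0 <= y <= tau ->
    closed_form_at (fun s t => complex.Im (psi (log_polar s t)))
                   (fun s t => complex.Re (psi (log_polar s t))) x y.
  move=> hx hy; apply: closed_form_log_polar; apply: dpsi.
  by rewrite modulus_log_polar !ler_expR.
have per x : complex.Im (psi (log_polar x 0)) = complex.Im (psi (log_polar x tau)).
  by rewrite log_polar_tau.
exact: goursat_periodic s12 tau0 per cl.
Qed.

(** The imaginary part of [psi] is the real part of the function [- i psi], which is again
    holomorphic. *)
Lemma circ_log_polar (psi : C -> C) s1 s2 : s1 <= s2 ->
  (forall z, expR s1 <= modulus z <= expR s2 -> differentiable psi z) ->
  circ (fun t => psi (log_polar s1 t)) = circ (fun t => psi (log_polar s2 t)).
Proof.
move=> s12 dpsi; apply/eqP; rewrite eq_complex; apply/andP; split; apply/eqP.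
  exact: circ_log_polar_Re.
have E s t : complex.Re ((- 'i)%C * psi (log_polar s t)) = complex.Im (psi (log_polar s t)).
  by rewrite Re_mul /= oppr0 mul0r sub0r mulN1r opprK.
pose phi z := (- 'i)%C * psi z.
have dphi z : expR s1 <= modulus z <= expR s2 -> differentiable phi z.
  by move=> /dpsi; exact: differentiableM (differentiable_cst _ _).
have := circ_log_polar_Re s12 dphi; rewrite /circ /cint /phi /=.
by under eq_Rintegral do rewrite E; under [RHS]eq_Rintegral do rewrite E.
Qed.

End PolarGoursat.

(** * Cauchy's formula on circles *)

Section Cauchy.
Variable R : realType.
Local Notation C := R[i].
Local Notation modulus := (@Normc.normc R).
Local Notation tau := (pi *+ 2 : R).
Implicit Types (psi g : C -> C) (z w : C) (r rho e : R).

Lemma geometric_small (q K e : R) : 0 <= q < 1 -> 0 < e ->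
  exists N, K * q ^+ N < e.
Proof.
move=> /andP[q0 q1] e0.
have h : K * q ^+ n @[n --> \oo] --> 0.
  rewrite -(mulr0 K); apply: cvgM; first exact: cvg_cst.
  by apply: cvg_expr; rewrite ger0_norm.
have /cvgrPdist_lt/(_ e e0) [N _ NP] := h.
exists N; have := NP N (leqnn N); rewrite /= sub0r normrN.
by apply: le_lt_trans; exact: ler_norm.
Qed.

Lemma eq0_le_mul_pos (x : R) (K : R) : 0 <= x ->
  (forall e, 0 < e -> x <= K * e) -> x = 0.
Proof.
move=> x0 h; apply/eqP; rewrite eq_le x0 andbT; apply/ler_addgt0Pl => e e0.
rewrite addr0; apply: le_trans (h (e / (`|K| + 1)) _) _.
  by rewrite divr_gt0// ltr_wpDl.
rewrite mulrA ler_pdivrMr ?ltr_wpDl// [e * _]mulrC ler_pM2r//.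
by apply: le_trans (ler_norm _) _; rewrite lerDl.
Qed.

Lemma continuous_add (T : topologicalType) (f g : T -> C) x :
  {for x, continuous f} -> {for x, continuous g} ->
  {for x, continuous (fun y => f y + g y)}.
Proof. exact: cvgD. Qed.

Lemma continuous_sub (T : topologicalType) (f g : T -> C) x :
  {for x, continuous f} -> {for x, continuous g} ->
  {for x, continuous (fun y => f y - g y)}.
Proof. exact: cvgB. Qed.

Lemma continuous_mul (T : topologicalType) (f g : T -> C) x :
  {for x, continuous f} -> {for x, continuous g} ->
  {for x, continuous (fun y => f y * g y)}.
Proof. exact: cvgM. Qed.

Lemma continuous_inv (T : topologicalType) (f : T -> C) x : f x != 0 ->
  {for x, continuous f} -> {for x, continuous (fun y => (f y)^-1)}.
Proof. by move=> fx0; exact: cvgV. Qed.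

Lemma continuous_const (T : topologicalType) (c : C) x :
  {for x, continuous (fun _ : T => c)}.
Proof. exact: cvg_cst. Qed.

Lemma continuous_pow n z : {for z, continuous (fun w : C => w ^+ n)}.
Proof.
elim: n => [|n IH]; first exact: continuous_const.
rewrite (_ : (fun _ => _) = (fun w => w * w ^+ n)); last first.
  by apply/funext => w; rewrite exprS.
by apply: continuous_mul; [exact: cvg_id | exact: IH].
Qed.

Definition circle (r t : R) : C := r%:C%C * expi t.

Lemma modulus_circle r t : 0 <= r -> modulus (circle r t) = r.
Proof. by move=> r0; rewrite modulusM modulus_real modulus_expi mulr1 ger0_norm. Qed.

Lemma continuous_real_complex (r : R) : {for r, continuous (fun x : R => x%:C%C)}.
Proof. by apply: continuous_Complex; [exact: cvg_id | exact: cvg_cst]. Qed.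

Lemma continuous_circle (p : R * R) :
  {for p, continuous (fun p => circle p.1 p.2)}.
Proof.
apply: cvgM.
  by apply: (cvg_comp _ _ (@cvg_fst _ _ (nbhs p.1) (nbhs p.2) _)) (@continuous_real_complex _).
by apply: (cvg_comp _ _ (@cvg_snd _ _ (nbhs p.1) (nbhs p.2) _)) (@continuous_expi _ _).
Qed.

Lemma continuous_circle_t r t : {for t, continuous (circle r)}.
Proof. by apply: cvgM; [exact: cvg_cst | exact: continuous_expi]. Qed.

Lemma segment_continuous_circle psi r : 0 <= r ->
  (forall z, modulus z = r -> {for z, continuous psi}) ->
  segment_continuous (fun t => psi (circle r t)).
Proof.
move=> r0 cpsi t _; apply: (@continuous_comp _ _ _ (circle r) psi).
  exact: continuous_circle_t.
by apply: cpsi; rewrite modulus_circle.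
Qed.

Lemma circ_radius psi r1 r2 : 0 < r1 -> r1 <= r2 ->
  (forall z, r1 <= modulus z <= r2 -> differentiable psi z) ->
  circ (fun t => psi (circle r1 t)) = circ (fun t => psi (circle r2 t)).
Proof.
move=> r10 r12 dpsi; have r20 : 0 < r2 by exact: lt_le_trans r12.
have := @circ_log_polar _ psi (ln r1) (ln r2).
rewrite /log_polar !lnK ?posrE//; apply; last exact: dpsi.
by rewrite ler_ln ?posrE.
Qed.

Lemma continuous_circ_radius psi rho r0 : 0 < r0 < rho ->
  (forall z, 0 < modulus z < rho -> {for z, continuous psi}) ->
  {for r0, continuous (fun r => circ (fun t => psi (circle r t)))}.
Proof.
move=> /andP[r00 r0rho] cpsi; apply: continuous_circ => [t _|].
  apply: (@continuous_comp _ _ _ (fun p : R * R => circle p.1 p.2) psi).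
    exact: continuous_circle.
  apply: cpsi; change (0 < modulus (circle r0 t) < rho).
  by rewrite modulus_circle ?r00// ltW.
near=> r; apply: segment_continuous_circle => [|z zr].
  by apply: ltW; near: r; exact: lt_nbhsr.
by apply: cpsi; rewrite zr; apply/andP; split; near: r; [exact: lt_nbhsr|exact: lt_nbhsl].
Unshelve. all: by end_near. Qed.

(** The integral is constant in the radius on either side of [modulus z0], and it tends to 0 with
    the radius. Goursat's lemma cannot cross the circle through [z0], where [psi] is only
    continuous; continuity in the radius carries the value 0 across. *)
Lemma circ_vanish psi rho z0 :
  (forall z, 0 < modulus z < rho -> z != z0 -> differentiable psi z) ->
  (forall z, 0 < modulus z < rho -> {for z, continuous psi}) ->
  (forall e, 0 < e -> exists2 d, 0 < d &
     forall z, 0 < modulus z < d -> modulus (psi z) <= e) ->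
  forall r, 0 < r < rho -> circ (fun t => psi (circle r t)) = 0.
Proof.
move=> dpsi cpsi psi0.
set L := fun r => circ (fun t => psi (circle r t)).
(* The second premise is void for [z0 = 0], so that this step then settles every radius. *)
have L0 r : 0 < r < rho -> (0 < modulus z0 -> r < modulus z0) -> L r = 0.
  move=> /andP[r0 rrho] rz0; apply/eqP; rewrite -modulus_eq0; apply/eqP.
  apply: (@eq0_le_mul_pos _ (2 * tau)) (modulus_ge0 _) _ => e e0.
  have [d d0 dP] := psi0 e e0.
  pose s := Num.min r (d / 2).
  have s0 : 0 < s by rewrite lt_min r0 divr_gt0.
  have sr : s <= r by rewrite ge_min lexx.
  have sd : s < d.
    by apply: (@le_lt_trans _ _ (d / 2)); rewrite ?ge_min ?lexx ?orbT// ltr_pdivrMr// ltr_pMr// ltr1n.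
  rewrite /L -(circ_radius s0 sr); last first.
    move=> z /andP[z1 z2]; apply: dpsi.
      by rewrite (lt_le_trans s0 z1) (le_lt_trans z2 rrho).
    apply/eqP => zz0; have : 0 < modulus z0 by rewrite -zz0 (lt_le_trans s0 z1).
    by move=> /rz0; rewrite -zz0 ltNge z2.
  rewrite -mulrA [tau * e]mulrC; apply: circ_le; first exact: ltW.
    apply: segment_continuous_circle => [|z zs]; first exact: ltW.
    by apply: cpsi; rewrite zs s0 (le_lt_trans sr rrho).
  by move=> t _; apply: dP; rewrite modulus_circle ?s0 ?sd// ltW.
have [z00|] := ltP 0 (modulus z0); last first.
  by move=> z00 r hr; apply: L0 => // /(le_lt_trans z00); rewrite ltxx.
(* The critical radius is approached from below, by some [s] within [d] of it. *)
have Lm : modulus z0 < rho -> L (modulus z0) = 0.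
  move=> z0rho; set m := modulus z0 in z00 z0rho *.
  have hm : 0 < m < rho by rewrite z00.
  have /cvg_modulusP cL := continuous_circ_radius hm cpsi.
  apply/eqP; rewrite -modulus_eq0; apply/eqP.
  apply: (@eq0_le_mul_pos _ 1) (modulus_ge0 _) _ => e e0; rewrite mul1r.
  have /nbhs_realP[d d0 dP] := cL e e0.
  pose s := m - Num.min (m / 2) (d / 2).
  have s0 : 0 < s by rewrite subr_gt0 gt_min ltr_pdivrMr// ltr_pMr// ltr1n.
  have sm : s < m by rewrite ltrBlDr ltrDl lt_min !divr_gt0.
  have Ls : L s = 0 by apply: L0 => //; rewrite s0 (lt_trans sm z0rho).
  have := dP s; rewrite -/(L s) Ls.
  rewrite sub0r modulusN => h; apply/ltW/h.
  rewrite ltr0_norm ?subr_lt0// opprB /s opprB addrC subrK gt_min; apply/orP; right.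
  by rewrite ltr_pdivrMr// ltr_pMr// ltr1n.
move=> r hr; have [rz|zr] := ltP r (modulus z0); first exact: L0.
have z0rho : modulus z0 < rho by apply: le_lt_trans zr _; case/andP: hr.
have hm : 0 < modulus z0 < rho by rewrite z00.
have /cvg_modulusP cL := continuous_circ_radius hm cpsi.
apply/eqP; rewrite -modulus_eq0; apply/eqP.
apply: (@eq0_le_mul_pos _ 1) (modulus_ge0 _) _ => e e0; rewrite mul1r.
have /nbhs_realP[d d0 dP] := cL e e0.
move: zr; rewrite le_eqVlt => /predU1P[<-|zr]; first by rewrite -/(L _) Lm// modulus0 ltW.
(* A radius just beyond the critical one, but not beyond [r]: [L s = L r] by Goursat's lemma, and
   [L s] is close to [L (modulus z0) = 0]. *)
pose s := Num.min r (modulus z0 + d / 2).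
have zs : modulus z0 < s by rewrite lt_min zr ltrDl divr_gt0.
have sr : s <= r by rewrite ge_min lexx.
rewrite -/(L r); have <- : L s = L r.
  apply: circ_radius => // [|z /andP[z1 z2]]; first exact: lt_trans zs.
  apply: dpsi.
    rewrite (lt_le_trans (lt_trans z00 zs) z1) (le_lt_trans z2)//.
    by case/andP: hr.
  by apply/eqP => zz0; move: z1; rewrite zz0 leNgt zs.
have := dP s; rewrite -/(L s) -/(L (modulus z0)) Lm// subr0 => h; apply/ltW/h.
rewrite gtr0_norm ?subr_gt0// ltrBlDl; apply: (@le_lt_trans _ _ (modulus z0 + d / 2)).
  by rewrite ge_min lexx orbT.
by rewrite ltrD2l ltr_pdivrMr// ltr_pMr// ltr1n.
Qed.

Lemma differentiable_id z : differentiable (fun w : C => w) z.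
Proof. by apply/derivable1_diffP; exact: derivable_id. Qed.

Lemma differentiable_exp n z : differentiable (fun w : C => w ^+ n) z.
Proof.
elim: n => [|n IH].
  by rewrite (_ : (fun _ => _) = cst 1)//; exact: differentiable_cst.
rewrite (_ : (fun _ => _) = (fun w => w * w ^+ n)); last first.
  by apply/funext => w; rewrite exprS.
by apply: differentiableM; [exact: differentiable_id | exact: IH].
Qed.

Lemma circ_expi_pos n : (0 < n)%N -> circ (fun t => expi t ^+ n : C) = 0.
Proof.
move=> n0.
have := @circ_vanish (fun w => w ^+ n) 2 0 _ _ _ 1.
rewrite ltr01 ltr1n.
rewrite (_ : (fun t => circle 1 t ^+ n) = (fun t => expi t ^+ n)); last first.
  by apply/funext => t; rewrite /circle rmorph1 mul1r.
apply => //.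
- by move=> z _ _; exact: differentiable_exp.
- by move=> z _; exact: continuous_pow.
- move=> e e0; exists (Num.min 1 e); first by rewrite lt_min ltr01.
  move=> z /andP[z0]; rewrite lt_min => /andP[z1 ze]; rewrite modulusX.
  apply: le_trans (ltW ze); case: n n0 => // n _; rewrite exprS.
  by rewrite ler_piMr ?modulus_ge0// exprn_ile1 ?modulus_ge0// ltW.
Qed.

Lemma circ_conj (f : R -> C) : segment_continuous f ->
  circ (fun t => (f t)^*%C) = (circ f)^*%C.
Proof.
move=> cf; rewrite /circ /cint /=.
have E (z : C) : (z^*)%C = Complex (complex.Re z) (- complex.Im z) by case: z.
congr Complex; first by apply: eq_Rintegral => t _; rewrite E.
rewrite -mulN1r -RintegralZl//; last by case: (segment_cintegrable cf).
by apply: eq_Rintegral => t _; rewrite E mulN1r.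
Qed.

Lemma circ_expi_neg n : (0 < n)%N -> circ (fun t => (expi t : C) ^- n) = 0.
Proof.
move=> n0; have E t : (expi t ^- n : C) = ((expi t ^+ n)^*)%C.
  rewrite rmorphXn /= -exprVn; congr (_ ^+ n).
  apply: (mulfI (_ : expi t != 0)); first by rewrite -modulus_gt0 modulus_expi.
  rewrite mulfV -?modulus_gt0 ?modulus_expi//.
  by apply/eqP; rewrite eq_complex /= !mulrN opprK -!expr2 cos2Dsin2 [sin t * _]mulrC addNr !eqxx.
rewrite (eq_circ E) circ_conj ?circ_expi_pos ?conjc0// => t _.
apply: (@continuous_comp _ _ _ (@expi R) (fun w : C => w ^+ n)).
  exact: continuous_expi.
exact: continuous_pow.
Qed.

Lemma circle_neq0 r t : 0 < r -> circle r t != 0.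
Proof. by move=> r0; rewrite -modulus_gt0 modulus_circle// ltW. Qed.

Lemma circ_circle_neg n r : 0 < r ->
  circ (fun t => circle r t ^- n) = if n == 0%N then tau%:C%C else 0.
Proof.
move=> r0; rewrite (@eq_circ _ _ (fun t => (r%:C%C) ^- n * (expi t : C) ^- n)); last first.
  by move=> t; rewrite /circle exprMn invfM.
have [->|n0] := eqVneq n 0%N.
  rewrite (@eq_circ _ _ (fun=> 1)) ?circ_cst ?mulr1// => t.
  by rewrite !expr0 invr1 mulr1.
rewrite circZ ?circ_expi_neg ?mulr0// ?lt0n// => t _.
apply: cvgV; first by rewrite expf_neq0// -modulus_gt0 modulus_expi.
apply: (@continuous_comp _ _ _ (@expi R) (fun w : C => w ^+ n)).
  exact: continuous_expi.
exact: continuous_pow.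
Qed.

(** The geometric series in [z / a] with its exact remainder. On a circle [da / (a - z)] is
    [i a / (a - z) dt], which is why Cauchy's kernel appears as [a / (a - z)]. *)
Lemma kernel_expansion N (a z : C) : a != 0 -> a - z != 0 ->
  a / (a - z) = \sum_(b < N) z ^+ b * a ^- b + z ^+ N * a ^- N * (a / (a - z)).
Proof.
move=> a0 az; elim: N => [|N IH]; first by rewrite big_ord0 add0r expr0 invr1 !mul1r.
rewrite {1}IH big_ord_recr /= -addrA; congr (_ + _).
rewrite !exprS; set u := a ^+ N; have : u != 0 by rewrite expf_neq0.
move: (z ^+ N) u => c u u0; field.
by rewrite az u0.
Qed.

Lemma kernel_remainder N (a z : C) : modulus z < modulus a ->
  modulus (a / (a - z) - \sum_(b < N) z ^+ b * a ^- b)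
  <= (modulus z / modulus a) ^+ N / (1 - modulus z / modulus a).
Proof.
move=> za; have ma0 : 0 < modulus a by apply: le_lt_trans za; exact: modulus_ge0.
have a0 : a != 0 by rewrite -modulus_gt0.
have aza : modulus a - modulus z <= modulus (a - z).
  by rewrite lerBlDr; have := modulusD (a - z) z; rewrite subrK.
have az0 : 0 < modulus a - modulus z by rewrite subr_gt0.
have az : a - z != 0 by rewrite -modulus_gt0 (lt_le_trans az0).
rewrite {1}(kernel_expansion N a0 az) addrAC subrr add0r.
rewrite !modulusM !modulusV !modulusX -expr_div_n.
apply: ler_wpM2l; first by apply: exprn_ge0; apply: divr_ge0; exact: modulus_ge0.
have -> : (1 - modulus z / modulus a)^-1 = modulus a / (modulus a - modulus z).
  by rewrite -[X in X - _](mulfV (lt0r_neq0 ma0)) -mulrBl invfM invrK mulrC.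
by rewrite ler_pM2l// lef_pV2 ?posrE// (lt_le_trans az0).
Qed.

Lemma segment_continuousM (f h : R -> C) : segment_continuous f ->
  segment_continuous h -> segment_continuous (fun t => f t * h t).
Proof. by move=> cf ch t ht; exact: continuous_mul (cf t ht) (ch t ht). Qed.

Lemma segment_continuousB (f h : R -> C) : segment_continuous f ->
  segment_continuous h -> segment_continuous (fun t => f t - h t).
Proof. by move=> cf ch t ht; exact: continuous_sub (cf t ht) (ch t ht). Qed.

Lemma segment_continuous_cst (c : C) : segment_continuous (fun=> c).
Proof. by move=> t ht; exact: continuous_const. Qed.

Lemma segment_continuous_sum (I : Type) (s : seq I) (F : I -> R -> C) :
  (forall i, segment_continuous (F i)) ->
  segment_continuous (fun t => \sum_(i <- s) F i t).
Proof.
move=> cF t ht; elim: s => [|i s IH].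
  rewrite (_ : (fun _ => _) = (fun=> 0)); first exact: continuous_const.
  by apply/funext => u; rewrite big_nil.
rewrite (_ : (fun _ => _) = (fun u => F i u + \sum_(j <- s) F j u)).
  exact: continuous_add (cF i t ht) IH.
by apply/funext => u; rewrite big_cons.
Qed.

Lemma segment_continuous_neg r n : 0 < r ->
  segment_continuous (fun t => circle r t ^- n).
Proof.
move=> r0; apply: (@segment_continuous_circle (fun w => w ^- n)) => [|z zr].
  exact: ltW.
apply: continuous_inv; last exact: continuous_pow.
by rewrite expf_neq0// -modulus_gt0 zr.
Qed.

Lemma segment_continuous_kernel r z : modulus z < r ->
  segment_continuous (fun t => circle r t / (circle r t - z)).
Proof.
move=> zr; apply: (@segment_continuous_circle (fun w => w / (w - z))) => [|w wr].
  by apply: ltW; apply: le_lt_trans zr; exact: modulus_ge0.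
apply: continuous_mul; first exact: cvg_id.
apply: continuous_inv.
  by rewrite subr_eq0; apply/eqP => wz; move: zr; rewrite -wz wr ltxx.
by apply: continuous_sub; [exact: cvg_id|exact: continuous_const].
Qed.

(** Termwise integration of the truncated kernel. It is used with [f = 1] for the integral of the
    kernel itself, and with [f] the values of a holomorphic function for Taylor's formula. *)
Lemma circ_kernel_le N (f : R -> C) r z M : modulus z < r -> 0 <= M ->
  segment_continuous f -> (forall t, 0 <= t <= tau -> modulus (f t) <= M) ->
  modulus (circ (fun t => f t * (circle r t / (circle r t - z))) -
           \sum_(b < N) z ^+ b * circ (fun t => f t * circle r t ^- b))
  <= 2 * tau * (M * ((modulus z / r) ^+ N / (1 - modulus z / r))).
Proof.
move=> zr M0 cf fM; have r0 : 0 < r by apply: le_lt_trans zr; exact: modulus_ge0.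
have q1 : 0 <= 1 - modulus z / r by rewrite subr_ge0 ler_pdivrMr// mul1r ltW.
have cn b := segment_continuousM cf (@segment_continuous_neg r b r0).
have czn b := segment_continuousM (@segment_continuous_cst (z ^+ b)) (cn b).
have ck := segment_continuousM cf (segment_continuous_kernel zr).
have cs := @segment_continuous_sum _ (index_enum 'I_N) _ (fun b : 'I_N => czn b).
have -> : \sum_(b < N) z ^+ b * circ (fun t => f t * circle r t ^- b) =
    circ (fun t => \sum_(b < N) z ^+ b * (f t * circle r t ^- b)).
  rewrite (circ_sum (index_enum 'I_N) (fun b : 'I_N => czn b)).
  by apply: eq_bigr => b _; rewrite (circZ _ (cn b)).
rewrite -(circB ck cs) -mulrA [tau * _]mulrC; apply: circ_le.
- apply: mulr_ge0 => //; apply: mulr_ge0; last by rewrite invr_ge0.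
  by apply: exprn_ge0; apply: divr_ge0; [exact: modulus_ge0|exact: ltW].
- exact: segment_continuousB ck cs.
- move=> t ht.
  rewrite (_ : _ - _ = f t * (circle r t / (circle r t - z) - \sum_(b < N) z ^+ b * circle r t ^- b)).
    rewrite modulusM; apply: ler_pM; rewrite ?modulus_ge0//; first exact: fM.
    have ma := modulus_circle t (ltW r0).
    by have := @kernel_remainder N (circle r t) z; rewrite ma => /(_ zr).
  rewrite mulrBr mulr_sumr; congr (_ - _); apply: eq_bigr => b _.
  by rewrite mulrCA.
Qed.

Lemma circ_kernel r z : modulus z < r ->
  circ (fun t => circle r t / (circle r t - z)) = tau%:C%C.
Proof.
move=> zr; have r0 : 0 < r by apply: le_lt_trans zr; exact: modulus_ge0.
apply/eqP; rewrite -subr_eq0 -modulus_eq0; apply/eqP.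
apply: (@eq0_le_mul_pos _ 1) (modulus_ge0 _) _ => e e0; rewrite mul1r.
set q := modulus z / r.
have q01 : 0 <= q < 1.
  by rewrite divr_ge0 ?modulus_ge0 ?ltW//= ltr_pdivrMr// mul1r.
have [N NP] := @geometric_small q (2 * tau / (1 - q)) e q01 e0.
(* The successor guarantees that the term of index 0, the only one with a nonzero integral, is
   present. *)
have := @circ_kernel_le N.+1 (fun=> 1) r z 1 zr ler01 (@segment_continuous_cst 1).
rewrite modulus1 => /(_ (fun _ _ => lexx _)).
have E1 : circ (fun t => 1 * (circle r t / (circle r t - z))) =
    circ (fun t => circle r t / (circle r t - z)) by apply: eq_circ => t; rewrite mul1r.
have E2 b : circ (fun t => 1 * circle r t ^- b) = if b == 0%N then tau%:C%C else 0.
  by rewrite -(circ_circle_neg b r0); apply: eq_circ => t; rewrite mul1r.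
rewrite E1 big_ord_recl big1 => [|i _]; last by rewrite E2 mulr0.
rewrite E2 expr0 mul1r addr0 => /le_trans; apply.
apply: le_trans (ltW NP); rewrite mul1r -[leRHS]mulrA [_^-1 * _]mulrC ler_wpM2l//.
  by rewrite mulr_ge0// ltW// tau_gt0.
case/andP: q01 => q0 q1.
by rewrite -/q ler_wpM2r ?invr_ge0 ?subr_ge0 ?(ltW q1)// exprS ler_piMl ?exprn_ge0// ltW.
Qed.

(** Apply [circ_vanish] to [z * (g z - g z0) / (z - z0)] and split the integral. The factor [z], due
    to [dz = i z dt], makes this function tend to 0 at the centre as soon as [g] is bounded
    there. *)
Lemma cauchy_formula g rho z0 r :
  (forall z, 0 < modulus z < rho -> differentiable g z) ->
  (exists M d : R, 0 < d /\ forall z, 0 < modulus z < d -> modulus (g z) <= M) ->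
  differentiable g z0 -> modulus z0 < r -> r < rho ->
  circ (fun t => g (circle r t) * (circle r t / (circle r t - z0))) = tau%:C%C * g z0.
Proof.
move=> dg [M [d1 [d10 gM]]] dgz0 z0r rrho.
have r0 : 0 < r by apply: le_lt_trans z0r; exact: modulus_ge0.
have [D DP] := complex_derivative dgz0.
pose q z := z * ((g z - g z0) / (z - z0)).
(* [q] extended by its limit at [z0], where the division by 0 would give 0. *)
pose psi z := if z == z0 then z0 * D else q z.
have psi_near z : z != z0 -> {near z, q =1 psi}.
  move=> zz0; apply/nbhs_complexP; exists (modulus (z - z0)).
    by rewrite modulus_gt0 subr_eq0.
  move=> w wz; rewrite /psi; case: eqP => // wz0.
  by move: wz; rewrite wz0 modulusC ltxx.
have dq z : 0 < modulus z < rho -> z != z0 -> differentiable q z.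
  move=> hz zz0; apply: differentiableM; first exact: differentiable_id.
  apply: differentiableM.
    by apply: differentiableB; [exact: dg | exact: differentiable_cst].
  apply: differentiableV; last by rewrite subr_eq0.
  by apply: differentiableB; [exact: differentiable_id | exact: differentiable_cst].
have dpsi z : 0 < modulus z < rho -> z != z0 -> differentiable psi z.
  move=> hz zz0; apply/derivable1_diffP.
  apply: (near_eq_derivable (psi_near z zz0)).
  by apply/derivable1_diffP; exact: dq.
have cpsi z : 0 < modulus z < rho -> {for z, continuous psi}.
  move=> hz; have [zz0|zz0] := eqVneq z z0; last first.
    exact: differentiable_continuous (dpsi z hz zz0).
  pose h w := if w == z0 then D else (g w - g z0) / (w - z0).
  have -> : psi = (fun w => w * h w).
    by apply/funext => w; rewrite /psi /h; case: eqP => // ->.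
  apply: continuous_mul; first exact: cvg_id.
  rewrite zz0; apply/(@cvg_modulusP R C (nbhs z0) _ h (h z0)) => e e0.
  have [d d0 dP] := DP (e / 2) (divr_gt0 e0 (ltr0n _ 2)).
  apply/nbhs_complexP; exists d => // w wz; rewrite /h eqxx.
  case: (eqVneq w z0) => [_|wz0]; first by rewrite subrr modulus0.
  have m0 : 0 < modulus (w - z0) by rewrite modulus_gt0 subr_eq0.
  rewrite -(ltr_pM2r m0) -modulusM mulrBl divfK ?subr_eq0//.
  apply: le_lt_trans (dP w wz) _.
  by rewrite ltr_pM2r// ltr_pdivrMr// ltr_pMr// ltr1n.
have psi0 e : 0 < e -> exists2 d, 0 < d & forall z, 0 < modulus z < d -> modulus (psi z) <= e.
  (* If [z0 = 0], the factor [z] cancels the denominator and continuity of [g] at 0 is used.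
     Otherwise the denominator is at least [modulus z0 / 2] for small [z], the numerator is bounded,
     and the factor [z] makes the product small. *)
  move=> e0; have [z00|z00] := eqVneq z0 0.
    have /cvg_modulusP/(_ e e0)/nbhs_complexP[d d0 dP] := differentiable_continuous dgz0.
    exists d => // z /andP[z1 z2]; rewrite /psi z00 -modulus_eq0 gt_eqF//.
    rewrite /q z00 subr0 mulrC divfK -?modulus_gt0//; apply: ltW.
    by have := dP z; rewrite z00 subr0; apply.
  have m0 : 0 < modulus z0 by rewrite modulus_gt0.
  pose K := (`|M| + modulus (g z0)) / (modulus z0 / 2).
  have K0 : 0 <= K by rewrite divr_ge0 ?addr_ge0 ?modulus_ge0// divr_ge0 ?modulus_ge0.
  exists (Num.min d1 (Num.min (modulus z0 / 2) (e / (K + 1)))).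
    by rewrite !lt_min d10 !divr_gt0// ltr_wpDl.
  move=> z /andP[z1]; rewrite !lt_min => /and3P[z2 z3 z4].
  have zz0 : modulus z0 / 2 <= modulus (z - z0).
    have := modulusD (z0 - z) z; rewrite subrK modulusC; lra.
  rewrite /psi ifF; last first.
    by apply/eqP => zz; move: zz0; rewrite zz subrr modulus0 leNgt divr_gt0.
  rewrite /q !modulusM modulusV.
  apply: (@le_trans _ _ (modulus z * K)); last first.
    move: z4; rewrite ltr_pdivlMr ?ltr_wpDl// => z4.
    by apply: le_trans (ltW z4); rewrite ler_wpM2l ?modulus_ge0// lerDl.
  apply: ler_wpM2l; first exact: modulus_ge0.
  apply: ler_pM; rewrite ?modulus_ge0 ?invr_ge0 ?modulus_ge0//.
    apply: le_trans (modulusB _ _) _; apply: lerD => //.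
    by apply: le_trans (ler_norm _); apply: gM; rewrite z1.
  by rewrite lef_pV2 ?posrE ?divr_gt0// (lt_le_trans _ zz0)// divr_gt0.
have hr : 0 < r < rho by rewrite r0.
have := circ_vanish dpsi cpsi psi0 hr.
have ckr := segment_continuous_kernel z0r.
have cgr : segment_continuous (fun t => g (circle r t)).
  apply: segment_continuous_circle => [|z zr]; first exact: ltW.
  by apply: differentiable_continuous; apply: dg; rewrite zr hr.
have cgk := segment_continuousM cgr ckr.
have cg0k := segment_continuousM (@segment_continuous_cst (g z0)) ckr.
have E t : psi (circle r t) = g (circle r t) * (circle r t / (circle r t - z0)) -
    g z0 * (circle r t / (circle r t - z0)).
  rewrite /psi ifF; first by rewrite -mulrBl /q mulrCA.
  by apply/eqP => zz; move: z0r; rewrite -zz modulus_circle ?ltxx// ltW.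
rewrite (eq_circ E) (circB cgk cg0k) (circZ _ ckr) circ_kernel//.
by move/eqP; rewrite subr_eq0 => /eqP ->; rewrite mulrC.
Qed.

(** The error depends on [g] only through a bound on one circle. This makes the expansion uniform in
    a parameter, as is needed to expand in two variables one after the other. *)
Lemma taylor_approx g rho z0 r N (M : R) :
  (forall z, 0 < modulus z < rho -> differentiable g z) ->
  (exists M d : R, 0 < d /\ forall z, 0 < modulus z < d -> modulus (g z) <= M) ->
  differentiable g z0 -> modulus z0 < r -> r < rho ->
  0 <= M -> (forall t, 0 <= t <= tau -> modulus (g (circle r t)) <= M) ->
  modulus (g z0 - \sum_(b < N) z0 ^+ b *
     (tau%:C%C^-1 * circ (fun t => g (circle r t) * circle r t ^- b)))
  <= 2 * (M * ((modulus z0 / r) ^+ N / (1 - modulus z0 / r))).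
Proof.
move=> dg g0 dgz0 z0r rrho M0 gM.
have r0 : 0 < r by apply: le_lt_trans z0r; exact: modulus_ge0.
have cgr : segment_continuous (fun t => g (circle r t)).
  apply: segment_continuous_circle => [|z zr]; first exact: ltW.
  by apply: differentiable_continuous; apply: dg; rewrite zr r0.
have := @circ_kernel_le N _ r z0 M z0r M0 cgr gM.
rewrite (cauchy_formula dg g0 dgz0 z0r rrho) => h.
have t0 := tau_gt0 R.
have tn0 : (tau%:C%C : C) != 0 by rewrite -modulus_gt0 modulus_real normr_gt0 gt_eqF.
rewrite -(ler_pM2l t0) [leRHS]mulrA [tau * 2]mulrC; apply: le_trans h.
rewrite -{1}(gtr0_norm t0) -modulus_real -modulusM mulrBr mulr_sumr.
rewrite le_eqVlt; apply/orP; left; apply/eqP; congr (modulus (_ - _)).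
by apply: eq_bigr => b _; rewrite mulrCA mulVKf.
Qed.

End Cauchy.

(** * Approximation in two variables *)

Section TwoVariables.
Variable R : realType.
Local Notation C := R[i].
Local Notation modulus := (@Normc.normc R).
Local Notation tau := (pi *+ 2 : R).

Lemma modulus_sum (I : Type) (s : seq I) (F : I -> C) :
  modulus (\sum_(i <- s) F i) <= \sum_(i <- s) modulus (F i).
Proof.
elim: s => [|i s IH]; first by rewrite !big_nil modulus0.
by rewrite !big_cons; apply: le_trans (modulusD _ _) _; rewrite lerD2l.
Qed.

Lemma continuous_pair (T : topologicalType) (f g : T -> C) x :
  {for x, continuous f} -> {for x, continuous g} ->
  {for x, continuous (fun y => (f y, g y))}.
Proof. by move=> cf cg; exact: (cvg_pair cf cg). Qed.

Lemma continuous_comp_fst (S T : topologicalType) (f : S -> C) (p : S * T) :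
  {for p.1, continuous f} -> {for p, continuous (fun p => f p.1)}.
Proof. by apply: continuous_comp; exact: cvg_fst. Qed.

Lemma continuous_comp_snd (S T : topologicalType) (f : T -> C) (p : S * T) :
  {for p.2, continuous f} -> {for p, continuous (fun p => f p.2)}.
Proof. by apply: continuous_comp; exact: cvg_snd. Qed.

Lemma differentiable_bounded_near (g : C -> C) z : differentiable g z ->
  exists M d : R, 0 < d /\ forall w, modulus (w - z) < d -> modulus (g w) <= M.
Proof.
move=> /differentiable_continuous/cvg_modulusP/(_ _ ltr01)/nbhs_complexP[d d0 dP].
exists (1 + modulus (g z)), d; split => // w /dP gw.
have := modulusD (g w - g z) (g z); rewrite subrK => /le_trans; apply.
by rewrite lerD2r ltW.
Qed.

Lemma ratio_le (x r : R) N : 1 < r -> 0 <= x <= 1 ->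
  (x / r) ^+ N / (1 - x / r) <= r^-1 ^+ N / (1 - r^-1).
Proof.
move=> r1 /andP[x0 x1]; have r0 : 0 < r by exact: lt_trans r1.
have xr : x / r <= r^-1 by rewrite ler_pdivrMr// mulVf ?gt_eqF.
have rr : r^-1 < 1 by rewrite invf_lt1.
have xr0 : 0 <= x / r by rewrite divr_ge0// ltW.
apply: ler_pM; first exact: exprn_ge0.
- by rewrite invr_ge0 subr_ge0 (le_trans xr)// ltW.
- by apply: lerXn2r => //; rewrite nnegrE// invr_ge0 ltW.
- rewrite lef_pV2 ?posrE ?subr_gt0//; last exact: le_lt_trans xr rr.
  by rewrite lerD2l lerN2.
Qed.

(** * Functions on the product of a disc and a punctured disc *)

Section Approx.
Variables (A : C -> C -> C) (rho : R).
Hypothesis rho1 : 1 < rho.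
Hypothesis dA1 : forall u v, modulus u < rho -> 0 < modulus v < rho ->
  differentiable (A ^~ v) u.
Hypothesis dA2 : forall u v, modulus u < rho -> 0 < modulus v < rho ->
  differentiable (A u) v.
Hypothesis cA : forall u v, modulus u < rho -> 0 < modulus v < rho ->
  {for (u, v), continuous (fun p => A p.1 p.2)}.
Hypothesis bA : exists M d : R, 0 < d /\
  forall u v, modulus u < rho -> 0 < modulus v < d -> modulus (A u v) <= M.

(** Any radius strictly between 1 and [rho] would do: on the closed unit disc the Taylor errors then
    decay like powers of [q = r^-1 < 1]. *)
Let r : R := (1 + rho) / 2.
Let r1 : 1 < r. Proof. by rewrite /r; move: rho1; lra. Qed.
Let r_rho : r < rho. Proof. by rewrite /r; move: rho1; lra. Qed.
Let r0 : 0 < r. Proof. exact: lt_trans r1. Qed.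
Let hr : 0 < r < rho. Proof. by rewrite r0 r_rho. Qed.
Let q : R := r^-1.
Let q0 : 0 < q. Proof. by rewrite invr_gt0. Qed.
Let q1 : q < 1. Proof. by rewrite invf_lt1. Qed.
Let mcircle t : modulus (circle r t) = r. Proof. by rewrite modulus_circle ?ltW. Qed.

Lemma torus_bound : exists2 M : R, 0 <= M & forall s t, 0 <= s <= tau ->
  0 <= t <= tau -> modulus (A (circle r s) (circle r t)) <= M.
Proof.
pose f (p : R * R) := A (circle r p.1) (circle r p.2).
have cf p : {for p, continuous f}.
  apply: (@continuous_comp _ _ _ (fun p : R * R => (circle r p.1, circle r p.2)) (fun p => A p.1 p.2)).
    apply: continuous_pair.
      by apply: continuous_comp_fst; exact: continuous_circle_t.
    by apply: continuous_comp_snd; exact: continuous_circle_t.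
  by apply: cA; rewrite mcircle.
have [M M0 MP] := continuous_compact_bounded
  (compact_setX (@segment_compact R 0 tau) (@segment_compact R 0 tau)) (fun p _ => cf p).
exists M => // s t hs ht; apply: (MP (s, t)).
by split; rewrite /= in_itv.
Qed.

(** Taylor coefficients by Cauchy's integrals: [alpha] in the first variable, with the second on the
    circle of radius [r]; [beta] in the second, with the first fixed; [gamma] in both. *)
Let alpha a t : C :=
  tau%:C%C^-1 * circ (fun s => A (circle r s) (circle r t) * circle r s ^- a).
Let beta b u : C :=
  tau%:C%C^-1 * circ (fun t => A u (circle r t) * circle r t ^- b).
Let gamma a b : C :=
  tau%:C%C^-1 * circ (fun t => alpha a t * circle r t ^- b).

Lemma alpha_approx M : 0 <= M -> (forall s t, 0 <= s <= tau ->
    0 <= t <= tau -> modulus (A (circle r s) (circle r t)) <= M) ->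
  forall N u t, 0 <= t <= tau -> modulus u <= 1 ->
  modulus (A u (circle r t) - \sum_(a < N) u ^+ a * alpha a t)
    <= 2 * (M * (q ^+ N / (1 - q))).
Proof.
move=> M0 MP N u t ht u1.
have ur : modulus u < r by exact: le_lt_trans r1.
have dg z : modulus z < rho -> differentiable (A ^~ (circle r t)) z.
  by move=> hz; apply: dA1 => //; rewrite mcircle.
have [|M' [d [d0 dP]]] := @differentiable_bounded_near (A ^~ (circle r t)) 0.
  by apply: dg; rewrite modulus0 (lt_trans r0).
have := @taylor_approx R (A ^~ (circle r t)) rho u r N M.
move=> h; apply: le_trans (h _ _ _ ur r_rho M0 _) _.
- by move=> z /andP[_]; exact: dg.
- by exists M', d; split => // z /andP[_ zd]; apply: dP; rewrite subr0.
- by apply: dg; exact: lt_trans ur r_rho.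
- by move=> s hs; exact: MP.
- apply: ler_wpM2l => //; apply: ler_wpM2l => //.
  by apply: ratio_le => //; rewrite modulus_ge0.
Qed.

Lemma beta_approx M : 0 <= M -> (forall s t, 0 <= s <= tau ->
    0 <= t <= tau -> modulus (A (circle r s) (circle r t)) <= M) ->
  forall N u v, modulus u <= 1 -> 0 < modulus v <= 1 ->
  modulus (A u v - \sum_(b < N) v ^+ b * beta b u)
    <= 2 * (2 * (M * (1 - q)^-1) * (q ^+ N / (1 - q))).
Proof.
move=> M0 MP N u v u1 /andP[v0 v1].
have ur : modulus u < rho by apply: le_lt_trans rho1.
have vr : modulus v < r by exact: le_lt_trans r1.
have [M' [d [d0 dP]]] := bA.
have := @taylor_approx R (A u) rho v r N (2 * (M * (1 - q)^-1)).
move=> h; apply: le_trans (h _ _ _ vr r_rho _ _) _.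
- by move=> z hz; exact: dA2.
- by exists M', d; split => // z zd; apply: dP.
- by apply: dA2; rewrite ?v0 ?(lt_trans vr).
- by rewrite mulr_ge0// mulr_ge0// invr_ge0 subr_ge0 ltW.
(* With [N = 0] the sum is empty and the estimate bounds [A u] on the circle by its values on the
   product of two circles, in place of a maximum principle. *)
- move=> t ht; have := alpha_approx M0 MP 0 ht u1.
  by rewrite big_ord0 subr0 expr0 mul1r.
- apply: ler_wpM2l => //; apply: ler_wpM2l.
    by rewrite mulr_ge0// mulr_ge0// invr_ge0 subr_ge0 ltW.
  by apply: ratio_le => //; rewrite modulus_ge0.
Qed.

Lemma segment_continuous_alpha a : segment_continuous (alpha a).
Proof.
move=> t _; apply: continuous_mul; first exact: continuous_const.
apply: (@continuous_circ R R (fun t s => A (circle r s) (circle r t) * circle r s ^- a)).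
  move=> s _; apply: continuous_mul.
    apply: (@continuous_comp _ _ _ (fun p : R * R => (circle r p.2, circle r p.1)) (fun p => A p.1 p.2)).
      apply: continuous_pair.
        by apply: continuous_comp_snd; exact: continuous_circle_t.
      by apply: continuous_comp_fst; exact: continuous_circle_t.
    by apply: cA; rewrite mcircle.
  apply: continuous_inv; first by rewrite expf_neq0//; exact: circle_neq0.
  apply: (@continuous_comp _ _ _ (fun p : R * R => circle r p.2) (fun w => w ^+ a)).
    by apply: continuous_comp_snd; exact: continuous_circle_t.
  exact: continuous_pow.
near=> t' => s hs; apply: continuous_mul.
  apply: (@segment_continuous_circle _ (A ^~ (circle r t'))) hs; first exact: ltW.
  by move=> z zr; apply: differentiable_continuous; apply: dA1; rewrite ?zr ?mcircle.
by apply: (segment_continuous_neg r0) hs.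
Unshelve. all: by end_near. Qed.

(** Integrate [alpha_approx] against [circle r t ^- b]. As [r > 1] this factor has modulus at most
    1, so the error does not depend on [b]. *)
Lemma beta_gamma M : 0 <= M -> (forall s t, 0 <= s <= tau ->
    0 <= t <= tau -> modulus (A (circle r s) (circle r t)) <= M) ->
  forall N b u, modulus u <= 1 ->
  modulus (beta b u - \sum_(a < N) u ^+ a * gamma a b)
    <= 4 * (M * (q ^+ N / (1 - q))).
Proof.
move=> M0 MP N b u u1; set E := M * _.
have E0 : 0 <= E.
  apply: mulr_ge0 => //; apply: divr_ge0; first by rewrite exprn_ge0// ltW.
  by rewrite subr_ge0 ltW.
have ur : modulus u < rho by apply: le_lt_trans rho1.
have cn := @segment_continuous_neg R r b r0.
have cAu : segment_continuous (fun t => A u (circle r t)).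
  apply: segment_continuous_circle; first exact: ltW.
  by move=> z zr; apply: differentiable_continuous; apply: dA2; rewrite ?zr.
have cAun := segment_continuousM cAu cn.
have ca a := segment_continuousM (@segment_continuous_alpha a) cn.
have cua a := segment_continuousM (@segment_continuous_cst R (u ^+ a)) (ca a).
have cs := @segment_continuous_sum _ _ (index_enum 'I_N) _ (fun a : 'I_N => cua a).
have -> : beta b u - \sum_(a < N) u ^+ a * gamma a b = tau%:C%C^-1 *
    circ (fun t => A u (circle r t) * circle r t ^- b -
      \sum_(a < N) u ^+ a * (alpha a t * circle r t ^- b)).
  rewrite (circB cAun cs) mulrBr; congr (_ - _).
  rewrite (circ_sum (index_enum 'I_N) (fun a : 'I_N => cua a)) mulr_sumr.
  by apply: eq_bigr => a _; rewrite (circZ _ (ca a)) /gamma mulrCA.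
have t0 := tau_gt0 R.
rewrite modulusM modulusV modulus_real gtr0_norm//.
rewrite mulrC ler_pdivrMr//.
have -> : 4 * E * tau = 2 * ((2 * E) * tau) by ring.
apply: circ_le; first by rewrite mulr_ge0.
  exact: segment_continuousB cAun cs.
move=> t ht; have := alpha_approx M0 MP N ht u1; rewrite -/E.
set X := \sum_(a < N) _; set Y := \sum_(a < N) _ => h.
have -> : Y = X * circle r t ^- b.
  by rewrite mulr_suml; apply: eq_bigr => a _; rewrite mulrA.
rewrite -mulrBl modulusM modulusV modulusX mcircle.
apply: le_trans h; rewrite ler_piMr ?modulus_ge0//.
by rewrite invf_le1 ?exprn_gt0// exprn_ege1// ltW.
Qed.

Lemma poly_approx (e : R) : 0 < e -> exists (N N' : nat) (c : nat -> nat -> C),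
  forall u v, modulus u <= 1 -> 0 < modulus v <= 1 ->
  modulus (A u v - \sum_(a < N') \sum_(b < N) c a b * (u ^+ a * v ^+ b)) <= e.
Proof.
move=> e0; have [M M0 MP] := torus_bound.
have q01 : 0 <= q < 1 by rewrite (ltW q0) q1.
have e20 : 0 < e / 2 by rewrite divr_gt0.
have [N NP] := geometric_small (2 * (2 * (M * (1 - q)^-1) * (1 - q)^-1)) q01 e20.
(* [N'] is chosen after [N], because the errors of the [N] coefficients [beta] add up. *)
have [N' NP'] := geometric_small (N%:R * (4 * (M * (1 - q)^-1))) q01 e20.
exists N, N', gamma => u v u1 hv.
have b1 := beta_approx M0 MP N u1 hv.
have b2 b := beta_gamma M0 MP N' b u1.
have b3 : modulus (\sum_(b < N) v ^+ b * beta b u -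
    \sum_(a < N') \sum_(b < N) gamma a b * (u ^+ a * v ^+ b)) <= e / 2.
  rewrite exchange_big /= -sumrB.
  apply: le_trans (modulus_sum _ _) _.
  apply: (@le_trans _ _ (\sum_(b < N) 4 * (M * (q ^+ N' / (1 - q))))).
    apply: ler_sum => b _.
    have -> : v ^+ b * beta b u - \sum_(a < N') gamma a b * (u ^+ a * v ^+ b) =
        v ^+ b * (beta b u - \sum_(a < N') u ^+ a * gamma a b).
      rewrite mulrBr mulr_sumr; congr (_ - _); apply: eq_bigr => a _; ring.
    rewrite modulusM modulusX; apply: le_trans (b2 b).
    rewrite ler_piMl ?modulus_ge0// exprn_ile1 ?modulus_ge0//.
    by case/andP: hv.
  rewrite sumr_const card_ord -mulr_natl; apply: le_trans (ltW NP').
  by rewrite le_eqVlt; apply/orP; left; apply/eqP; ring.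
set X := \sum_(b < N) _ in b1 b3; set Y := \sum_(a < N') _ in b3 *.
rewrite (_ : A u v - Y = (A u v - X) + (X - Y)); last by rewrite addrA subrK.
apply: le_trans (modulusD _ _) _; rewrite (splitr e); apply: lerD => //.
apply: le_trans b1 _; apply: le_trans (ltW NP).
by rewrite le_eqVlt; apply/orP; left; apply/eqP; ring.
Qed.

End Approx.
End TwoVariables.

(** * Approximation on the Hartogs triangle *)

Section HartogsApprox.
Variable R : realType.
Local Notation C := R[i].
Local Notation C2 := (R[i] * R[i])%type.
Local Notation modulus := (@Normc.normc R).
Local Notation tau := (pi *+ 2 : R).
Local Notation hartogs := (@hartogs R).
Local Notation torus := (@torus R).
Local Notation expi := (@expi R).
Implicit Types (F : C2 -> C) (z w : C2) (k : nat).

Lemma hartogsE z : hartogs z <-> modulus z.1 < modulus z.2 /\ modulus z.2 < 1.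
Proof.
rewrite /Defs.hartogs /= !normE.
by rewrite (_ : 1 = (1 : R)%:C%C) // !ltcR.
Qed.

Lemma torusE z : torus z <-> modulus z.1 = 1 /\ modulus z.2 = 1.
Proof.
rewrite /Defs.torus /= !normE; split=> -[h1 h2]; last by rewrite h1 h2.
by split; apply: complexI.
Qed.

Lemma torus_polar t : torus (polar t).
Proof. by apply/torusE; rewrite !modulus_expi. Qed.

Lemma expi_neq0 (t : R) : expi t != 0.
Proof. by rewrite -modulus_gt0 modulus_expi. Qed.

Lemma expi_tauMz (n : int) : expi (n%:~R * tau) = 1.
Proof.
have nat_case (m : nat) : expi (m%:R * tau) = 1.
  elim: m => [|m IH]; first by rewrite mul0r expi0.
  by rewrite -natr1 mulrDl mul1r expiD IH expi_2pi mulr1.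
case: n => m; first exact: nat_case.
have := nat_case m.+1 => h.
by have := expiD (m.+1%:R * tau) ((Negz m)%:~R * tau);
  rewrite h mul1r NegzE rmorphN /= mulNr addrN expi0 => <-.
Qed.

(** Estimates on the torus are stated for all real angles; this reduction brings them to a compact
    square. *)
Lemma expi_mod_tau (t : R) : exists2 t', 0 <= t' <= tau & expi t' = expi t.
Proof.
have t0 := tau_gt0 R.
exists (t - (Num.floor (t / tau))%:~R * tau).
  rewrite subr_ge0 -ler_pdivlMr// lerBlDr.
  have /andP[-> h2] /= := floor_itv (t / tau).
  move: h2; rewrite ltr_pdivrMr// intrD mulrDl mul1r addrC => /ltW; exact.
by rewrite expiD -mulNr -rmorphN expi_tauMz mulr1.
Qed.

Lemma polar_mod_tau (t : R * R) : exists t' : R * R,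
  [/\ 0 <= t'.1 <= tau, 0 <= t'.2 <= tau & polar t' = polar t].
Proof.
have [a ha ea] := expi_mod_tau t.1; have [b hb eb] := expi_mod_tau t.2.
by exists (a, b); rewrite /polar /= ea eb.
Qed.

(** The first coordinate is contracted more strongly than the second, so the torus, where both
    moduli are 1, is moved into the open triangle. Equal factors would leave it on the boundary
    [|z.1| = |z.2|]. *)
Definition shrink (s : R) w : C2 := ((s ^+ 2)%:C%C * w.1, s%:C%C * w.2).

Lemma shrink_hartogs s w : 0 < s < 1 -> modulus w.1 <= modulus w.2 ->
  0 < modulus w.2 <= 1 -> hartogs (shrink s w).
Proof.
move=> /andP[s0 s1] w12 /andP[w20 w2]; apply/hartogsE.
rewrite /shrink /= !modulusM !modulus_real !ger0_norm ?exprn_ge0// ?(ltW s0)//.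
split.
  apply: (@le_lt_trans _ _ (s ^+ 2 * modulus w.2)).
    by rewrite ler_wpM2l// exprn_ge0// ltW.
  by rewrite expr2 -mulrA ltr_pM2l// gtr_pMl.
by apply: (@le_lt_trans _ _ s) => //; rewrite ler_piMr// ltW.
Qed.

Lemma A_bounded F k : A_ k F -> exists M d : R, 0 < d /\
  forall z, hartogs z -> modulus z.1 < d -> modulus z.2 < d ->
    modulus (z.2 ^+ k * F z) <= M.
Proof.
move=> [_ _ /pinfty_ex_gt0[M M0]]; rewrite /= => -[[U V] /= [U0 V0] UV].
move/nbhs_complexP : U0 => [d1 d10 d1P]; move/nbhs_complexP : V0 => [d2 d20 d2P].
exists (complex.Re M), (Num.min d1 d2); split; first by rewrite lt_min d10.
move=> z hz; rewrite !lt_min => /andP[h1 _] /andP[_ h2].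
have : `|z.2 ^+ k * F z| <= M.
  apply: (UV z) => //; split; first by apply: d1P; rewrite subr0.
  by apply: d2P; rewrite subr0.
by rewrite normE lecE => /andP[_].
Qed.

Lemma A_differentiable F k z : A_ k F -> hartogs z -> differentiable F z.
Proof. by case=> + _ _; exact. Qed.

Lemma differentiable_scale (c z : C) : differentiable (fun w : C => c * w) z.
Proof.
by apply: differentiableM; [exact: differentiable_cst | exact: differentiable_id].
Qed.

(** With [u = w.1 / w.2] and [v = w.2], the point [shrink s w] is [pt u v], which stays in the
    triangle for [u] and [v] of modulus below [s^-1 > 1] with [v] nonzero. This is the margin beyond
    the unit discs that [poly_approx] requires. *)
Lemma shrink_poly_approx F k s (e : R) : A_ k F -> 0 < s < 1 -> 0 < e ->
  exists (N N' : nat) (c : nat -> nat -> C), forall w,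
    modulus w.1 <= modulus w.2 -> 0 < modulus w.2 <= 1 ->
    modulus (w.2 ^+ k * (F (shrink s w) -
      \sum_(a < N') \sum_(b < N)
        c a b * monomialT (a%:Z, b%:Z - a%:Z - k%:Z) w)) <= e.
Proof.
move=> AF hs e0; case/andP: (hs) => s0 s1.
pose pt (u v : C) : C2 := (((s ^+ 2)%:C%C * u) * v, s%:C%C * v).
pose A (u v : C) : C := (s%:C%C * v) ^+ k * F (pt u v).
have pt_hartogs u v : modulus u < s^-1 -> 0 < modulus v < s^-1 -> hartogs (pt u v).
  rewrite -[s^-1]mul1r !ltr_pdivlMr// => hu /andP[v0 hv].
  apply/hartogsE; rewrite /pt /= !modulusM !modulus_real !ger0_norm ?exprn_ge0// ?(ltW s0)//.
  rewrite [s * _]mulrC hv; split => //.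
  rewrite (_ : s ^+ 2 * _ * _ = (modulus v * s) * (modulus u * s)); last by ring.
  by rewrite gtr_pMr ?mulr_gt0.
have dA1 u v : modulus u < s^-1 -> 0 < modulus v < s^-1 -> differentiable (A ^~ v) u.
  move=> hu hv; apply: differentiableM; first exact: differentiable_cst.
  apply: (@differentiable_comp _ _ _ _ (pt ^~ v) F).
    apply: differentiable_pair; last exact: differentiable_cst.
    by apply: differentiableM; [exact: differentiable_scale | exact: differentiable_cst].
  by apply: A_differentiable AF _; exact: pt_hartogs.
have dA2 u v : modulus u < s^-1 -> 0 < modulus v < s^-1 -> differentiable (A u) v.
  move=> hu hv; apply: differentiableM.
    apply: (@differentiable_comp _ _ _ _ (fun v : C => s%:C%C * v) (fun w : C => w ^+ k)).
      exact: differentiable_scale.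
    exact: differentiable_exp.
  apply: (@differentiable_comp _ _ _ _ (pt u) F).
    by apply: differentiable_pair; exact: differentiable_scale.
  by apply: A_differentiable AF _; exact: pt_hartogs.
have cA u v : modulus u < s^-1 -> 0 < modulus v < s^-1 ->
    {for (u, v), continuous (fun p => A p.1 p.2)}.
  move=> hu hv.
  have csc (c x : C) : {for x, continuous (fun y => c * y)}.
    by apply: continuous_mul; [exact: continuous_const | exact: cvg_id].
  have c1 : {for (u, v), continuous (fun p : C2 => (s ^+ 2)%:C%C * p.1)}.
    exact: (@continuous_comp_fst R C C (fun y => (s ^+ 2)%:C%C * y) (u, v) (csc _ _)).
  have c2 : {for (u, v), continuous (fun p : C2 => s%:C%C * p.2)}.
    exact: (@continuous_comp_snd R C C (fun y => s%:C%C * y) (u, v) (csc _ _)).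
  have c3 : {for (u, v), continuous (fun p : C2 => p.2)}.
    exact: (@continuous_comp_snd R C C (fun y => y) (u, v) cvg_id).
  apply: continuous_mul.
    apply: (@continuous_comp _ _ _ (fun p : C2 => s%:C%C * p.2) (fun w : C => w ^+ k)); [exact: c2|exact: continuous_pow].
  apply: (@continuous_comp _ _ _ (fun p : C2 => pt p.1 p.2) F).
    by apply: continuous_pair; [apply: continuous_mul; [exact: c1|exact: c3]|exact: c2].
  by apply: differentiable_continuous; apply: A_differentiable AF _; exact: pt_hartogs.
have bA : exists M d : R, 0 < d /\
    forall u v, modulus u < s^-1 -> 0 < modulus v < d -> modulus (A u v) <= M.
  have [M [d [d0 dP]]] := A_bounded AF.
  exists M, (Num.min d s^-1); split; first by rewrite lt_min d0 invr_gt0.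
  move=> u v hu /andP[v0]; rewrite lt_min => /andP[vd vs].
  have hp := pt_hartogs u v hu (introT andP (conj v0 vs)).
  have hv : modulus (pt u v).2 < d.
    rewrite /= modulusM modulus_real gtr0_norm//; apply: lt_trans vd.
    by rewrite gtr_pMl.
  have hu' : modulus (pt u v).1 < d by apply: lt_trans hv; case/hartogsE: hp.
  exact: (dP (pt u v) hp hu' hv).
have s1' : 1 < s^-1 by rewrite invf_gt1.
(* [A] carries the factor [s ^+ k], which is divided out at the end. *)
have esk : 0 < e * s ^+ k by rewrite mulr_gt0// exprn_gt0.
have [N [N' [c cP]]] := poly_approx s1' dA1 dA2 cA bA esk.
exists N, N', (fun a b => c a b / (s%:C%C) ^+ k) => w w12 /andP[w20 w21].
have w2n0 : w.2 != 0 by rewrite -modulus_gt0.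
have sn0 : (s%:C%C : C) != 0 by rewrite -modulus_gt0 modulus_real normr_gt0 gt_eqF.
have skn0 : (s%:C%C : C) ^+ k != 0 by rewrite expf_neq0.
have u1 : modulus (w.1 / w.2) <= 1.
  by rewrite modulusM modulusV ler_pdivrMr// mul1r.
have := cP (w.1 / w.2) w.2 u1; rewrite w20 => /(_ w21).
have -> : A (w.1 / w.2) w.2 = s%:C%C ^+ k * (w.2 ^+ k * F (shrink s w)).
  by rewrite /A exprMn -mulrA /pt /shrink -mulrA divfK.
(* Taking out [w.2 ^+ k] turns [u ^+ a * v ^+ b] into the monomial with exponents [a] and
   [b - a - k]. *)
have E : \sum_(a < N') \sum_(b < N) c a b * ((w.1 / w.2) ^+ a * w.2 ^+ b) =
    s%:C%C ^+ k * (w.2 ^+ k * \sum_(a < N') \sum_(b < N)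
      c a b / s%:C%C ^+ k * monomialT (a%:Z, b%:Z - a%:Z - k%:Z) w).
  rewrite !mulr_sumr; apply: eq_bigr => a _; rewrite !mulr_sumr; apply: eq_bigr => b _.
  rewrite /monomialT /= !expfzDr// -!exprnN -!exprnP exprMn exprVn.
  have h1 : w.2 ^+ a != 0 by rewrite expf_neq0.
  have h2 : w.2 ^+ k != 0 by rewrite expf_neq0.
  move: (w.2 ^+ a) (w.2 ^+ k) (s%:C%C ^+ k) h1 h2 skn0 => x y t h1 h2 h3.
  by field; rewrite h1 h2 h3.
rewrite E -!mulrBr; set X := w.2 ^+ k * _.
rewrite modulusM modulusX modulus_real gtr0_norm// mulrC.
by rewrite ler_pM2r// exprn_gt0.
Qed.

Lemma A_cvg F k z : A_ k F -> hartogs z \/ torus z -> forall e, 0 < e ->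
  exists2 d : R, 0 < d & forall w, hartogs w \/ torus w ->
    modulus (w.1 - z.1) < d -> modulus (w.2 - z.2) < d -> modulus (F w - F z) < e.
Proof.
move=> [_ /subspace_continuousP cF _] hz e e0.
have /cvg_modulusP /(_ e e0) := cF z hz.
move=> [[U V] /= [/nbhs_complexP[d1 d10 d1P] /nbhs_complexP[d2 d20 d2P]] UV].
exists (Num.min d1 d2); first by rewrite lt_min d10.
move=> w hw; rewrite !lt_min => /andP[h1 _] /andP[_ h2].
by apply: (UV w) => //; split; [exact: d1P|exact: d2P].
Qed.

Lemma shrink_dist (s : R) w : 0 < s < 1 -> modulus w.1 <= 1 -> modulus w.2 <= 1 ->
  modulus ((shrink s w).1 - w.1) <= 2 * (1 - s) /\
  modulus ((shrink s w).2 - w.2) <= 2 * (1 - s).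
Proof.
move=> /andP[s0 s1] w1 w2; rewrite /shrink /=.
have h (x : R) (y : C) : 0 <= x <= 1 -> modulus y <= 1 -> modulus (x%:C%C * y - y) <= 1 - x.
  move=> hx hy; rewrite -[X in _ - X]mul1r -mulrBl modulusM -(rmorph1 (real_complex R)) -rmorphB.
  by rewrite modulus_real ler0_norm ?opprB ?ler_piMr//; lra.
have s2 : s ^+ 2 = s * s by [].
split.
  apply: le_trans (h _ _ _ w1) _; first by rewrite s2; nra.
  by rewrite s2; nra.
by apply: le_trans (h _ _ _ w2) _; lra.
Qed.

(** Continuity of [F] on the triangle together with the torus gives convergence at each point as [s]
    tends to 1; compactness of the square of angles makes it uniform on the torus, and one [s]
    serves [z] as well. *)
Lemma shrink_cvg F k z (e : R) : A_ k F -> hartogs z -> 0 < e ->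
  exists2 s : R, 0 < s < 1 &
    (forall t, modulus (F (shrink s (polar t)) - F (polar t)) < e) /\
    modulus (F (shrink s z) - F z) < e.
Proof.
move=> AF hz e0.
have near_T : \forall s \near (1 : R), 0 < s < 1 -> forall t : R * R,
    (`[0, tau]%classic `*` `[0, tau]%classic) t ->
    modulus (F (shrink s (polar t)) - F (polar t)) < e.
  have /compact_near_coveringP cK := compact_setX (@segment_compact R 0 tau) (@segment_compact R 0 tau).
  have := cK R (nbhs (1 : R)) (fun s t => 0 < s < 1 -> modulus (F (shrink s (polar t)) - F (polar t)) < e) (nbhs_filter (1 : R)).
  move=> h; apply: filterS (h _) => [s hs s01 t Kt|t Kt]; first exact: hs.
  have [d d0 dP] := A_cvg AF (or_intror (torus_polar t)) (divr_gt0 e0 (ltr0n _ 2)).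
  have d20 : 0 < d / 4 by rewrite divr_gt0.
  have /cvg_modulusP/(_ _ d20) n1 := @continuous_expi R t.1.
  have /cvg_modulusP/(_ _ d20) n2 := @continuous_expi R t.2.
  exists ([set t' : R * R | modulus (expi t'.1 - expi t.1) < d / 4 /\
    modulus (expi t'.2 - expi t.2) < d / 4], [set s | `|s - 1| < d / 4]).
    split; last exact: near_dist_lt.
    by exists ([set x | modulus (expi x - expi t.1) < d / 4],
               [set x | modulus (expi x - expi t.2) < d / 4]).
  move=> [t' s] /= [[h1 h2]] hs s01.
  have [] := @shrink_dist s (polar t') s01; rewrite ?modulus_expi// => k1 k2.
  have hs' : 2 * (1 - s) < d / 2.
    by move: hs; rewrite ltr_distlC; lra.
  have j1 : modulus (F (shrink s (polar t')) - F (polar t)) < e / 2.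
    apply: dP.
    - left; apply: shrink_hartogs => //; first by rewrite !modulus_expi.
      by rewrite modulus_expi ltr01 lexx.
    - rewrite (_ : _ - _ = ((shrink s (polar t')).1 - (polar t').1) + ((polar t').1 - (polar t).1)); last by rewrite addrA subrK.
      by apply: le_lt_trans (modulusD _ _) _; rewrite /=; move: k1 h1 => /=; lra.
    - rewrite (_ : _ - _ = ((shrink s (polar t')).2 - (polar t').2) + ((polar t').2 - (polar t).2)); last by rewrite addrA subrK.
      by apply: le_lt_trans (modulusD _ _) _; rewrite /=; move: k2 h2 => /=; lra.
  have j2 : modulus (F (polar t') - F (polar t)) < e / 2.
    apply: dP; first by right; exact: torus_polar.
      by apply: lt_trans h1 _; lra.
    by apply: lt_trans h2 _; lra.
  rewrite (_ : _ - _ = (F (shrink s (polar t')) - F (polar t)) - (F (polar t') - F (polar t))); last by rewrite opprB addrA subrK.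
  by apply: le_lt_trans (modulusB _ _) _; lra.
have [d d0 dP] := A_cvg AF (or_introl hz) e0.
have /nbhs_realP[d1 d10 d1P] := near_T.
(* The three bounds keep [1 - m] in the unit interval, move [z] by at most [2 * m < d], and bring
   [1 - m] within [d1] of 1. *)
pose m := Num.min (1 / 2) (Num.min (d / 4) (d1 / 2)).
have m0 : 0 < m by rewrite !lt_min !divr_gt0.
have m1 : m <= 1 / 2 by rewrite /m ge_min lexx.
have m2 : m <= d / 4 by rewrite /m ge_min [in X in _ || X]ge_min lexx orbT.
have m3 : m <= d1 / 2 by rewrite /m ge_min [in X in _ || X]ge_min lexx !orbT.
have s01 : 0 < 1 - m < 1 by lra.
exists (1 - m) => //; split.
  move=> t; have [t' [h1 h2 <-]] := polar_mod_tau t.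
  apply: d1P; [|exact: s01|by split; rewrite /= in_itv].
  by rewrite addrAC subrr add0r normrN gtr0_norm//; lra.
have [z12 z21] := (hartogsE z).1 hz.
have z20 : 0 < modulus z.2 by apply: le_lt_trans z12; exact: modulus_ge0.
have [k1 k2] := shrink_dist s01 (ltW (lt_trans z12 z21)) (ltW z21).
apply: dP.
- by left; apply: shrink_hartogs => //; rewrite ?z20 ltW.
- by apply: le_lt_trans k1 _; lra.
- by apply: le_lt_trans k2 _; lra.
Qed.

Lemma A_square_approx F k z (e : R) : A_ k F -> hartogs z -> 0 < e ->
  exists (N N' : nat) (c : nat -> nat -> C),
    let P := fun w => \sum_(a < N') \sum_(b < N)
      c a b * monomialT (a%:Z, b%:Z - a%:Z - k%:Z) w in
    (forall t, modulus (F (polar t) - P (polar t)) <= e) /\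
    modulus (F z - P z) <= e.
Proof.
move=> AF hz e0; have [z12 z21] := (hartogsE z).1 hz.
have z20 : 0 < modulus z.2 by apply: le_lt_trans z12; exact: modulus_ge0.
have e2 : 0 < e / 2 by rewrite divr_gt0.
have [s s01 [sT sz]] := shrink_cvg AF hz e2.
have zk0 : 0 < modulus z.2 ^+ k by rewrite exprn_gt0.
have zk1 : modulus z.2 ^+ k <= 1 by rewrite exprn_ile1// ltW.
(* The tolerance contains [modulus z.2 ^+ k] to compensate the weight at [z]; on the torus the
   weight has modulus 1 and the tolerance is more than enough. *)
have [N [N' [c cP]]] := shrink_poly_approx AF s01 (mulr_gt0 e2 zk0).
exists N, N', c => /=; split.
  move=> t; rewrite -[X in X - _](subrK (F (shrink s (polar t)))) -addrA.
  apply: le_trans (modulusD _ _) _; rewrite (splitr e); apply: lerD.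
    by rewrite modulusC ltW.
  have := cP (polar t); rewrite !modulus_expi modulusM modulusX modulus_expi expr1n mul1r ltr01 lexx.
  move=> /(_ isT isT)/le_trans; apply.
  by rewrite ler_piMr// ltW.
rewrite -[X in X - _](subrK (F (shrink s z))) -addrA.
apply: le_trans (modulusD _ _) _; rewrite (splitr e); apply: lerD.
  by rewrite modulusC ltW.
have := cP z (ltW z12); rewrite z20 (ltW z21) => /(_ isT).
by rewrite modulusM modulusX [e / 2 * _]mulrC ler_pM2l.
Qed.

End HartogsApprox.

(** * Measurability and integration on the torus *)

Section ComplexMeasurable.
Variable R : realType.
Local Notation C := R[i].
Local Notation modulus := (@Normc.normc R).
Context d (T : measurableType d).
Implicit Types f g : T -> C.

Definition cmeasurable f :=
  measurable_fun setT (fun t => complex.Re (f t)) /\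
  measurable_fun setT (fun t => complex.Im (f t)).

Lemma cmeasurable_add f g : cmeasurable f -> cmeasurable g ->
  cmeasurable (fun t => f t + g t).
Proof.
move=> [f1 f2] [g1 g2]; split.
  by under eq_fun do rewrite Re_add; exact: measurable_funD.
by under eq_fun do rewrite Im_add; exact: measurable_funD.
Qed.

Lemma cmeasurable_mul f g : cmeasurable f -> cmeasurable g ->
  cmeasurable (fun t => f t * g t).
Proof.
move=> [f1 f2] [g1 g2]; split.
  under eq_fun do rewrite Re_mul.
  by apply: measurable_funB; exact: measurable_funM.
under eq_fun do rewrite Im_mul.
by apply: measurable_funD; exact: measurable_funM.
Qed.

Lemma cmeasurable_cst (c : C) : cmeasurable (fun=> c).
Proof. by split; exact: measurable_cst. Qed.

Lemma cmeasurable_conj f : cmeasurable f -> cmeasurable (fun t => (f t)^*%C).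
Proof.
have E (z : C) : (z^*)%C = Complex (complex.Re z) (- complex.Im z) by case: z.
move=> [f1 f2]; split; first by under eq_fun do rewrite E.
by under eq_fun do rewrite E /=; exact: measurableT_comp.
Qed.

Lemma cmeasurable_sqr_modulus f : cmeasurable f ->
  measurable_fun setT (fun t => modulus (f t) ^+ 2).
Proof.
move=> [f1 f2]; under eq_fun do rewrite sqr_modulus.
by apply: measurable_funD; exact: measurable_funX.
Qed.

Lemma cmeasurable_lim f (F : nat -> T -> C) : (forall n, cmeasurable (F n)) ->
  (forall n t, modulus (f t - F n t) <= n.+1%:R^-1) -> cmeasurable f.
Proof.
move=> mF hF.
have lim0 e : 0 < e -> exists N : nat, forall n, (N <= n)%N -> n.+1%:R^-1 < e :> R.
  move=> e0; exists (Num.truncn e^-1) => n Nn.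
  rewrite invf_plt ?posrE//; apply: lt_le_trans (truncnS_gt _) _.
  by rewrite ler_nat.
split.
  apply: (@measurable_fun_cvg _ _ _ setT (fun n t => complex.Re (F n t))) => [n|t _].
    by case: (mF n).
  apply/cvgrPdist_lt => e /lim0[N NP]; exists N => // n /NP.
  by apply: le_lt_trans; rewrite -Re_opp -Re_add; exact: le_trans (modulus_Re _) (hF _ _).
apply: (@measurable_fun_cvg _ _ _ setT (fun n t => complex.Im (F n t))) => [n|t _].
  by case: (mF n).
apply/cvgrPdist_lt => e /lim0[N NP]; exists N => // n /NP.
by apply: le_lt_trans; rewrite -Im_opp -Im_add; exact: le_trans (modulus_Im _) (hF _ _).
Qed.

End ComplexMeasurable.

(** * The measure [sigmaT] and its product structure *)

Section SigmaT.
Variable R : realType.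
Local Notation C := R[i].
Local Notation C2 := (R[i] * R[i])%type.
Local Notation angles := (measurableTypeR R * measurableTypeR R)%type.
Local Notation modulus := (@Normc.normc R).
Local Notation tau := (pi *+ 2 : R).
Local Notation sigmaT := (@sigmaT R).
Local Notation arc_length := (@arc_length R).

Lemma arc_lengthE (A : set (measurableTypeR R)) :
  arc_length A = @lebesgue_measure R (A `&` `[0, tau[%classic).
Proof. by []. Qed.

Lemma arc_lengthT : arc_length setT = tau%:E.
Proof.
by rewrite arc_lengthE setTI lebesgue_measure_itv /= lte_fin tau_gt0 oppr0 adde0.
Qed.

Lemma sigmaT_setT : sigmaT setT = (tau * tau)%:E.
Proof.
transitivity (arc_length setT * arc_length setT)%E; last by rewrite arc_lengthT EFinM.
by rewrite -setXTT; exact: product_measure1E.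
Qed.

Lemma sigmaT_fin : (sigmaT setT < +oo)%E.
Proof. by rewrite sigmaT_setT ltry. Qed.

Lemma arc_length_integrable (f : R -> R) (K : R) : measurable_fun setT f ->
  (forall x, `|f x| <= K) -> arc_length.-integrable setT (EFin \o f).
Proof.
move=> mf fK; apply: measurable_bounded_integrable => //.
  by rewrite ltey_eq fin_num_measure.
exists K; split; first exact: num_real.
by move=> M KM x _ /=; exact: le_trans (fK x) (ltW KM).
Qed.

(** [arc_length] lives on [[0, tau[] and the missing end point is null. This carries the integrals
    computed with [circ] over to the measure of the circle. *)
Lemma Rintegral_arc_length (f : R -> R) (K : R) : (forall x, {for x, continuous f}) ->
  (forall x, `|f x| <= K) ->
  \int[arc_length]_t f t = \int[@lebesgue_measure R]_(t in `[0, tau]) f t.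
Proof.
move=> cf fK.
have mf : measurable_fun setT f by exact: continuous_measurable_fun.
rewrite -Rintegral_itv_bndo_bndc; last first.
  apply: (@integrableS _ _ _ (@lebesgue_measure R) `[0, tau]) => //; last exact: integrable_itv.
  by apply: subset_itvl; rewrite bnd_simp.
have N0 : arc_length (~` `[0, tau[%classic) = 0.
  by rewrite arc_lengthE setICl measure0.
have mN : measurable (~` `[0, tau[%classic : set (measurableTypeR R)).
  by apply: measurableC; exact: measurable_itv.
rewrite /Rintegral (negligible_integral mN measurableT (arc_length_integrable mf fK) N0).
rewrite setTD setCK; congr fine; apply: eq_measure_integral => A mA sA.
exact: etrans (arc_lengthE A) (congr1 _ (setIidl sA)).
Qed.

Lemma integral_tensor (u v : R -> R) (K : R) :
  measurable_fun setT u -> measurable_fun setT v ->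
  (forall x, `|u x| <= K) -> (forall x, `|v x| <= K) ->
  \int[sigmaT]_t (u t.1 * v t.2) = (\int[arc_length]_t u t) * (\int[arc_length]_t v t).
Proof.
move=> mu mv uK vK.
have K0 : 0 <= K by apply: le_trans (uK 0).
have iu := arc_length_integrable mu uK.
have iv := arc_length_integrable mv vK.
have iuv : sigmaT.-integrable setT (EFin \o (fun t : angles => u t.1 * v t.2)).
  apply: measurable_bounded_integrable => //; first exact: sigmaT_fin.
    apply: measurable_funM; first exact: (measurableT_comp mu measurable_fst).
    exact: (measurableT_comp mv measurable_snd).
  exists (K * K); split; first exact: num_real.
  move=> M KM t _ /=; apply: le_trans (ltW KM).
  by rewrite normrM ler_pM.
rewrite {1}/Rintegral -(integral12_prod_meas1 iuv) /fubini_F /=.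
rewrite mulrC -RintegralZl// /Rintegral; congr fine.
apply: eq_integral => x _.
rewrite (EFinM (fine _)) fineK; last exact: (integrable_fin_num measurableT iv).
rewrite muleC; exact: (integralZl measurableT iv (u x)).
Qed.

End SigmaT.

(** * The inner product of L^2(T) *)

Section L2.
Variable R : realType.
Local Notation C := R[i].
Local Notation C2 := (R[i] * R[i])%type.
Local Notation angles := (measurableTypeR R * measurableTypeR R)%type.
Local Notation modulus := (@Normc.normc R).
Local Notation tau := (pi *+ 2 : R).
Local Notation sigmaT := (@sigmaT R).
Implicit Types (f g h : C2 -> C) (c : C) (e : R).

Definition torus_measurable f := cmeasurable (fun t : angles => f (polar t)).

Definition sqT f : R := \int[sigmaT]_t (modulus (f (polar t)) ^+ 2).

Definition sq_integrable f := sigmaT.-integrable setT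
  (EFin \o (fun t : angles => modulus (f (polar t)) ^+ 2)).

Lemma normT_poweR f :
  (normT f `^ 2%:R = \int[sigmaT]_t (modulus (f (polar t)) ^+ 2)%:E)%E.
Proof.
rewrite /normT powR_Lnorm ?pnatr_eq0//; apply: eq_integral => t _.
by rewrite gee0_abs ?lee_fin ?modulus_ge0// poweR_EFin powR_mulrn ?modulus_ge0.
Qed.

Lemma normT_ge0 f : (0 <= normT f)%E.
Proof. exact: Lnorm_ge0. Qed.

Lemma sqT_ge0 f : 0 <= sqT f.
Proof. by apply: Rintegral_ge0 => t _; exact: sqr_ge0. Qed.

Lemma L2TP f : L2T f <-> torus_measurable f /\ sq_integrable f.
Proof.
split=> [[m1 m2 fin]|[[m1 m2] /integrableP[_ fin]]].
  split; first by split.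
  apply/integrableP; split.
    by apply/measurable_EFinP; exact: (cmeasurable_sqr_modulus (conj m1 m2)).
  under eq_integral do rewrite gee0_abs ?lee_fin ?sqr_ge0//.
  by rewrite -normT_poweR poweR_lty.
split => //; move: fin.
under eq_integral do rewrite gee0_abs ?lee_fin ?sqr_ge0//.
rewrite -normT_poweR; have := normT_ge0 f.
by case: (normT f) => [r _ _|_|//]; rewrite ?ltry// poweRyr ?pnatr_eq0// ltxx.
Qed.

Lemma normTE f : L2T f -> normT f = (Num.sqrt (sqT f))%:E.
Proof.
move=> /L2TP [_ fin].
have := normT_poweR f; rewrite -[X in _ = X -> _](fineK (integrable_fin_num measurableT fin)).
rewrite -/(Rintegral _ _ _) -/(sqT f); have := normT_ge0 f.
case: (normT f) => [r r0|_|//]; last by rewrite poweRyr ?pnatr_eq0.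
rewrite poweR_EFin lee_fin in r0 * => -[]; rewrite powR_mulrn// => <-.
by rewrite sqrtr_sqr ger0_norm.
Qed.

Lemma normT_lt f e : L2T f -> 0 < e -> ((normT f < e%:E)%E <-> sqT f < e ^+ 2).
Proof.
move=> Lf e0; rewrite (normTE Lf) lte_fin -[X in _ < X]ger0_norm ?ltW//.
by rewrite -sqrtr_sqr ltr_sqrt// exprn_gt0.
Qed.

Lemma bounded_L2T f (K : R) : torus_measurable f ->
  (forall t, modulus (f (polar t)) <= K) -> L2T f.
Proof.
move=> mf fK; apply/L2TP; split => //.
apply: measurable_bounded_integrable => //; first exact: sigmaT_fin.
  exact: (cmeasurable_sqr_modulus mf).
exists (K ^+ 2); split; first exact: num_real.
move=> M KM t _ /=; apply: le_trans (ltW KM).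
rewrite ger0_norm ?sqr_ge0// lerXn2r ?nnegrE ?modulus_ge0//.
exact: le_trans (modulus_ge0 _) (fK t).
Qed.

Lemma bounded_sqT f (K : R) : L2T f -> 
  (forall t, modulus (f (polar t)) <= K) -> sqT f <= (K * tau) ^+ 2.
Proof.
move=> /L2TP [mf fin] fK.
have -> : (K * tau) ^+ 2 = \int[sigmaT]_t (K ^+ 2).
  by rewrite Rintegral_cst// sigmaT_setT /= exprMn expr2 [tau ^+ 2]expr2.
apply: le_Rintegral => //.
  apply: measurable_bounded_integrable => //; first exact: sigmaT_fin.
  exists (K ^+ 2); split; first exact: num_real.
  by move=> M KM t _ /=; rewrite ger0_norm ?sqr_ge0// ltW.
move=> t _; rewrite lerXn2r ?nnegrE ?modulus_ge0//.
exact: le_trans (modulus_ge0 _) (fK t).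
Qed.

Lemma L2T_mul_integrable f g : L2T f -> L2T g ->
  cintegrable sigmaT setT (fun t => f (polar t) * g (polar t)).
Proof.
move=> /L2TP[mf ff] /L2TP[mg gg].
have [m1 m2] := cmeasurable_mul mf mg.
have bd t : modulus (f (polar t) * g (polar t)) <=
    modulus (f (polar t)) ^+ 2 + modulus (g (polar t)) ^+ 2.
  rewrite modulusM; have := sqr_ge0 (modulus (f (polar t)) - modulus (g (polar t))).
  have := modulus_ge0 (f (polar t)); have := modulus_ge0 (g (polar t)).
  by move: (modulus _) (modulus _) => x y x0 y0; nra.
have fg := integrableD measurableT ff gg.
split; apply: le_integrable fg => //; try exact/measurable_EFinP.
  move=> t _ /=; rewrite lee_fin [leRHS]ger0_norm ?addr_ge0 ?sqr_ge0//.
  exact: le_trans (modulus_Re _) (bd t).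
move=> t _ /=; rewrite lee_fin [leRHS]ger0_norm ?addr_ge0 ?sqr_ge0//.
exact: le_trans (modulus_Im _) (bd t).
Qed.

Lemma L2T_conj f : L2T f -> L2T (fun w => (f w)^*).
Proof.
move=> /L2TP[mf ff]; apply/L2TP; split; first exact: (cmeasurable_conj mf).
by rewrite /sq_integrable; under eq_fun do rewrite modulus_conj.
Qed.

Lemma L2T_scale c f : L2T f -> L2T (fun w => c * f w).
Proof.
move=> /L2TP[mf ff]; apply/L2TP; split.
  exact: (cmeasurable_mul (cmeasurable_cst _ c) mf).
have := integrableZl measurableT (modulus c ^+ 2) ff.
by apply: eq_integrable => // t _ /=; rewrite modulusM exprMn EFinM.
Qed.

Lemma L2T_add f g : L2T f -> L2T g -> L2T (fun w => f w + g w).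
Proof.
move=> /L2TP[mf ff] /L2TP[mg gg]; apply/L2TP; split.
  exact: (cmeasurable_add mf mg).
have fg := integrableZl measurableT 2 (integrableD measurableT ff gg).
apply: le_integrable fg => //.
  by apply/measurable_EFinP; exact: (cmeasurable_sqr_modulus (cmeasurable_add mf mg)).
move=> t _ /=; rewrite lee_fin [leLHS]ger0_norm ?sqr_ge0// [leRHS]ger0_norm; last first.
  by apply: mulr_ge0 => //; apply: addr_ge0; exact: sqr_ge0.
have h := modulusD (f (polar t)) (g (polar t)).
have h0 := modulus_ge0 (f (polar t) + g (polar t)).
have h1 := modulus_ge0 (f (polar t)); have h2 := modulus_ge0 (g (polar t)).
have := sqr_ge0 (modulus (f (polar t)) - modulus (g (polar t))).
by nra.
Qed.

Lemma L2T_sub f g : L2T f -> L2T g -> L2T (fun w => f w - g w).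
Proof.
move=> Lf Lg; have := L2T_add Lf (L2T_scale (-1) Lg).
by under eq_fun do rewrite mulN1r.
Qed.

Definition innerT f g : C := integralT (fun w => f w * (g w)^*).

Lemma innerT_integrable f g : L2T f -> L2T g ->
  cintegrable sigmaT setT (fun t => f (polar t) * (g (polar t))^*).
Proof. by move=> Lf Lg; exact: L2T_mul_integrable Lf (L2T_conj Lg). Qed.

Lemma innerTD f g h : L2T f -> L2T g -> L2T h ->
  innerT (fun w => f w + g w) h = innerT f h + innerT g h.
Proof.
move=> Lf Lg Lh.
rewrite -[RHS](cintD measurableT (innerT_integrable Lf Lh) (innerT_integrable Lg Lh)).
by apply: eq_cint => t _; rewrite mulrDl.
Qed.

Lemma innerTZ c f h : L2T f -> L2T h ->
  innerT (fun w => c * f w) h = c * innerT f h.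
Proof.
move=> Lf Lh; rewrite -[RHS](cintZ measurableT c (innerT_integrable Lf Lh)).
by apply: eq_cint => t _; rewrite mulrA.
Qed.

Lemma innerTB f g h : L2T f -> L2T g -> L2T h ->
  innerT (fun w => f w - g w) h = innerT f h - innerT g h.
Proof.
move=> Lf Lg Lh; rewrite -mulN1r -innerTZ// -innerTD//; last exact: L2T_scale.
by apply: eq_cint => t _; rewrite mulN1r.
Qed.

Lemma innerT_conj f g : L2T f -> L2T g -> innerT g f = (innerT f g)^*%C.
Proof.
move=> Lf Lg; have [i1 i2] := innerT_integrable Lf Lg.
have E (z : C) : (z^*)%C = Complex (complex.Re z) (- complex.Im z) by case: z.
have S t : g (polar t) * (f (polar t))^* = ((f (polar t) * (g (polar t))^*)^*)%C.
  by rewrite rmorphM /= conjcK mulrC.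
rewrite /innerT /integralT /=; congr Complex.
  by apply: eq_Rintegral => t _; rewrite S E.
rewrite -mulN1r -RintegralZl//.
by apply: eq_Rintegral => t _; rewrite S E mulN1r.
Qed.

Lemma innerTT f : innerT f f = (sqT f)%:C%C.
Proof.
have S t : f (polar t) * (f (polar t))^* = (modulus (f (polar t)) ^+ 2)%:C%C.
  by rewrite -[LHS]sqr_normc normE -rmorphXn.
rewrite /innerT /integralT; congr Complex.
  by apply: eq_Rintegral => t _; rewrite S.
rewrite (@eq_Rintegral _ _ _ _ _ (fun=> 0)) => [|t _]; last by rewrite S.
by rewrite Rintegral_cst// mul0r.
Qed.

Lemma innerT_sum (I : Type) (s : seq I) (F : I -> C2 -> C) h :
  (forall i, L2T (F i)) -> L2T h ->
  innerT (fun w => \sum_(i <- s) F i w) h = \sum_(i <- s) innerT (F i) h.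
Proof.
move=> LF Lh.
rewrite -[RHS](cint_sum measurableT s (fun i => innerT_integrable (LF i) Lh)).
by apply: eq_cint => t _; rewrite mulr_suml.
Qed.

Lemma L2T_cst c : L2T (fun=> c).
Proof. by apply: (@bounded_L2T _ (modulus c)) => //; exact: cmeasurable_cst. Qed.

Lemma L2T_sum (I : Type) (s : seq I) (F : I -> C2 -> C) :
  (forall i, L2T (F i)) -> L2T (fun w => \sum_(i <- s) F i w).
Proof.
move=> LF; elim: s => [|i s IH].
  by under eq_fun do rewrite big_nil; exact: L2T_cst.
by under eq_fun do rewrite big_cons; exact: L2T_add.
Qed.

Lemma sqT_scale c f : L2T f -> sqT (fun w => c * f w) = modulus c ^+ 2 * sqT f.
Proof.
move=> /L2TP[_ ff]; rewrite /sqT -RintegralZl//.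
by apply: eq_Rintegral => t _; rewrite modulusM exprMn.
Qed.

Lemma sqT_add f g : L2T f -> L2T g ->
  sqT (fun w => f w + g w) = sqT f + sqT g + 2 * complex.Re (innerT f g).
Proof.
move=> Lf Lg; apply: complexI; rewrite -innerTT.
have Lfg := L2T_add Lf Lg.
rewrite innerTD// (innerT_conj Lfg Lf) (innerT_conj Lfg Lg) !innerTD// !innerTT.
rewrite (innerT_conj Lf Lg).
case: (innerT f g) => x y; apply/eqP; rewrite eq_complex /=; apply/andP.
by split; apply/eqP; ring.
Qed.

Lemma sqT_pythagoras f g : L2T f -> L2T g -> innerT f g = 0 ->
  sqT (fun w => f w + g w) = sqT f + sqT g.
Proof. by move=> Lf Lg fg; rewrite sqT_add// fg /= mulr0 addr0. Qed.

(** The parallelogram identity, with the square of the difference dropped. *)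
Lemma sqT_le_add f g : L2T f -> L2T g ->
  sqT (fun w => f w + g w) <= 2 * (sqT f + sqT g).
Proof.
move=> Lf Lg; have := sqT_add Lf (L2T_scale (-1) Lg).
rewrite sqT_scale// modulusN modulus1 expr1n mul1r.
have -> : innerT f (fun w => -1 * g w) = - innerT f g.
  rewrite (innerT_conj (L2T_scale (-1) Lg) Lf) innerTZ// (innerT_conj Lf Lg).
  rewrite mulN1r; case: (innerT f g) => x y.
  by apply/eqP; rewrite eq_complex /= !opprK !eqxx.
rewrite Re_opp => h; rewrite sqT_add//.
have := sqT_ge0 (fun w => f w + -1 * g w); rewrite h; lra.
Qed.

Lemma Re_conj_scale (l : R) (z : C) :
  complex.Re (((- (l%:C%C * z)) * z^*)^*)%C = - l * modulus z ^+ 2.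
Proof. by rewrite sqr_modulus; case: z => x y /=; ring. Qed.

(** Expand the squared norm of [f - l * I * g] for real [l], where [I] is the inner product; the
    optimal [l] is the inverse of [sqT g]. *)
Lemma cauchy_schwarz f g : L2T f -> L2T g ->
  modulus (innerT f g) ^+ 2 <= sqT f * sqT g.
Proof.
move=> Lf Lg; set I := innerT f g; set m := modulus I ^+ 2.
have key (l : R) : 0 <= sqT f - 2 * l * m + l ^+ 2 * m * sqT g.
  have := sqT_ge0 (fun w => f w + (- (l%:C%C * I)) * g w).
  rewrite sqT_add//; last exact: L2T_scale.
  rewrite sqT_scale// modulusN modulusM modulus_real exprMn real_normK ?num_real//.
  rewrite (innerT_conj (L2T_scale _ Lg) Lf) innerTZ// (innerT_conj Lf Lg) -/I -/m.
  by rewrite Re_conj_scale -/m => h; lra.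
have m0 : 0 <= m by exact: sqr_ge0.
have := sqT_ge0 g; rewrite le_eqVlt => /predU1P[g0|g0].
  rewrite -g0 mulr0; rewrite leNgt; apply/negP => mp.
  (* With [sqT g = 0] the expression is affine in [l], and this [l] gives it the value -1. *)
  have := key ((sqT f + 1) / (2 * m)); rewrite -g0 mulr0 addr0.
  have -> : 2 * ((sqT f + 1) / (2 * m)) * m = sqT f + 1.
    by field; rewrite gt_eqF.
  lra.
have := key (sqT g)^-1; move: g0; move: (sqT f) (sqT g) => a b b0.
have -> : a - 2 * b^-1 * m + b^-1 ^+ 2 * m * b = (a * b - m) / b.
  by field; rewrite gt_eqF.
by rewrite pmulr_lge0 ?invr_gt0// subr_ge0.
Qed.

Lemma sqT_eq0 f : L2T f -> sqT f = 0 -> {ae sigmaT, forall t, f (polar t) = 0}.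
Proof.
move=> /L2TP[mf ff] f0.
have mm : measurable_fun setT (fun t : angles => (modulus (f (polar t)) ^+ 2)%:E).
  by apply/measurable_EFinP; exact: (cmeasurable_sqr_modulus mf).
have : (\int[sigmaT]_t `|(modulus (f (polar t)) ^+ 2)%:E| = 0)%E.
  under eq_integral do rewrite gee0_abs ?lee_fin ?sqr_ge0//.
  by rewrite -(fineK (integrable_fin_num measurableT ff)) -/(Rintegral _ _ _) -/(sqT f) f0.
move=> /(ae_eq_integral_abs sigmaT measurableT mm).
apply: filterS => t /(_ I) [] /eqP; rewrite sqrf_eq0 modulus_eq0 => /eqP; exact.
Qed.

End L2.

(** * Fourier coefficients *)

Section Fourier.
Variable R : realType.
Local Notation C := R[i].
Local Notation C2 := (R[i] * R[i])%type.
Local Notation angles := (measurableTypeR R * measurableTypeR R)%type.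
Local Notation modulus := (@Normc.normc R).
Local Notation tau := (pi *+ 2 : R).
Local Notation sigmaT := (@sigmaT R).
Local Notation arc_length := (@arc_length R).
Local Notation expi := (@expi R).
Local Notation monomialT := (@monomialT R).
Local Notation K := ((4 * pi ^+ 2)%:C%C : C).
Implicit Types (f g h : C2 -> C) (p q : int * int) (n m : int).

Lemma expi_exprz n (t : R) : expi t ^ n = expi (n%:~R * t).
Proof.
have nat_case (m : nat) : expi t ^+ m = expi (m%:R * t).
  elim: m => [|m IH]; first by rewrite expr0 mul0r expi0.
  by rewrite exprSr IH -natr1 mulrDl mul1r expiD.
case: n => m; first exact: nat_case.
apply: (mulfI (_ : expi t ^+ m.+1 != 0)); first by rewrite expf_neq0// expi_neq0.
rewrite [RHS](_ : _ = 1) ?mulfV ?expf_neq0 ?expi_neq0//.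
rewrite nat_case -expiD NegzE rmorphN /= mulNr.
by rewrite (_ : _ + _ = 0) ?expi0// addrN.
Qed.

Lemma expi_neg (t : R) : expi (- t) = (expi t)^*%C.
Proof. by rewrite /Defs.expi cosN sinN. Qed.

Lemma monomialT_polar p (t : angles) :
  monomialT p (polar t) = expi (p.1%:~R * t.1) * expi (p.2%:~R * t.2).
Proof. by rewrite /Defs.monomialT /= !expi_exprz. Qed.

Lemma modulus_monomialT p (t : angles) : modulus (monomialT p (polar t)) = 1.
Proof. by rewrite monomialT_polar modulusM !modulus_expi mulr1. Qed.

Lemma continuous_expi_scale (a x : R) : {for x, continuous (fun t => expi (a * t))}.
Proof.
apply: (@continuous_comp _ _ _ (fun t : R => a * t) expi).
  by apply: cvgM; [exact: cvg_cst | exact: cvg_id].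
exact: continuous_expi.
Qed.

Lemma measurable_Re_expi (a : R) : measurable_fun setT (fun t : R => complex.Re (expi (a * t))).
Proof.
apply: continuous_measurable_fun => x.
exact: continuous_Re (@continuous_expi_scale a x).
Qed.

Lemma measurable_Im_expi (a : R) : measurable_fun setT (fun t : R => complex.Im (expi (a * t))).
Proof.
apply: continuous_measurable_fun => x.
exact: continuous_Im (@continuous_expi_scale a x).
Qed.

Lemma monomialT_measurable p : torus_measurable (monomialT p).
Proof.
rewrite /torus_measurable; under eq_fun do rewrite monomialT_polar.
apply: cmeasurable_mul; split.
- exact: (measurableT_comp (measurable_Re_expi _) measurable_fst).
- exact: (measurableT_comp (measurable_Im_expi _) measurable_fst).
- exact: (measurableT_comp (measurable_Re_expi _) measurable_snd).
- exact: (measurableT_comp (measurable_Im_expi _) measurable_snd).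
Qed.

Lemma L2T_monomialT p : L2T (monomialT p).
Proof.
apply: (@bounded_L2T _ _ 1); first exact: monomialT_measurable.
by move=> t; rewrite modulus_monomialT.
Qed.

Lemma circ_expi n : circ (fun t => expi (n%:~R * t)) = if n == 0 then tau%:C%C else 0.
Proof.
have E t : expi (n%:~R * t) = expi t ^ n by rewrite expi_exprz.
rewrite (eq_circ E); case: n {E} => [[|m]|m].
- by rewrite eqxx -[RHS]mulr1 -(circ_cst 1); apply: eq_circ => t; rewrite expr0z.
- by rewrite (@circ_expi_pos R m.+1).
- by rewrite (@circ_expi_neg R m.+1).
Qed.

Lemma arc_length_expi n :
  \int[arc_length]_t complex.Re (expi (n%:~R * t)) = (if n == 0 then tau else 0) /\
  \int[arc_length]_t complex.Im (expi (n%:~R * t)) = 0.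
Proof.
have c x := @continuous_expi_scale n%:~R x.
have bR x : `|complex.Re (expi (n%:~R * x))| <= 1.
  by apply: le_trans (modulus_Re _) _; rewrite modulus_expi.
have bI x : `|complex.Im (expi (n%:~R * x))| <= 1.
  by apply: le_trans (modulus_Im _) _; rewrite modulus_expi.
rewrite (Rintegral_arc_length (fun x => continuous_Re (c x)) bR).
rewrite (Rintegral_arc_length (fun x => continuous_Im (c x)) bI).
have := congr1 (@complex.Im R) (circ_expi n); have := congr1 (@complex.Re R) (circ_expi n).
by rewrite /circ /cint /= => -> ->; case: eqP.
Qed.

(** [integral_tensor] handles real products, so the real and imaginary parts are each written as two
    products of functions of one angle. *)
Lemma integral_expi2 m n :
  integralT (monomialT (m, n)) = if (m == 0) && (n == 0) then K else 0.
Proof.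
have b1 (a x : R) : `|complex.Re (expi (a * x))| <= 1.
  by apply: le_trans (modulus_Re _) _; rewrite modulus_expi.
have b2 (a x : R) : `|complex.Im (expi (a * x))| <= 1.
  by apply: le_trans (modulus_Im _) _; rewrite modulus_expi.
have [c1 s1] := arc_length_expi m; have [c2 s2] := arc_length_expi n.
pose u1 x := complex.Re (expi (m%:~R * x)); pose v1 x := complex.Im (expi (m%:~R * x)).
pose u2 x := complex.Re (expi (n%:~R * x)); pose v2 x := complex.Im (expi (n%:~R * x)).
have mu1 : measurable_fun setT u1 by exact: measurable_Re_expi.
have mu2 : measurable_fun setT u2 by exact: measurable_Re_expi.
have mv1 : measurable_fun setT v1 by exact: measurable_Im_expi.
have mv2 : measurable_fun setT v2 by exact: measurable_Im_expi.
have int (u v : R -> R) : measurable_fun setT u -> measurable_fun setT v ->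
   (forall x, `|u x| <= 1) -> (forall x, `|v x| <= 1) ->
   sigmaT.-integrable setT (EFin \o (fun t : angles => u t.1 * v t.2)).
  move=> mu mv bu bv.
  apply: measurable_bounded_integrable => //; first exact: sigmaT_fin.
    apply: measurable_funM; first exact: (measurableT_comp mu measurable_fst).
    exact: (measurableT_comp mv measurable_snd).
  exists 1; split; first exact: num_real.
  move=> M KM t _ /=; apply: le_trans (ltW KM).
  by rewrite normrM mulr_ile1.
have eR : \int[sigmaT]_t complex.Re (monomialT (m, n) (polar t)) =
    \int[sigmaT]_t (u1 t.1 * u2 t.2 - v1 t.1 * v2 t.2).
  by apply: eq_Rintegral => t _; rewrite monomialT_polar Re_mul.
have eI : \int[sigmaT]_t complex.Im (monomialT (m, n) (polar t)) =
    \int[sigmaT]_t (u1 t.1 * v2 t.2 + v1 t.1 * u2 t.2).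
  by apply: eq_Rintegral => t _; rewrite monomialT_polar Im_mul.
rewrite /integralT eR eI (RintegralB measurableT (int _ _ mu1 mu2 (b1 _) (b1 _)) (int _ _ mv1 mv2 (b2 _) (b2 _))).
rewrite (RintegralD measurableT (int _ _ mu1 mv2 (b1 _) (b2 _)) (int _ _ mv1 mu2 (b2 _) (b1 _))).
rewrite (integral_tensor mu1 mu2 (b1 _) (b1 _)) (integral_tensor mv1 mv2 (b2 _) (b2 _)).
rewrite (integral_tensor mu1 mv2 (b1 _) (b2 _)) (integral_tensor mv1 mu2 (b2 _) (b1 _)).
rewrite /u1 /u2 /v1 /v2 c1 c2 s1 s2 !mul0r !mulr0 subr0 addr0.
case: eqP => _; case: eqP => _; rewrite ?mul0r ?mulr0 //=.
by rewrite -mulr_natl; congr Complex; ring.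
Qed.

Lemma innerT_monomialT p q :
  innerT (monomialT p) (monomialT q) = if p == q then K else 0.
Proof.
have -> : (p == q) = (p.1 - q.1 == 0) && (p.2 - q.2 == 0) by rewrite !subr_eq0 -pair_eqE.
rewrite -integral_expi2; apply: eq_cint => t _ /=.
rewrite !monomialT_polar /= !rmorphM /= !intrD !intrN !mulrDl !mulNr !expiD !expi_neg.
by rewrite mulrACA.
Qed.

Lemma K_neq0 : K != 0.
Proof.
by rewrite -modulus_gt0 modulus_real normr_gt0 mulf_neq0 ?pnatr_eq0// expf_neq0// gt_eqF// pi_gt0.
Qed.

Lemma fourierE f p : fourier f p = K^-1 * innerT f (monomialT p).
Proof. by []. Qed.

Definition trig (A : {fset int * int}) (c : int * int -> C) (w : C2) : C :=
  \sum_(p <- A) c p * monomialT p w.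

Lemma L2T_trig A c : L2T (trig A c).
Proof. by apply: L2T_sum => p; apply: L2T_scale; exact: L2T_monomialT. Qed.

Lemma innerT_trig (A : {fset int * int}) c q :
  innerT (trig A c) (monomialT q) = if q \in A then c q * K else 0.
Proof.
rewrite innerT_sum; last 2 first.
- by move=> p; apply: L2T_scale; exact: L2T_monomialT.
- exact: L2T_monomialT.
have E p : innerT (fun w => c p * monomialT p w) (monomialT q) = if p == q then c q * K else 0.
  rewrite innerTZ; try exact: L2T_monomialT.
  by rewrite innerT_monomialT; case: eqP => [->|]; rewrite ?mulr0.
rewrite (eq_bigr _ (fun p _ => E p)); case: ifPn => qA.
  rewrite (bigD1_seq q) ?fset_uniq//= eqxx big1 ?addr0// => p /negbTE ->; exact.
by rewrite big_seq big1// => p pA; case: eqP => // pq; move: qA; rewrite -pq pA.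
Qed.

(** The two approximants differ by a combination of monomials indexed by [B], each orthogonal to [f]
    minus its Fourier sum over [B]; Pythagoras concludes. *)
Lemma fourier_best f (B : {fset int * int}) c : L2T f ->
  sqT (fun w => f w - trig B (fourier f) w) <= sqT (fun w => f w - trig B c w).
Proof.
move=> Lf; pose S := trig B (fourier f); pose D := trig B (fun p => fourier f p - c p).
have LS : L2T S by exact: L2T_trig.
have LD : L2T D by exact: L2T_trig.
have LfS := L2T_sub Lf LS.
have -> : (fun w => f w - trig B c w) = (fun w => (f w - S w) + D w).
  apply/funext => w; rewrite -addrA; congr (_ + _).
  rewrite /S /D /trig -!sumrN -big_split /=; apply: eq_bigr => p _.
  by rewrite mulrBl addrA addNr sub0r.
suff orth : innerT (fun w => f w - S w) D = 0.
  by rewrite (sqT_pythagoras LfS LD orth) lerDl sqT_ge0.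
rewrite (innerT_conj LD LfS) innerT_sum//; last first.
  by move=> p; apply: L2T_scale; exact: L2T_monomialT.
rewrite big_seq big1 ?conjc0// => p pB.
rewrite innerTZ//; last exact: L2T_monomialT.
rewrite (innerT_conj LfS (L2T_monomialT p)) innerTB//; last exact: L2T_monomialT.
by rewrite innerT_trig pB fourierE mulrAC mulVf ?K_neq0// mul1r subrr conjc0 mulr0.
Qed.

End Fourier.

(** * The Hardy spaces *)

Section HardySpace.
Variable R : realType.
Local Notation C := R[i].
Local Notation C2 := (R[i] * R[i])%type.
Local Notation angles := (measurableTypeR R * measurableTypeR R)%type.
Local Notation modulus := (@Normc.normc R).
Local Notation tau := (pi *+ 2 : R).
Local Notation monomialT := (@monomialT R).
Local Notation hartogs := (@hartogs R).
Local Notation torus := (@torus R).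
Local Notation K := ((4 * pi ^+ 2)%:C%C : C).
Implicit Types (f g h F G : C2 -> C) (p q : int * int) (k : nat) (z w : C2).

Lemma A_intro F k : (forall z, hartogs z -> differentiable F z) ->
  {within hartogs `|` torus, continuous F} ->
  (exists M d : R, 0 < d /\ forall z, hartogs z -> modulus z.1 < d ->
     modulus z.2 < d -> modulus (z.2 ^+ k * F z) <= M) -> A_ k F.
Proof.
move=> dF cF [M [d [d0 dP]]]; split=> //.
exists M%:C%C; split; first by rewrite complex_real.
move=> N MN; exists ([set z | modulus z < d], [set z | modulus z < d]) => /=.
  by split; apply/nbhs_complexP; exists d => // z; rewrite subr0.
move=> z /= [z1 z2] hz; apply: le_trans (ltW MN).
by rewrite normE lecR; exact: dP.
Qed.

Lemma A_cst0 k : A_ k (fun=> 0 : C).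
Proof.
apply: A_intro => [z _||]; first exact: differentiable_cst.
  by move=> x; exact: cvg_cst.
by exists 0, 1; split => // z _ _ _; rewrite mulr0 modulus0.
Qed.

Lemma A_add F G k : A_ k F -> A_ k G -> A_ k (fun w => F w + G w).
Proof.
move=> AF AG; have [dF cF _] := AF; have [dG cG _] := AG.
have [M1 [d1 [d10 P1]]] := A_bounded AF; have [M2 [d2 [d20 P2]]] := A_bounded AG.
apply: A_intro => [z hz||].
- by apply: differentiableD; [exact: dF|exact: dG].
- by move=> x; exact: continuous_add (cF x) (cG x).
exists (M1 + M2), (Num.min d1 d2); split; first by rewrite lt_min d10.
move=> z hz; rewrite !lt_min => /andP[a1 a2] /andP[b1 b2].
rewrite mulrDr; apply: le_trans (modulusD _ _) _; apply: lerD.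
  exact: P1.
exact: P2.
Qed.

Lemma A_scale (c : C) F k : A_ k F -> A_ k (fun w => c * F w).
Proof.
move=> AF; have [dF cF _] := AF; have [M [d [d0 P]]] := A_bounded AF.
apply: A_intro => [z hz||].
- by apply: differentiableM; [exact: differentiable_cst|exact: dF].
- by move=> x; apply: continuous_mul (cF x); exact: cvg_cst.
exists (modulus c * M), d; split => // z hz z1 z2.
by rewrite mulrCA modulusM ler_wpM2l ?modulus_ge0//; exact: P.
Qed.

Lemma A_sub F G k : A_ k F -> A_ k G -> A_ k (fun w => F w - G w).
Proof.
move=> AF AG; have := A_add AF (A_scale (-1) AG).
by under eq_fun do rewrite mulN1r.
Qed.

Lemma A_sum (I : eqType) (s : seq I) (F : I -> C2 -> C) k :
  (forall i, i \in s -> A_ k (F i)) -> A_ k (fun w => \sum_(i <- s) F i w).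
Proof.
elim: s => [|i s IH] AF.
  by under eq_fun do rewrite big_nil; exact: A_cst0.
under eq_fun do rewrite big_cons.
apply: A_add; first by apply: AF; rewrite mem_head.
by apply: IH => j js; apply: AF; rewrite in_cons js orbT.
Qed.

Definition allowed k p := (0 <= p.1) && (0 <= p.2 + p.1 + k%:Z).

Lemma modulus_exprz (z : C) (n : int) : modulus (z ^ n) = modulus z ^ n.
Proof.
case: n => n; first exact: modulusX.
by rewrite NegzE -exprnN -exprnN modulusV modulusX.
Qed.

Lemma differentiable_fst (z : C2) : differentiable (fun w : C2 => w.1) z.
Proof. by apply: linear_differentiable => p; exact: cvg_fst. Qed.

Lemma differentiable_snd (z : C2) : differentiable (fun w : C2 => w.2) z.
Proof. by apply: linear_differentiable => p; exact: cvg_snd. Qed.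

Lemma differentiable_exprz (n : int) (z : C) : z != 0 ->
  differentiable (fun w : C => w ^ n) z.
Proof.
move=> z0; case: n => n; first exact: differentiable_exp.
rewrite (_ : (fun _ => _) = (fun w : C => (w ^+ n.+1)^-1)); last first.
  by apply/funext => w; rewrite NegzE -exprnN.
by apply: differentiableV; [exact: differentiable_exp | rewrite expf_neq0].
Qed.

Lemma differentiable_monomialT p z : 0 <= p.1 -> z.2 != 0 ->
  differentiable (monomialT p) z.
Proof.
case: p => -[a|//] l _ z20; apply: differentiableM.
  apply: (@differentiable_comp _ _ _ _ (fun w : C2 => w.1) (fun w : C => w ^+ a)).
    exact: differentiable_fst.
  exact: differentiable_exp.
apply: (@differentiable_comp _ _ _ _ (fun w : C2 => w.2) (fun w : C => w ^ l)).
  exact: differentiable_snd.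
exact: differentiable_exprz.
Qed.

Lemma hartogs_neq0 z : hartogs z -> z.2 != 0.
Proof.
by move=> /hartogsE[z12 _]; rewrite -modulus_gt0 (le_lt_trans (modulus_ge0 _) z12).
Qed.

Lemma torus_neq0 z : torus z -> z.2 != 0.
Proof. by move=> /torusE[_ z2]; rewrite -modulus_gt0 z2. Qed.

(** On the triangle [|z.1| < |z.2|], so a nonnegative power of [z.1] is bounded by the same power of
    [z.2], and what remains is [|z.2|] to the nonnegative power [k + a + l]. Regularity only needs
    [z.2] nonzero, which holds on the torus too. *)
Lemma A_monomialT p k : allowed k p -> A_ k (monomialT p).
Proof.
move=> /andP[p1 p2]; apply: A_intro => [z hz||].
- by apply: differentiable_monomialT => //; exact: hartogs_neq0.
- apply: continuous_in_subspaceT => z /set_mem hz.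
  apply: differentiable_continuous; apply: differentiable_monomialT => //.
  by case: hz; [exact: hartogs_neq0|exact: torus_neq0].
exists 1, 1; split => // z hz _ _; have z20 := hartogs_neq0 hz.
have [z12 z21] := (hartogsE z).1 hz.
have m20 : modulus z.2 != 0 by rewrite modulus_eq0.
rewrite /Defs.monomialT !modulusM !modulus_exprz modulusX.
case: p p1 p2 => -[a|//] l /= _ p2.
apply: (@le_trans _ _ (modulus z.2 ^+ k * (modulus z.2 ^+ a * modulus z.2 ^ l))).
  apply: ler_wpM2l; first by rewrite exprn_ge0 ?modulus_ge0.
  apply: ler_wpM2r; first by rewrite exprz_ge0 ?modulus_ge0.
  by apply: lerXn2r; rewrite ?nnegrE ?modulus_ge0// ltW.
rewrite !exprnP -!expfzDr// addrA addrC [k%:Z + _]addrC addrA.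
case: (l + _ + _) p2 => // n _.
by rewrite -exprnP exprn_ile1 ?modulus_ge0// ltW.
Qed.

Definition allowed_poly k (P : C2 -> C) := exists (A : {fset int * int}) (c : int * int -> C),
  (forall p, p \in A -> allowed k p) /\ forall w, P w = trig A c w.

Lemma allowed_poly_A k P : allowed_poly k P -> A_ k P.
Proof.
move=> [A [c [hA PE]]]; rewrite (_ : P = trig A c); last by apply/funext.
by apply: A_sum => p pA; apply: A_scale; apply: A_monomialT; exact: hA.
Qed.

Lemma allowed_poly_L2T k P : allowed_poly k P -> L2T P.
Proof.
move=> [A [c [hA PE]]]; rewrite (_ : P = trig A c); last by apply/funext.
exact: L2T_trig.
Qed.

Lemma allowed_poly0 k : allowed_poly k (fun=> 0).
Proof. by exists fset0, (fun=> 0); split => // w; rewrite /trig big_seq_fset0. Qed.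

Lemma allowed_poly_monomial k (c : C) p : allowed k p ->
  allowed_poly k (fun w => c * monomialT p w).
Proof.
move=> hp; exists [fset p]%fset, (fun=> c); split; first by move=> q /fset1P ->.
by move=> w; rewrite /trig big_seq_fset1.
Qed.

Lemma trig_incl (A B : {fset int * int}) c w : (A `<=` B)%fset ->
  trig A c w = trig B (fun p => if p \in A then c p else 0) w.
Proof.
move=> AB; rewrite /trig -(big_fset_incl _ AB); last first.
  by move=> p _ /negbTE ->; rewrite mul0r.
by rewrite big_seq [RHS]big_seq; apply: eq_bigr => p ->.
Qed.

Lemma allowed_poly_add k P Q : allowed_poly k P -> allowed_poly k Q ->
  allowed_poly k (fun w => P w + Q w).
Proof.
move=> [A [c [hA PE]]] [B [d [hB QE]]].
exists (A `|` B)%fset, (fun p => (if p \in A then c p else 0) + (if p \in B then d p else 0)).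
split=> [p|w]; first by rewrite in_fsetU => /orP[/hA|/hB].
rewrite PE QE (trig_incl c w (fsubsetUl A B)) (trig_incl d w (fsubsetUr A B)).
by rewrite /trig -big_split; apply: eq_bigr => p _; rewrite mulrDl.
Qed.

Lemma allowed_poly_sum k (I : Type) (s : seq I) (P : I -> C2 -> C) :
  (forall i, allowed_poly k (P i)) -> allowed_poly k (fun w => \sum_(i <- s) P i w).
Proof.
move=> hP; elim: s => [|i s IH].
  by under eq_fun do rewrite big_nil; exact: allowed_poly0.
by under eq_fun do rewrite big_cons; exact: allowed_poly_add.
Qed.

Lemma allowed_poly_square k N N' (c : nat -> nat -> C) :
  allowed_poly k (fun w => \sum_(a < N') \sum_(b < N)
    c a b * monomialT (a%:Z, b%:Z - a%:Z - k%:Z) w).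
Proof.
apply: allowed_poly_sum => a; apply: allowed_poly_sum => b.
apply: allowed_poly_monomial; rewrite /allowed /=.
by have -> : b%:Z - a%:Z - k%:Z + a%:Z + k%:Z = b%:Z by ring.
Qed.

Lemma A_poly_approx F k z (e : R) : A_ k F -> hartogs z -> 0 < e ->
  exists2 P, allowed_poly k P &
    (forall t, modulus (F (polar t) - P (polar t)) <= e) /\ modulus (F z - P z) <= e.
Proof.
move=> AF hz e0; have [N [N' [c cP]]] := A_square_approx AF hz e0.
by eexists; [exact: (allowed_poly_square k N N' c) | exact: cP].
Qed.

Lemma trig_bounded A c (t : angles) :
  modulus (trig A c (polar t)) <= \sum_(p <- A) modulus (c p).
Proof.
apply: le_trans (modulus_sum _ _) _; apply: ler_sum => p _.
by rewrite modulusM modulus_monomialT mulr1.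
Qed.

(** A point to feed to [A_poly_approx] where only the approximation on the torus matters. *)
Lemma hartogs_point : hartogs (0, (2^-1 : R)%:C%C).
Proof.
have e : modulus (2^-1 : R)%:C%C = 2^-1.
  by rewrite modulus_real gtr0_norm ?invr_gt0.
apply/hartogsE; split.
  by change (modulus (0 : C) < modulus (2^-1 : R)%:C%C); rewrite modulus0 e invr_gt0.
by change (modulus (2^-1 : R)%:C%C < 1); rewrite e invf_lt1 ?ltr0n ?ltr1n.
Qed.

(** The bound comes from one approximant; measurability comes from a sequence of them. This is how
    functions of [A_ k] and the kernel are seen to be in [L2T]. *)
Lemma uniform_limit_L2T f k :
  (forall e : R, 0 < e -> exists2 P, allowed_poly k P &
     forall t, modulus (f (polar t) - P (polar t)) <= e) -> L2T f.
Proof.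
move=> lim.
have [P [A [c [_ PE]]] P1] := lim 1 ltr01.
apply: (@bounded_L2T _ _ (1 + \sum_(p <- A) modulus (c p))); last first.
  move=> t; have := modulusD (f (polar t) - P (polar t)) (P (polar t)).
  rewrite subrK => /le_trans; apply; apply: lerD; first exact: P1.
  by rewrite PE trig_bounded.
have /choice[Q QP] : forall n : nat, exists Q, allowed_poly k Q /\
    forall t, modulus (f (polar t) - Q (polar t)) <= n.+1%:R^-1.
  by move=> n; have [|Q h1 h2] := lim n.+1%:R^-1; [rewrite invr_gt0 | exists Q].
apply: (@cmeasurable_lim _ _ _ _ (fun n t => Q n (polar t))) => [n|n t].
  have [AQ _] := QP n.
  by have /L2TP[] := allowed_poly_L2T AQ.
by have [_] := QP n; apply.
Qed.

Lemma A_L2T F k : A_ k F -> L2T F.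
Proof.
move=> AF; apply: (@uniform_limit_L2T _ k) => e e0.
by have [P h1 [h2 _]] := A_poly_approx AF hartogs_point e0; exists P.
Qed.

Lemma sqT_sub0 f : sqT (fun w => f w - f w) = 0.
Proof.
rewrite /sqT (@eq_Rintegral _ _ _ _ _ (fun=> 0)) => [|t _].
  by rewrite Rintegral_cst// mul0r.
by rewrite subrr modulus0 expr0n.
Qed.

Lemma A_H2 F k : A_ k F -> H2_ k F.
Proof.
move=> AF; have LF := A_L2T AF; split => // e e0; exists F => //.
by apply/normT_lt => //; [exact: L2T_sub | rewrite sqT_sub0 exprn_gt0].
Qed.

Lemma uniform_limit_H2 f k :
  (forall e : R, 0 < e -> exists2 P, allowed_poly k P &
     forall t, modulus (f (polar t) - P (polar t)) <= e) -> H2_ k f.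
Proof.
move=> lim; have Lf := uniform_limit_L2T lim; split => // e e0.
have t0 := tau_gt0 R.
(* By [bounded_sqT] such a uniform error gives a squared norm of at most [(e / 2) ^+ 2]. *)
have [|P AP hP] := lim (e / (2 * tau)); first by rewrite divr_gt0// mulr_gt0.
have LP := allowed_poly_L2T AP.
exists P; first exact: allowed_poly_A.
apply/normT_lt => //; first exact: L2T_sub.
apply: le_lt_trans (bounded_sqT (L2T_sub Lf LP) hP) _.
have -> : e / (2 * tau) * tau = e / 2.
  by have : tau != 0 by [rewrite gt_eqF]; move: tau => x x0; field.
by rewrite ltrXn2r// ?nnegrE ?divr_ge0 ?ltW// ltr_pdivrMr// ltr_pMr// ltr1n.
Qed.

Lemma H2_approx f k (e : R) : H2_ k f -> 0 < e ->
  exists2 P, allowed_poly k P & sqT (fun w => f w - P w) < e.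
Proof.
(* The squared errors will be below [e / 4] from [f] to [F] and at most [e / 16] from [F] to [P];
   twice their sum is below [e]. *)
move=> [Lf hf] e0; have s0 : 0 < Num.sqrt (e / 4) by rewrite sqrtr_gt0 divr_gt0.
have [F AF fF] := hf _ s0; have LF := A_L2T AF.
have t0 := tau_gt0 R; pose e' := Num.sqrt (e / 4) / (2 * tau).
have e'0 : 0 < e' by rewrite divr_gt0// mulr_gt0.
have [P AP [FP _]] := A_poly_approx AF hartogs_point e'0.
exists P => //; have LP := allowed_poly_L2T AP.
have -> : (fun w => f w - P w) = (fun w => (f w - F w) + (F w - P w)).
  by apply/funext => w; rewrite addrA subrK.
apply: le_lt_trans (sqT_le_add (L2T_sub Lf LF) (L2T_sub LF LP)) _.
have h1 : sqT (fun w => f w - F w) < e / 4.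
  by move/normT_lt : fF => /(_ (L2T_sub Lf LF) s0); rewrite sqr_sqrtr// divr_ge0// ltW.
have h2 : sqT (fun w => F w - P w) <= e / 16.
  apply: le_trans (bounded_sqT (L2T_sub LF LP) FP) _.
  have -> : e' * tau = Num.sqrt (e / 4) / 2.
    by rewrite /e'; have : tau != 0 by [rewrite gt_eqF]; move: tau => x x0; field.
  rewrite expr_div_n sqr_sqrtr; last by rewrite divr_ge0// ltW.
  by rewrite le_eqVlt; apply/orP; left; apply/eqP; field.
lra.
Qed.

(** An allowed polynomial has no coefficient at [p], so subtracting a close one does not change the
    coefficient, and Cauchy-Schwarz makes it arbitrarily small. *)
Lemma H2_fourier0 f k p : H2_ k f -> ~~ allowed k p -> fourier f p = 0.
Proof.
move=> hf np; rewrite fourierE; apply/eqP; rewrite mulf_eq0; apply/orP; right.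
rewrite -modulus_eq0 -sqrf_eq0; apply/eqP.
apply: (@eq0_le_mul_pos _ _ (sqT (monomialT p))) => [|e e0]; first exact: sqr_ge0.
have [P AP fP] := H2_approx hf e0; have [Lf _] := hf.
have LP := allowed_poly_L2T AP.
have -> : innerT f (monomialT p) = innerT (fun w => f w - P w) (monomialT p).
  rewrite innerTB//; last exact: L2T_monomialT.
  case: AP => A [c [hA PE]]; rewrite (_ : P = trig A c); last by apply/funext.
  rewrite innerT_trig ifN ?subr0//; apply/negP => /hA.
  by rewrite (negbTE np).
apply: le_trans (cauchy_schwarz (L2T_sub Lf LP) (@L2T_monomialT R p)) _.
by rewrite mulrC ler_wpM2l ?sqT_ge0// ltW.
Qed.

(** One good approximant over [A], extended by zero coefficients, competes with the Fourier sum over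
    every larger [B]. This gives summability without a prescribed order. *)
Lemma fourier_sums f (e : R) : L2T f -> 0 < e ->
  forall A c, sqT (fun w => f w - trig A c w) < e ^+ 2 ->
  forall B, (A `<=` B)%fset ->
  (normT (fun w => f w - \sum_(p <- B) fourier f p * monomialT p w)%R < e%:E)%E.
Proof.
move=> Lf e0 A c fA B AB.
apply/normT_lt => //; first exact: (L2T_sub Lf (L2T_trig B (fourier f))).
apply: le_lt_trans fA.
rewrite (_ : (fun w => f w - trig A c w) = (fun w => f w - trig B (fun p => if p \in A then c p else 0) w)).
  exact: fourier_best.
by apply/funext => w; rewrite (trig_incl _ _ AB).
Qed.

Lemma allowedPn k (j l : int) : (Num.min j (l + j + k%:Z) < 0) = ~~ allowed k (j, l).
Proof. by rewrite /allowed /= gt_min negb_and -!ltNge. Qed.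

Lemma H2_characterization k : @H2_ R k = [set f | [/\ L2T f, sumsT (fourier f) f
  & forall j l : int, Num.min j (l + j + k%:Z) < 0 -> fourier f (j, l) = 0]].
Proof.
apply/seteqP; split=> f.
  move=> hf; have [Lf _] := hf; split => //.
    move=> e e0; have [P [A [c [hA PE]]] fP] := H2_approx hf (exprn_gt0 2 e0).
    exists A => B AB; apply: (fourier_sums Lf e0 (A := A) (c := c)) AB.
    by rewrite (_ : trig A c = P)//; apply/funext => w; rewrite PE.
  by move=> j l; rewrite allowedPn; exact: H2_fourier0.
move=> [Lf sf f0]; split => // e e0.
have [A AP] := sf e e0.
(* Forbidden coefficients vanish, so the Fourier sums of [f] themselves lie in [A_ k]. *)
exists (trig A (fourier f)); last exact: AP (fsubset_refl A).
apply: A_sum => -[j l] _; have [jl|] := boolP (allowed k (j, l)).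
  by apply: A_scale; exact: A_monomialT.
rewrite -allowedPn => /f0 ->; under eq_fun do rewrite mul0r; exact: A_cst0.
Qed.

Lemma H2_not_stabilize :
  ~ (exists k0 : nat, forall k : nat, (k0 <= k)%N -> @H2_ R k = @H2_ R k0).
Proof.
(* The power of [z.2] with exponent [- (k0 + 1)] is just allowed at level [k0 + 1] and just
   forbidden at level [k0]. *)
move=> [k0 stab]; pose p : int * int := (0, - k0.+1%:Z).
have Hp : H2_ k0 (monomialT p).
  rewrite -(stab k0.+1)//; apply: A_H2; apply: A_monomialT.
  by rewrite /allowed /= addr0 addNr.
have := H2_fourier0 Hp (p := p).
rewrite fourierE innerT_monomialT eqxx mulVf ?K_neq0// => h.
have /h /eqP : ~~ allowed k0 p; last by rewrite oner_eq0.
rewrite /allowed /=.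
by have -> : - k0.+1%:Z + 0 + k0%:Z = -1 by rewrite -addn1 PoszD; ring.
Qed.

End HardySpace.

(** * The Szego kernel *)

Section Szego.
Variable R : realType.
Local Notation C := R[i].
Local Notation C2 := (R[i] * R[i])%type.
Local Notation angles := (measurableTypeR R * measurableTypeR R)%type.
Local Notation modulus := (@Normc.normc R).
Local Notation tau := (pi *+ 2 : R).
Local Notation monomialT := (@monomialT R).
Local Notation hartogs := (@hartogs R).
Local Notation torus := (@torus R).
Local Notation K := ((4 * pi ^+ 2)%:C%C : C).
Implicit Types (f g h F G : C2 -> C) (p q : int * int) (k : nat) (z w : C2).

(** Enumerates the allowed exponents by pairs of naturals, turning the kernel into a product of two
    geometric series. *)
Definition square_index k (a b : nat) : int * int := (a%:Z, b%:Z - a%:Z - k%:Z).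

(** The two factors are the series in [y / x] and in [x]. The constant 3 is 1 for the error of the
    first factor plus 2 for that of the second, whose cofactor is a partial sum bounded by
    [2 / (1 - q)]. *)
Lemma geometric_products (x y : C) N : modulus y < modulus x -> modulus x < 1 ->
  modulus (x / (x - y) * (1 - x)^-1 -
    (\sum_(a < N) y ^+ a * x ^- a) * (\sum_(b < N) x ^+ b)) <=
  let q := modulus y / modulus x in
  ((q ^+ N) + modulus x ^+ N) * (3 / ((1 - q) * (1 - modulus x))).
Proof.
move=> yx x1; set q := modulus y / modulus x => /=.
have x0 : 0 < modulus x by apply: le_lt_trans yx; exact: modulus_ge0.
have q0 : 0 <= q by rewrite divr_ge0 ?modulus_ge0.
have q1 : q < 1 by rewrite ltr_pdivrMr// mul1r.
have h1 := kernel_remainder N yx; rewrite -/q in h1.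
have := @kernel_remainder R N 1 x; rewrite modulus1 divr1 => /(_ x1).
have -> : \sum_(b < N) x ^+ b * 1 ^- b = \sum_(b < N) x ^+ b.
  by apply: eq_bigr => b _; rewrite expr1n invr1 mulr1.
rewrite mul1r => h2.
(* With no terms in the sum, the remainder estimate bounds the full factor. *)
have := @kernel_remainder R 0 x y yx; rewrite big_ord0 subr0 expr0 mul1r -/q => h3.
have := @kernel_remainder R 0 1 x; rewrite modulus1 big_ord0 subr0 expr0 !divr1 !mul1r => /(_ x1) h4.
move: h1 h2 h3 h4.
set A := x / (x - y); set B := (1 - x)^-1.
set A' := \sum_(a < N) _; set B' := \sum_(b < N) _.
set s := (1 - q)^-1; set t := (1 - modulus x)^-1 => h1 h2 h3 h4.
have s0 : 0 < s by rewrite invr_gt0 subr_gt0.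
have t0 : 0 < t by rewrite invr_gt0 subr_gt0.
have -> : 3 / ((1 - q) * (1 - modulus x)) = 3 * (s * t) by rewrite invfM.
have qN0 : 0 <= q ^+ N by rewrite exprn_ge0.
have qN1 : q ^+ N <= 1 by rewrite exprn_ile1// ltW.
have xN0 : 0 <= modulus x ^+ N by rewrite exprn_ge0// ltW.
have -> : A * B - A' * B' = (A - A') * B + A' * (B - B') by ring.
apply: le_trans (modulusD _ _) _; rewrite !modulusM.
have hA' : modulus A' <= 2 * s.
  rewrite -[A'](subKr A); apply: le_trans (modulusB _ _) _.
  rewrite mulr2n mulrDl mul1r; apply: lerD => //; apply: le_trans h1 _.
  by rewrite ler_piMl// ltW.
have b1 : modulus (A - A') * modulus B <= q ^+ N * s * t.
  by apply: ler_pM; rewrite ?modulus_ge0.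
have b2 : modulus A' * modulus (B - B') <= 2 * s * (modulus x ^+ N * t).
  by apply: ler_pM; rewrite ?modulus_ge0.
apply: le_trans (lerD b1 b2) _.
have st : 0 <= s * t by rewrite mulr_ge0// ltW.
have e1 : 0 <= q ^+ N * (s * t) by exact: mulr_ge0.
have e2 : 0 <= modulus x ^+ N * (s * t) by exact: mulr_ge0.
move: (q ^+ N) (modulus x ^+ N) e1 e2 => u v e1 e2; lra.
Qed.

Definition szego_coef k z p : C := K^-1 * (monomialT p z)^*%C.

Definition szego_partial k z N w : C := \sum_(a < N) \sum_(b < N)
  szego_coef k z (square_index k a b) * monomialT (square_index k a b) w.

Lemma szego_partial_allowed k z N : allowed_poly k (szego_partial k z N).
Proof. exact: (allowed_poly_square k N N (fun a b => szego_coef k z (square_index k a b))). Qed.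

Lemma conj_inv_torus (w : C) : modulus w = 1 -> w^* = w^-1.
Proof.
move=> w1; have w0 : w != 0 by rewrite -modulus_gt0 w1.
apply: (mulfI w0); rewrite mulfV// -[LHS]sqr_normc normE w1.
by rewrite -rmorphXn expr1n.
Qed.

Lemma monomialT_square k a b (z : C2) : z.2 != 0 ->
  monomialT (square_index k a b) z = z.2 ^- k * (z.1 / z.2) ^+ a * z.2 ^+ b.
Proof.
move=> z20; rewrite /Defs.monomialT /square_index /= !expfzDr// -!exprnN -!exprnP exprMn exprVn.
ring.
Qed.

Lemma modulus_conjB (x y : C) : modulus (x^* - y) = modulus (x - y^*).
Proof. by case: x => a b; case: y => c d /=; congr Num.sqrt; ring. Qed.

Lemma conj_monomialT_square k a b w : modulus w.1 = 1 -> modulus w.2 = 1 ->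
  (monomialT (square_index k a b) w)^* = w.2 ^+ k * (w.2 / w.1) ^+ a * w.2 ^- b.
Proof.
move=> w1 w2; rewrite conj_inv_torus.
  rewrite monomialT_square; last by rewrite -modulus_gt0 w2.
  by rewrite !invfM invrK -exprVn invfM invrK [w.1^-1 * _]mulrC.
by rewrite modulusM !modulus_exprz w1 w2 !exp1rz mulr1.
Qed.

Lemma conjK (x : C) : (x^*%C)^* = x.
Proof. exact: conjcK. Qed.

Lemma conjKV : (K^-1)^* = K^-1.
Proof. by rewrite fmorphV; congr (_^-1); exact: conjc_real. Qed.

Lemma conj_szego_term k z p w :
  (szego_coef k z p * monomialT p w)^* = K^-1 * (monomialT p z * (monomialT p w)^*).
Proof.
rewrite /szego_coef; move: (monomialT p z) (monomialT p w) => x y.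
have h1 : (K^-1 * x^*%C * y)^* = (K^-1 * x^*%C)^* * y^* by exact: rmorphM.
have h2 : (K^-1 * x^*%C)^* = (K^-1)^* * (x^*%C)^* by exact: rmorphM.
by rewrite h1 h2 conjK conjKV -mulrA.
Qed.

Lemma szego_approx k z : hartogs z -> forall e : R, 0 < e -> exists N0, forall N t,
  (N0 <= N)%N ->
  modulus ((szego_ k z (polar t))^* - szego_partial k z N (polar t)) <= e.
Proof.
move=> hz e e0; have [z12 z21] := (hartogsE z).1 hz.
have z20 := hartogs_neq0 hz.
have m20 : 0 < modulus z.2 by rewrite modulus_gt0.
set q := modulus z.1 / modulus z.2; set r := modulus z.2 in z12 z21 m20 q *.
have q01 : 0 <= q < 1.
  by rewrite /q divr_ge0 ?modulus_ge0//= ltr_pdivrMr// mul1r.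
have r01 : 0 <= r < 1 by rewrite ltW.
pose L := modulus K^-1 * r ^- k * (3 / ((1 - q) * (1 - r))).
have [q0 q1] := andP q01.
have L0 : 0 <= L.
  rewrite !mulr_ge0 ?modulus_ge0 ?invr_ge0 ?exprn_ge0 ?(ltW m20)//.
  by rewrite mulr_ge0// subr_ge0 ltW.
have [N1 N1P] := geometric_small L q01 (divr_gt0 e0 (ltr0n _ 2)).
have [N2 N2P] := geometric_small L r01 (divr_gt0 e0 (ltr0n _ 2)).
exists (maxn N1 N2) => N t; rewrite geq_max => /andP[N1N N2N].
set w := polar t; have [w1 w2] : modulus w.1 = 1 /\ modulus w.2 = 1 by rewrite !modulus_expi.
pose x := z.2 * (w.2)^*; pose y := z.1 * (w.1)^*.
have mx : modulus x = r by rewrite /x modulusM modulus_conj w2 mulr1.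
have my : modulus y = modulus z.1 by rewrite /y modulusM modulus_conj w1 mulr1.
have x0 : x != 0 by rewrite -modulus_gt0 mx.
have xy : x - y != 0.
  by rewrite subr_eq0; apply/eqP => h; move: z12; rewrite -my -h mx ltxx.
(* The exponent [- (k - 1)] supplies [x ^- k] and the numerator that makes [x / (x - y)] a geometric
   series in [y / x]. *)
have sE : szego_ k z w = K^-1 * x ^- k * (x / (x - y) * (1 - x)^-1).
  rewrite /szego_ -/x -/y opprB expfzDr// expr1z -exprnN invfM.
  ring.
have pE : (szego_partial k z N w)^* =
    K^-1 * x ^- k * ((\sum_(a < N) y ^+ a * x ^- a) * (\sum_(b < N) x ^+ b)).
  rewrite /szego_partial rmorph_sum /= mulr_suml mulr_sumr; apply: eq_bigr => a _.
  rewrite rmorph_sum /= !mulr_sumr; apply: eq_bigr => b _.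
  have w20 : w.2 != 0 by rewrite -modulus_gt0 w2.
  rewrite (conj_szego_term k z (square_index k a b) w).
  rewrite -[RHS]mulrA; congr (_ * _).
  rewrite (conj_monomialT_square k a b w1 w2) monomialT_square//.
  rewrite /x /y (conj_inv_torus w1) (conj_inv_torus w2) !exprMn !exprVn !invfM !invrK.
  ring.
rewrite modulus_conjB sE pE -mulrBr modulusM.
have := @geometric_products x y N; rewrite mx my -/q => /(_ z12 z21) h; cbv zeta in h.
have hK : modulus (K^-1 * x ^- k) = modulus K^-1 * r ^- k.
  by rewrite modulusM [modulus (x ^- k)]modulusV modulusX mx.
apply: le_trans (ler_wpM2l (modulus_ge0 _) h) _; rewrite hK.
rewrite [X in _ * X]mulrC mulrA -/L mulrDr (splitr e); apply: lerD.
  apply: le_trans (ltW N1P); apply: ler_wpM2l => //.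
  by apply: ler_wiXn2l => //; exact: ltW.
apply: le_trans (ltW N2P); apply: ler_wpM2l => //.
by apply: ler_wiXn2l => //; exact: ltW.
Qed.

Definition szego_conj k z w : C := (szego_ k z w)^*.

Lemma szego_conj_H2 k z : hartogs z -> H2_ k (szego_conj k z).
Proof.
move=> hz; apply: uniform_limit_H2 => e /(szego_approx k hz)[N NP].
exists (szego_partial k z N); first exact: szego_partial_allowed.
by move=> t; exact: NP.
Qed.

Lemma innerT_szego_partial k z N (a b : nat) : (a < N)%N -> (b < N)%N ->
  innerT (szego_partial k z N) (monomialT (square_index k a b)) =
  (monomialT (square_index k a b) z)^*%C.
Proof.
move=> aN bN; pose p := square_index k a b.
have LM c q : L2T (fun w => c * monomialT q w).
  by apply: L2T_scale; exact: L2T_monomialT.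
have Lp := @L2T_monomialT R p.
rewrite innerT_sum//; last by move=> i; apply: L2T_sum.
rewrite (bigD1 (Ordinal aN))//= [X in _ + X]big1 ?addr0.
  rewrite innerT_sum// (bigD1 (Ordinal bN))//= [X in _ + X]big1 ?addr0.
    rewrite innerTZ; [|exact: L2T_monomialT|exact: L2T_monomialT].
    by rewrite innerT_monomialT eqxx /szego_coef mulrAC mulVf ?K_neq0 ?mul1r.
  move=> j jb; rewrite innerTZ; [|exact: L2T_monomialT|exact: L2T_monomialT].
  rewrite innerT_monomialT ifN ?mulr0//.
  apply: contra jb => /eqP[] /(congr1 (fun i => i + k%:Z + a%:Z)).
  by rewrite !subrK => -[jb]; apply/eqP/val_inj.
move=> i ia; rewrite innerT_sum// big1// => j _.
rewrite innerTZ; [|exact: L2T_monomialT|exact: L2T_monomialT].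
rewrite innerT_monomialT ifN ?mulr0//.
by apply: contra ia => /eqP[ia _]; apply/eqP/val_inj.
Qed.

Lemma allowed_square_index k p : allowed k p -> exists a b, p = square_index k a b.
Proof.
case: p => -[a|//] l /andP[/= _]; case E : (l + a%:Z + k%:Z) => [b|//] _.
by exists a, b; rewrite /square_index -E; congr pair; ring.
Qed.

Lemma innerT_monomialT_szego k z p : hartogs z -> allowed k p ->
  innerT (monomialT p) (szego_conj k z) = monomialT p z.
Proof.
move=> hz /allowed_square_index[a [b ->]]; set p' := square_index k a b.
have [Ls _] := szego_conj_H2 k hz; have Lp := @L2T_monomialT R p'.
have t0 := tau_gt0 R.
apply/eqP; rewrite -subr_eq0 -modulus_eq0 -sqrf_eq0; apply/eqP.
apply: (@eq0_le_mul_pos _ _ (sqT (monomialT p'))) => [|e e0]; first exact: sqr_ge0.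
(* This uniform error on the torus has squared norm at most [e]. *)
have s0 : 0 < Num.sqrt e / tau by rewrite divr_gt0 ?sqrtr_gt0.
have [N0 N0P] := szego_approx k hz s0.
pose N := maxn N0 (maxn a b).+1.
have NP t := N0P N t (leq_maxl _ _).
have aN : (a < N)%N by rewrite leq_max ltnS leq_maxl orbT.
have bN : (b < N)%N by rewrite leq_max ltnS leq_maxr orbT.
have LP := allowed_poly_L2T (szego_partial_allowed k z N).
have -> : innerT (monomialT p') (szego_conj k z) - monomialT p' z =
    (innerT (fun w => szego_conj k z w - szego_partial k z N w) (monomialT p'))^*%C.
  rewrite innerTB// (innerT_szego_partial k z aN bN) rmorphB /= conjcK.
  by rewrite (innerT_conj Ls Lp).
rewrite modulus_conj.
apply: le_trans (cauchy_schwarz (L2T_sub Ls LP) Lp) _.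
rewrite mulrC; apply: ler_wpM2l; first exact: sqT_ge0.
apply: le_trans (bounded_sqT (L2T_sub Ls LP) NP) _.
by rewrite divfK ?gt_eqF// sqr_sqrtr// ltW.
Qed.

(** The identity holds for allowed polynomials. The approximant is close to [F] on the torus, which
    controls the inner product, and at [z], which controls the value. *)
Lemma innerT_A_szego k z F : hartogs z -> A_ k F ->
  innerT F (szego_conj k z) = F z.
Proof.
move=> hz AF; have [Ls _] := szego_conj_H2 k hz; have LF := A_L2T AF.
apply/eqP; rewrite -subr_eq0 -modulus_eq0; apply/eqP.
apply: (@eq0_le_mul_pos _ _ (tau * Num.sqrt (sqT (szego_conj k z)) + 1)) => [|e e0].
  exact: modulus_ge0.
have [P AP [FP FPz]] := A_poly_approx AF hz e0.
have LP := allowed_poly_L2T AP.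
have PE : innerT P (szego_conj k z) = P z.
  case: AP => A [c [hA PE]]; rewrite (_ : P = trig A c); last by apply/funext.
  rewrite innerT_sum//; last by move=> p; apply: L2T_scale; exact: L2T_monomialT.
  rewrite /trig big_seq [RHS]big_seq; apply: eq_bigr => p pA.
  rewrite innerTZ//; last exact: L2T_monomialT.
  by rewrite innerT_monomialT_szego//; exact: hA.
have -> : innerT F (szego_conj k z) - F z =
    innerT (fun w => F w - P w) (szego_conj k z) - (F z - P z).
  by rewrite innerTB// PE opprB addrA subrK.
apply: le_trans (modulusB _ _) _; rewrite mulrDl mul1r; apply: lerD => //.
rewrite -(@ler_pXn2r _ 2)// ?nnegrE ?modulus_ge0//; last first.
  by rewrite !mulr_ge0 ?sqrtr_ge0 ?ltW ?tau_gt0.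
apply: le_trans (cauchy_schwarz (L2T_sub LF LP) Ls) _.
set S := sqT (szego_conj k z).
have -> : (tau * Num.sqrt S * e) ^+ 2 = (e * tau) ^+ 2 * S.
  have S0 : 0 <= S by exact: sqT_ge0.
  by rewrite -[in RHS](sqr_sqrtr S0); ring.
apply: ler_wpM2r; first exact: sqT_ge0.
exact: bounded_sqT (L2T_sub LF LP) FP.
Qed.

Lemma szegoE k z f : integralT (fun w => f w * szego_ k z w) = innerT f (szego_conj k z).
Proof. by apply: eq_cint => t _; rewrite /szego_conj conjCK. Qed.

Lemma szego_evaluation k z : hartogs z ->
  is_evaluation k z (fun f => integralT (fun w => f w * szego_ k z w)).
Proof.
move=> hz; have [Ls _] := szego_conj_H2 k hz; split.
- move=> a f g [Lf _] [Lg _]; rewrite !szegoE innerTD//; last exact: L2T_scale.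
  by rewrite innerTZ.
- exists (Num.sqrt (sqT (szego_conj k z))) => f [Lf _].
  rewrite szegoE normTE// -EFinM lee_fin.
  rewrite -ler_sqr ?nnegrE ?modulus_ge0 ?mulr_ge0 ?sqrtr_ge0//.
  apply: le_trans (cauchy_schwarz Lf Ls) _.
  by rewrite exprMn !sqr_sqrtr ?sqT_ge0// mulrC.
- by move=> F AF; rewrite szegoE innerT_A_szego.
Qed.

Lemma evaluation_unique k z Ev1 Ev2 f : is_evaluation k z Ev1 ->
  is_evaluation k z Ev2 -> H2_ k f -> Ev1 f = Ev2 f.
Proof.
move=> [lin1 [M1 bd1] ev1] [lin2 [M2 bd2] ev2] hf.
apply/eqP; rewrite -subr_eq0 -modulus_eq0; apply/eqP.
apply: (@eq0_le_mul_pos _ _ (`|M1| + `|M2|)) => [|e e0]; first exact: modulus_ge0.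
have [Lf /(_ e e0)[F AF fF]] := hf.
have HF := A_H2 AF; have LF := A_L2T AF.
(* [is_evaluation] states linearity for functions of the form [a * f + g] only, so the difference is
   put in that form. *)
have D0 : (fun w => -1 * F w + f w) = (fun w => f w - F w).
  by apply/funext => w; rewrite mulN1r addrC.
have HfF : H2_ k (fun w => -1 * F w + f w).
  rewrite D0; split=> [|e' e'0]; first exact: L2T_sub.
  have [_ /(_ e' e'0)[G AG fG]] := hf.
  exists (fun w => G w - F w); first exact: A_sub.
  rewrite (_ : (fun _ => _) = (fun w => f w - G w))//.
  by apply/funext => w; rewrite opprB addrA subrK.
have le_e M Ev : (forall f, H2_ k f -> ((modulus (Ev f))%:E <= M%:E * normT f)%E) ->
    modulus (Ev (fun w => -1 * F w + f w)) <= `|M| * e.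
  move=> /(_ _ HfF); rewrite D0 (normTE (L2T_sub Lf LF)) -EFinM lee_fin => h.
  move: fF; rewrite (normTE (L2T_sub Lf LF)) lte_fin => fF.
  apply: le_trans h _; apply: (@le_trans _ _ (`|M| * Num.sqrt (sqT (fun w => f w - F w)))).
    by rewrite ler_wpM2r ?sqrtr_ge0// ler_norm.
  by rewrite ler_wpM2l// ltW.
have -> : Ev1 f - Ev2 f = Ev1 (fun w => -1 * F w + f w) - Ev2 (fun w => -1 * F w + f w).
  by rewrite lin1// lin2// (ev1 F AF) (ev2 F AF); ring.
by apply: le_trans (modulusB _ _) _; rewrite mulrDl; apply: lerD; exact: le_e.
Qed.

Lemma H2_sub k f g : H2_ k f -> H2_ k g -> H2_ k (fun w => f w - g w).
Proof.
move=> [Lf hf] [Lg hg]; split=> [|e e0]; first exact: L2T_sub.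
have e2 : 0 < e / 2 by rewrite divr_gt0.
have [F AF fF] := hf _ e2; have [G AG gG] := hg _ e2.
have LF := A_L2T AF; have LG := A_L2T AG.
exists (fun w => F w - G w); first exact: A_sub.
have LfF := L2T_sub Lf LF; have LgG := L2T_sub Lg LG.
have -> : (fun w => f w - g w - (F w - G w)) = (fun w => (f w - F w) + (-1) * (g w - G w)).
  by apply/funext => w; ring.
have Lm := L2T_scale (-1) LgG.
apply/normT_lt => //; first exact: L2T_add.
apply: le_lt_trans (sqT_le_add LfF Lm) _; rewrite sqT_scale// modulusN modulus1 expr1n mul1r.
move/(normT_lt LfF e2) : fF; move/(normT_lt LgG e2) : gG.
by rewrite exprMn exprVn => h1 h2; have : (2 : R) ^+ 2 = 4 by [ring]; move=> E; move: h1 h2; rewrite E; lra.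
Qed.

Lemma szego_is_kernel k : is_szego_kernel k (@szego_ R k).
Proof.
have rep : reproduces k (@szego_ R k).
  move=> z hz; split; first exact: szego_conj_H2.
  by exists (fun f => integralT (fun w => f w * szego_ k z w)); first exact: szego_evaluation.
split=> // s' rep' z hz.
have [Hs' [Ev' ev' E']] := rep' z hz; have [Hs [Ev ev E]] := rep z hz.
(* [g] lies in [H2_ k], where both kernels represent the same functional. Hence [g] has equal inner
   products with the two conjugate kernels, and [sqT g = 0]. *)
pose g w := (s' z w)^* - (szego_ k z w)^*.
have Hg : H2_ k g by exact: H2_sub.
have [Lg _] := Hg; have [Ls' _] := Hs'; have [Ls _] := Hs.
have E2 : innerT g (fun w => (s' z w)^*) = innerT g (fun w => (szego_ k z w)^*).
  have -> : innerT g (fun w => (s' z w)^*) = integralT (fun w => g w * s' z w).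
    by apply: eq_cint => t _; rewrite conjCK.
  by rewrite -szegoE -E'// -E//; exact: evaluation_unique ev' ev Hg.
have g0 : sqT g = 0.
  apply: complexI; rewrite -innerTT (innerT_conj Lg Lg).
  rewrite {1}/g innerTB// (innerT_conj Lg Ls') (innerT_conj Lg Ls) E2 subrr.
  exact: conjc0.
have := sqT_eq0 Lg g0; apply: filterS => t /eqP; rewrite subr_eq0 => /eqP.
by move=> /(congr1 (fun x : C => (x^*)%C)); rewrite !conjcK.
Qed.

End Szego.

Unset Implicit Arguments.

Theorem theorem6p1 (R : realType) :
  [/\ forall k : nat,
        @H2_ R k = [set f | [/\ L2T f, sumsT (fourier f) f
          & forall j l : int, Num.min j (l + j + k%:Z) < 0 ->
              fourier f (j, l) = 0]],
      ~ (exists k0 : nat, forall k : nat, (k0 <= k)%N -> @H2_ R k = @H2_ R k0)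
    & forall k : nat, is_szego_kernel k (@szego_ R k)].
Proof.
split; [exact: H2_characterization | exact: H2_not_stabilize | exact: szego_is_kernel].
Qed.
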